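(* Let $1\le j<k$ and $s\ge 2$ be integers. There is a constant $c=c(s,k,j)>0$ such that the following holds. Let $0\le p_1=p_1(n)\le\dots\le p_s=p_s(n)\le 1$ and let $H\sim H_k(n,p_1,\dots,p_s)$. (i) If $p_1\le\frac{\log n}{cn^{k-j}}$, or if for some $2\le r\le s$ we have $\prod_{i=1}^r p_i\le\frac{1}{c\,n^{r(k-j-1)+1}(\log n)^{r-1}}$, then with high probability $H$ does not $j$-percolate. (ii) If $p_1\ge\frac{c\log n}{n^{k-j}}$ and for every $2\le r\le s$ we have $\prod_{i=1}^r p_i\ge\frac{c}{n^{r(k-j-1)+1}(\log n)^{r-1}}$, then with high probability $H$ $j$-percolates.
   Context: The binomial random $s$-fold $k$-graph $H_k(n,p_1,\dots,p_s)$ has vertex set $[n]$, and each $k$-subset of $[n]$ forms an $i$-edge (an edge of colour $i$) with probability $p_i$, independently for all $1\le i\le s$ and all $k$-subsets. $j$-jigsaw percolation on an $s$-fold $k$-graph with vertex set $V$: start with the partition of $V^{(j)}$ (the set of $j$-subsets of $V$) into singletons (clusters); at each time step form an auxiliary graph on the clusters where distinct clusters $C,C'$ are adjacent iff for every colour $i\in\{1,\dots,s\}$ there is an $i$-edge containing some $j$-set of $C$ and some $j$-set of $C'$; stop if this graph has no edges, otherwise merge the clusters in each connected component, and stop if a single cluster remains. $H$ $j$-percolates if the process ends with a single cluster. ''With high probability'' means with probability tending to $1$ as $n\to\infty$. *)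

(* Defs.v *)
From mathcomp Require Import all_boot all_order all_algebra.
From mathcomp Require Import boolp classical_sets reals topology normedtype sequences exp.

Set Implicit Arguments.
Unset Strict Implicit.
Unset Printing Implicit Defensive.

Import Order.TTheory GRing.Theory Num.Theory.
Import numFieldTopology.Exports numFieldNormedType.Exports.

(* The set [n]^(m) of m-subsets of the vertex set [n] = 'I_n. *)
Definition subsets (n m : nat) : finType := {A : {set 'I_n} | #|A| == m}.

(* H i is the set of edges of colour i. *)
Definition sfold_graph (s k n : nat) : finType := {ffun 'I_s -> {set subsets n k}}.

Section Percolation.
Variables (s k n j : nat) (H : sfold_graph s k n).

Definition jcluster : finType := {set subsets n j}.

Definition initial_clusters : {set jcluster} :=
  [set [set J] | J in [set: subsets n j]].

Definition jigsaw_adj (P : {set jcluster}) : rel jcluster := fun C C' =>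
  [&& C \in P, C' \in P, C != C' &
    [forall i : 'I_s, exists e in H i,
      [exists J in C, val J \subset val e] &&
      [exists J in C', val J \subset val e]]].

(* If no two clusters are adjacent then every component is a singleton and
   merge_step P = P, so iterating merge_step past the stopping time changes nothing. *)
Definition merge_step (P : {set jcluster}) : {set jcluster} :=
  [set finset.cover [set C' in P | connect (jigsaw_adj P) C C'] | C in P].

Definition percolates : Prop :=
  exists t : nat, #|iter t merge_step initial_clusters| = 1%N.

End Percolation.

Local Open Scope ring_scope.

Section RandomGraph.
Variables (R : realType) (s k n : nat) (p : 'I_s -> R).

(* Probability mass function of H_k(n, p_1, ..., p_s). *)
Definition sfold_graph_mass (H : sfold_graph s k n) : R :=
  \prod_(i < s) \prod_(e : subsets n k)
    (if e \in H i then p i else 1 - p i).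

Definition sfold_graph_prob (A : sfold_graph s k n -> Prop) : R :=
  \sum_(H : sfold_graph s k n | `[< A H >]) sfold_graph_mass H.

End RandomGraph.

Local Open Scope classical_set_scope.

Definition whp (R : realType) (s k : nat) (p : nat -> 'I_s -> R)
    (A : forall n, sfold_graph s k n -> Prop) : Prop :=
  sfold_graph_prob (p n) (A n) @[n --> \oo] --> (1 : R).

(* Main.v *)
(* Percolation is equivalent to every stable labelling of the j-sets being
   constant, where a labelling is stable if classes that are linked by an edge
   of every colour coincide.

   Below the threshold for p_1, a second moment computation produces a j-set
   contained in no edge of colour 1. Below the threshold for p_1...p_r,
   percolation in the first r colours would produce a set S of order log n
   j-sets connected in each of them. Let E be a smallest connecting family over
   all these colours: it is a rooted connected family of m edges with m of order
   |S|, and every other colour has at least m edges containing two members of S.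
   Counting E as a lattice animal and the other families as m-subsets, a union
   bound rules this out; taking the smallest family is what makes edges that
   contain many j-sets harmless.

   Above the thresholds, fix a (j-1)-set L and a quarter F of the vertices, and
   join u and v in colour i when some i-edge consists of L, u, v and vertices of
   F: this gives independent binomial graphs on the remaining vertices. Many
   sequential attempts, each succeeding with probability at least n^(-1/2), find
   a jointly spanned nucleus of order log n; it doubles repeatedly inside a
   second quarter of the vertices up to linear size, and then absorbs all other
   vertices. The failure probability is o(n^(-j)), so this holds for all L
   simultaneously, and exchanging one element at a time connects all j-sets. *)

Require Import Defs.
From mathcomp Require Import all_boot all_order all_algebra.
From mathcomp Require Import boolp reals sequences exp.
From mathcomp Require Import zify ring lra.

Set Implicit Arguments.
Unset Strict Implicit.
Unset Printing Implicit Defensive.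

Import Order.TTheory GRing.Theory Num.Theory.

(** * Stable labellings *)

(** The thresholds can be read off from two balances. Below them, each edge of [E] costs a factor of
    order n^(k-j) for growing the animal, every other colour a factor of order n^(k-j-1) log n, and
    p_1...p_r is gained; the product is a constant over c, and order log n edges turn it into a
    power of n that beats the number of roots. Above them, a set of t vertices has at least order c
    t (t/log n)^(s-1) joint neighbours on average, as long as this is below order n: from t of order
    log n on, this is a large multiple of t and doubling is nearly certain, while smaller sets grow
    only by luck. The obstacle in the second part is dependence. An exploration is treated as a
    random variable whose event [X om == y] depends only on a set [D y] of coordinates, and each
    continuation must live on the complement. The decisive case is a failed nucleus attempt: it has
    revealed only coordinates touching the small set it ended with, so this set is all that is given
    up, not the large blocks that were searched. That is why almost n/log n attempts fit into a
    linear number of vertices. *)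

Section Stable.
Variables (s k n j : nat) (H : sfold_graph s k n).

(** The j-sets [J] and [J'] only name two label classes: each colour may use its own representatives
    [J1], [J1'], as cluster adjacency does. *)
Definition linked (T : eqType) (f : subsets n j -> T) (J J' : subsets n j) :=
  forall i, exists2 E, E \in H i & exists J1 J1',
    [/\ f J1 = f J, f J1' = f J', val J1 \subset val E & val J1' \subset val E].

Definition stable (T : eqType) (f : subsets n j -> T) :=
  forall J J', linked f J J' -> f J = f J'.

Lemma jigsaw_adjP (P : {set jcluster n j}) (C C' : jcluster n j) :
  reflect [/\ C \in P, C' \in P, C != C' & forall i, exists2 E, E \in H i &
              exists J J', [/\ J \in C, J' \in C', val J \subset val E & val J' \subset val E]]
          (jigsaw_adj H P C C').
Proof.
apply: (iffP and4P) => -[CP C'P nCC' adj]; split => //.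
  move=> i; move/forallP/(_ i)/existsP: adj => [E /and3P[EH]].
  move=> /existsP[J /andP[JC JE]] /existsP[J' /andP[J'C J'E]].
  by exists E => //; exists J, J'.
apply/forallP => i; have [E EH [J [J' [JC J'C JE J'E]]]] := adj i.
apply/existsP; exists E; rewrite EH /=; apply/andP; split; apply/existsP.
  by exists J; rewrite JC.
by exists J'; rewrite J'C.
Qed.

Lemma jigsaw_adj_sym (P : {set jcluster n j}) : symmetric (jigsaw_adj H P).
Proof.
move=> C C'; apply/jigsaw_adjP/jigsaw_adjP => -[CP C'P nCC' adj]; split => //;
  rewrite 1?eq_sym // => i; have [E EH [J [J' [JC J'C JE J'E]]]] := adj i;
  by exists E => //; exists J', J.
Qed.

Lemma connect_jigsaw_mem (P : {set jcluster n j}) (C C' : jcluster n j) :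
  C \in P -> connect (jigsaw_adj H P) C C' -> C' \in P.
Proof.
move=> CP /connectP[q]; elim/last_ind: q C' => [|q D IHq] C' /=; first by move=> _ ->.
rewrite rcons_path last_rcons => /andP[_ /and4P[_ DP _ _]] ->; exact: DP.
Qed.

Lemma initial_clusters_partition :
  partition (initial_clusters n j) [set: subsets n j].
Proof.
apply/and3P; split.
- apply/eqP/setP => J; rewrite inE; apply/bigcupP; exists [set J]; last by rewrite inE.
  by apply/imsetP; exists J; rewrite ?inE.
- apply/trivIsetP => _ _ /imsetP[J _ ->] /imsetP[J' _ ->] nJJ'.
  by rewrite disjoints1 inE; apply: contraNneq nJJ' => ->.
- apply/imsetP => -[J _ /setP/(_ J)]; by rewrite !inE eqxx.
Qed.

Lemma mem_merge_step (P : {set jcluster n j}) C J : C \in P ->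
  reflect (exists2 C', connect (jigsaw_adj H P) C C' & J \in C')
    (J \in cover [set C' in P | connect (jigsaw_adj H P) C C']).
Proof.
move=> CP; apply: (iffP bigcupP) => [[C'] | [C' cCC' JC']].
  by rewrite inE => /andP[_ cCC'] JC'; exists C'.
by exists C'; rewrite // inE cCC' (connect_jigsaw_mem CP cCC').
Qed.

Lemma merge_step_partition (P : {set jcluster n j}) :
  partition P [set: subsets n j] ->
  partition (merge_step H P) [set: subsets n j].
Proof.
case/and3P=> /eqP covP trivP P0.
have csym : connect_sym (jigsaw_adj H P).
  exact/sym_connect_sym/jigsaw_adj_sym.
apply/and3P; split.
- apply/eqP/setP => J; rewrite inE.
  have : J \in cover P by rewrite covP inE.
  case/bigcupP => C CP JC; apply/bigcupP.
  exists (cover [set C' in P | connect (jigsaw_adj H P) C C']).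
    by apply/imsetP; exists C.
  by apply/(mem_merge_step _ CP); exists C.
- apply/trivIsetP => _ _ /imsetP[C CP ->] /imsetP[D DP ->].
  apply: contraR => /pred0Pn[J /andP[/(mem_merge_step _ CP)[C' cCC' JC']]].
  case/(mem_merge_step _ DP) => D' cDD' JD'.
  have eqCD' : C' = D'.
    have C'P := connect_jigsaw_mem CP cCC'; have D'P := connect_jigsaw_mem DP cDD'.
    apply/eqP; apply: contraTT (JC') => nCD'.
    by have /trivIsetP/(_ _ _ C'P D'P nCD')/disjointFl -> := trivP.
  apply/eqP; congr cover; apply/setP => B; rewrite !inE; congr (_ && _).
  by apply: same_connect => //; apply: connect_trans cCC' _; rewrite eqCD' csym.
- apply/imsetP => -[C CP]; apply/eqP; rewrite eq_sym; apply/set0Pn.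
  have /set0Pn[J JC] : C != set0 by apply: contraNneq P0 => <-.
  by exists J; apply/(mem_merge_step _ CP); exists C.
Qed.

Lemma iter_merge_partition t :
  partition (iter t (merge_step H) (initial_clusters n j)) [set: subsets n j].
Proof.
elim: t => [|t IHt] /=; [exact: initial_clusters_partition | exact: merge_step_partition].
Qed.

(** Clusters stay inside level sets of [f]: a merge follows a path of adjacencies, and each
    adjacency links two label classes. The first colour supplies a j-set of the cluster reached so
    far, which carries the label along the path. *)
Lemma percolates_stable (T : eqType) (f : subsets n j -> T) :
  (0 < s)%N -> percolates j H -> stable f -> forall J J', f J = f J'.
Proof.
move=> s_gt0 [t Pt1] stf.
have mono u C : C \in iter u (merge_step H) (initial_clusters n j) ->
    {in C &, forall J J', f J = f J'}.
  elim: u C => [|u IHu] C /=.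
    by case/imsetP => J _ -> J1 J2; rewrite !inE => /eqP-> /eqP->.
  case/imsetP => D DP -> J J'.
  set P := iter _ _ _ in IHu DP *.
  suff mon D' : connect (jigsaw_adj H P) D D' -> {in D & D', forall J J', f J = f J'}.
    have /set0Pn[J0 J0D] : D != set0.
      have /and3P[_ _ P0] := iter_merge_partition u.
      by apply: contraNneq P0 => <-.
    case/(mem_merge_step _ DP) => C1 c1 J1 /(mem_merge_step _ DP)[C2 c2 J2].
    by rewrite -(mon _ c1 J0 J) // (mon _ c2 J0 J').
  case/connectP => q; elim/last_ind: q D' => [|q D2 IHq] D' /=.
    by move=> _ ->; apply: IHu.
  rewrite rcons_path last_rcons => /andP[pq adj] -> J1 J2 J1D J2D2.
  set D1 := last D q in adj.
  case/jigsaw_adjP: adj => D1P D2P _ adj.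
  have [E _ [K1 [_ [K1D _ _ _]]]] := adj (Ordinal s_gt0).
  rewrite (IHq D1 pq erefl J1 K1) //; apply: stf => i.
  have [E' EH [K [K' [KD KD' KE KE']]]] := adj i.
  exists E' => //; exists K, K'; split => //; [exact: (IHu D1) | exact: (IHu D2)].
move=> J J'; case/eqP/cards1P: Pt1 => C PC.
have /and3P[/eqP cov _ _] := iter_merge_partition t.
have inC K : K \in C.
  have : K \in [set: subsets n j] by rewrite inE.
  by rewrite -cov PC /cover big_set1.
by apply: (mono t C); rewrite ?PC ?inE.
Qed.

(** Once a step does not lower the number of clusters, the merging map is injective, so adjacent
    clusters would coincide and there are none. Labelling each j-set by its own cluster is then
    stable, hence constant. *)
Lemma stable_percolates :
  (j <= n)%N -> (forall f : subsets n j -> jcluster n j, stable f -> forall J J', f J = f J') ->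
  percolates j H.
Proof.
move=> le_jn total_f.
pose P t := iter t (merge_step H) (initial_clusters n j).
(* The cluster count cannot drop strictly more than [#|P 0|] times. *)
have [t le_t] : exists t, (#|P t| <= #|P t.+1|)%N.
  have [/existsP[t tP] | /existsPn noP] :=
    boolP [exists t : 'I_(#|P 0|.+2), (#|P t| <= #|P t.+1|)%N]; first by exists t.
  suff dec t : (t <= #|P 0|.+1)%N -> (#|P t| + t <= #|P 0|)%N.
    by have := dec _ (leqnn _); lia.
  elim: t => [|t IHt] lt_t; first by rewrite addn0.
  have lt_t2 : (t < #|P 0|.+2)%N by lia.
  have lt_P : (#|P t.+1| < #|P t|)%N by rewrite ltnNge; exact: (noP (Ordinal lt_t2)).
  by have := IHt (ltnW lt_t); lia.
have partP : partition (P t) [set: subsets n j] by exact: iter_merge_partition.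
have /and3P[/eqP covP trivP P0] := partP.
have noadj C C' : ~~ jigsaw_adj H (P t) C C'.
  apply/negP => adj; have /and4P[CP C'P /negP nCC' _] := adj; apply: nCC'.
  have injP : {in P t &, injective (fun C => cover
      [set C' in P t | connect (jigsaw_adj H (P t)) C C'])}.
    by apply/imset_injP; rewrite eqn_leq leq_imset_card.
  apply/eqP; apply: injP => //; congr cover; apply/setP => B; rewrite !inE; congr (_ && _).
  apply: same_connect; first exact/sym_connect_sym/jigsaw_adj_sym.
  exact: connect1.
have mem_pb J : J \in pblock (P t) J by rewrite mem_pblock covP inE.
have pbP J : pblock (P t) J \in P t by rewrite pblock_mem // covP inE.
have const : forall J J', pblock (P t) J = pblock (P t) J'.
  apply: total_f => J J' link.
  apply/eqP; apply: contraT => nJJ'; have /negP := noadj (pblock (P t) J) (pblock (P t) J').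
  case; apply/jigsaw_adjP; split => // i.
  have [E EH [J1 [J1' [eJ eJ' ? ?]]]] := link i.
  by exists E => //; exists J1, J1'; rewrite -eJ -eJ' !mem_pb.
exists t; apply/eqP/cards1P.
have [J _] : exists J : subsets n j, true.
  have : (0 < #|[set A : {set 'I_n} | #|A| == j]|)%N by rewrite card_draws card_ord bin_gt0.
  by case/card_gt0P => A; rewrite inE => Aj; exists (exist _ A Aj).
exists (pblock (P t) J); apply/setP => C; rewrite inE; apply/idP/eqP => [CP | -> //].
have /set0Pn[K KC] : C != set0 by apply: contraNneq P0 => <-.
by rewrite (const J K) (def_pblock trivP CP KC).
Qed.

End Stable.

Local Open Scope ring_scope.

(** * Product Bernoulli measures on the subsets of a finite type *)

Section Bernoulli.
Variables (R : realFieldType) (I : finType) (w : I -> R).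

Definition mass (om : {set I}) : R :=
  \prod_x (if x \in om then w x else 1 - w x).

Definition expectation (f : {set I} -> R) : R := \sum_om mass om * f om.

Definition prob (A : pred {set I}) : R := expectation (fun om => (A om)%:R).

(** Measurability with respect to the coordinates in [D], as invariance under restriction; it
    applies to values of any type, such as the outcome of an exploration. *)
Definition depends_on (T : Type) (D : {set I}) (f : {set I} -> T) :=
  forall om, f (om :&: D) = f om.

Lemma depends_onS (T : Type) (D D' : {set I}) (f : {set I} -> T) :
  D \subset D' -> depends_on D f -> depends_on D' f.
Proof.
move=> /setIidPr sDD' fD om.
by rewrite -fD -setIA sDD' fD.
Qed.

Lemma eq_expectation f g : f =1 g -> expectation f = expectation g.
Proof. by move=> fg; apply: eq_bigr => om _; rewrite fg. Qed.

Lemma eq_prob A B : A =1 B -> prob A = prob B.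
Proof. by move=> AB; apply: eq_expectation => om; rewrite AB. Qed.

Lemma expectationD f g :
  expectation (fun om => f om + g om) = expectation f + expectation g.
Proof. by rewrite -big_split; apply: eq_bigr => om _; rewrite mulrDr. Qed.

Lemma expectationZ c f : expectation (fun om => c * f om) = c * expectation f.
Proof. by rewrite mulr_sumr; apply: eq_bigr => om _; rewrite mulrCA. Qed.

Lemma expectation_sum (J : Type) (r : seq J) (P : pred J) (F : J -> {set I} -> R) :
  expectation (fun om => \sum_(y <- r | P y) F y om) =
  \sum_(y <- r | P y) expectation (F y).
Proof.
rewrite exchange_big /=; apply: eq_bigr => om _.
by rewrite mulr_sumr.
Qed.

Lemma expectation_prod (F G : I -> R) :
  expectation (fun om => \prod_x (if x \in om then F x else G x)) =
  \prod_x (w x * F x + (1 - w x) * G x).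
Proof.
rewrite bigA_distr; apply: eq_bigr => om _; rewrite -big_split /=.
by apply: eq_bigr => x _; case: ifP.
Qed.

Lemma expectation1 : expectation (fun=> 1) = 1.
Proof.
transitivity (\prod_(x : I) (w x * 1 + (1 - w x) * 1)).
  rewrite -expectation_prod; apply: eq_expectation => om.
  by rewrite big1 // => x _; case: ifP.
by rewrite big1 // => x _; ring.
Qed.

Lemma expectation_cst c : expectation (fun=> c) = c.
Proof.
by rewrite -[RHS]mulr1 -expectation1 -expectationZ; apply: eq_expectation => om; rewrite mulr1.
Qed.

Lemma prob_cst (b : bool) : prob (fun=> b) = b%:R.
Proof. exact: expectation_cst. Qed.

Lemma probC A : prob (fun om => ~~ A om) = 1 - prob A.
Proof.
apply/eqP; rewrite eq_sym subr_eq -expectationD -[X in X == _]expectation1.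
by apply/eqP/eq_expectation => om; case: (A om); rewrite /= ?addr0 ?add0r.
Qed.

Lemma prob_prod_indicator (F G : pred I) :
  prob (fun om => [forall x, if x \in om then F x else G x]) =
  \prod_x (w x * (F x)%:R + (1 - w x) * (G x)%:R).
Proof.
rewrite -expectation_prod; apply: eq_expectation => om.
case: forallP => [allFG | nallFG].
  by rewrite big1 // => x _; move: (allFG x); case: ifP => _ ->.
have /existsP[x nx] : [exists x, ~~ (if x \in om then F x else G x)].
  by rewrite -negb_forall; apply/forallP.
by rewrite (bigD1 x) //=; move: nx; case: ifP => _ /negbTE->; rewrite mul0r.
Qed.

Lemma prob_pattern (A B : {set I}) : [disjoint A & B] ->
  prob (fun om => (A \subset om) && [disjoint B & om]) =
  (\prod_(x in A) w x) * \prod_(x in B) (1 - w x).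
Proof.
move=> dAB.
transitivity (prob (fun om => [forall x, if x \in om then x \notin B else x \notin A])).
  apply: eq_prob => om; apply/andP/forallP => [[/subsetP sA dB] x | H].
    case: ifPn => xom; last by apply: contra xom; apply: sA.
    by apply/negP => xB; rewrite (disjointFr dB xB) in xom.
  split; first by apply/subsetP => x xA; have := H x; case: ifP; rewrite ?xA.
  by rewrite disjoint_sym disjoint_subset; apply/subsetP => x xom; have := H x; rewrite xom.
rewrite prob_prod_indicator.
rewrite (big_mkcond (mem A)) (big_mkcond (mem B)) -big_split; apply: eq_bigr => x _ /=.
case: (boolP (x \in A)) => xA /=; case: (boolP (x \in B)) => xB /=; try ring.
by rewrite (disjointFr dAB xA) in xB.
Qed.

Lemma prob_subset (A : {set I}) : prob (fun om => A \subset om) = \prod_(x in A) w x.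
Proof.
have d0 : [disjoint A & (set0 : {set I})] by rewrite disjoint_sym disjoints_subset sub0set.
have := prob_pattern d0; rewrite [X in _ * X]big_set0 mulr1 => <-.
by apply: eq_prob => om; rewrite disjoints_subset sub0set andbT.
Qed.

Lemma prob_disjoint (B : {set I}) :
  prob (fun om => [disjoint B & om]) = \prod_(x in B) (1 - w x).
Proof.
have d0 : [disjoint (set0 : {set I}) & B] by rewrite disjoints_subset sub0set.
have := prob_pattern d0; rewrite [X in X * _]big_set0 mul1r => <-.
by apply: eq_prob => om; rewrite sub0set.
Qed.

(* Exchanging the coordinates in [D] of two independent copies preserves the
   product mass. *)
Lemma expectationM (D : {set I}) f g :
  depends_on D f -> depends_on (~: D) g ->
  expectation (fun om => f om * g om) = expectation f * expectation g.
Proof.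
move=> fD gD.
pose mix (a b : {set I}) := (a :&: D) :|: (b :&: ~: D).
pose swap (z : {set I} * {set I}) := (mix z.1 z.2, mix z.2 z.1).
have swapK : involutive swap.
  move=> [a b]; congr (_, _); apply/setP => x; rewrite !inE;
  by case: (x \in a); case: (x \in b); case: (x \in D).
rewrite [RHS]big_distrlr /= pair_big /= (reindex_inj (inv_inj swapK)) /=.
transitivity (\sum_(z : {set I} * {set I}) mass z.1 * mass z.2 * (f z.1 * g z.1)).
  rewrite -(pair_big xpredT xpredT (fun a b => mass a * mass b * (f a * g a))) /=.
  apply: eq_bigr => a _.
  rewrite -mulr_suml -mulr_sumr; congr (_ * _).
  rewrite -[LHS]mulr1 -[in LHS]expectation1; congr (_ * _).
  by apply: eq_bigr => b _; rewrite mulr1.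
apply: eq_bigr => -[a b] _ /=.
have mixD : mix a b :&: D = a :&: D.
  by apply/setP => x; rewrite !inE; case: (x \in a); case: (x \in b); case: (x \in D).
have mixDC : mix b a :&: ~: D = a :&: ~: D.
  by apply/setP => x; rewrite !inE; case: (x \in a); case: (x \in b); case: (x \in D).
rewrite -(fD (mix a b)) mixD fD -(gD (mix b a)) mixDC gD [RHS]mulrACA; congr (_ * _).
rewrite /mass -!big_split; apply: eq_bigr => x _ /=; rewrite !inE.
by case: (x \in a); case: (x \in b); case: (x \in D) => /=; rewrite 1?mulrC.
Qed.

Lemma probM (D : {set I}) A B : depends_on D A -> depends_on (~: D) B ->
  prob (fun om => A om && B om) = prob A * prob B.
Proof.
move=> AD BD; rewrite -(@expectationM D).
- by apply: eq_expectation => om; rewrite -mulnb natrM.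
- by move=> om; rewrite AD.
- by move=> om; rewrite BD.
Qed.

Lemma expectation_prod_indep (J : eqType) (r : seq J) (D : J -> {set I})
    (f : J -> {set I} -> R) :
  uniq r -> {in r &, forall u v, u != v -> [disjoint D u & D v]} ->
  {in r, forall u, depends_on (D u) (f u)} ->
  expectation (fun om => \prod_(u <- r) f u om) = \prod_(u <- r) expectation (f u).
Proof.
elim: r => [|u r IHr] /=.
  by move=> _ _ _; rewrite big_nil -[RHS]expectation1; apply: eq_expectation => om; rewrite big_nil.
case/andP=> ur uniqr disj dep.
rewrite big_cons -IHr //; first last.
- by move=> v vr; apply: dep; rewrite inE vr orbT.
- by move=> v v' vr v'r; apply: disj; rewrite inE ?vr ?v'r orbT.
rewrite -(@expectationM (D u)); first last.
- move=> om; apply: eq_big_seq => v vr.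
  have sub : D v \subset ~: D u.
    rewrite -disjoints_subset disj ?inE ?vr ?orbT ?eqxx //.
    by apply: contraNneq ur => <-.
  by apply: (depends_onS sub); apply: dep; rewrite inE vr orbT.
- by apply: dep; rewrite inE eqxx.
by apply: eq_expectation => om; rewrite big_cons.
Qed.

(* The law of total probability for an adaptive exploration [X] that, on
   reaching [y], has revealed only the coordinates in [D y]. *)
Lemma prob_adaptive (Y : finType) (X : {set I} -> Y) (B : Y -> pred {set I})
    (D : Y -> {set I}) :
  (forall y, depends_on (D y) (fun om => X om == y)) ->
  (forall y, depends_on (~: D y) (B y)) ->
  prob (fun om => B (X om) om) = \sum_y prob (fun om => X om == y) * prob (B y).
Proof.
move=> XD BD.
transitivity (\sum_y prob (fun om => (X om == y) && B y om)).
  rewrite -expectation_sum; apply: eq_expectation => om.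
  rewrite (bigD1 (X om)) //= eqxx /= big1 ?addr0 // => y /negbTE.
  by rewrite eq_sym => ->.
by apply: eq_bigr => y _; rewrite (@probM (D y)).
Qed.

Hypothesis w01 : forall x, 0 <= w x <= 1.

Lemma mass_ge0 om : 0 <= mass om.
Proof. by apply: prodr_ge0 => x _; have := w01 x; case: ifP => _; lra. Qed.

Lemma le_expectation f g : (forall om, f om <= g om) -> expectation f <= expectation g.
Proof. by move=> fg; apply: ler_sum => om _; rewrite ler_wpM2l ?mass_ge0. Qed.

Lemma le_prob (A B : pred {set I}) : (forall om, A om -> B om) -> prob A <= prob B.
Proof.
move=> AB; apply: le_expectation => om; rewrite ler_nat.
by have := AB om; case: (A om) => // ->.
Qed.

Lemma prob_ge0 A : 0 <= prob A.
Proof. by rewrite sumr_ge0 // => om _; rewrite mulr_ge0 ?mass_ge0. Qed.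

Lemma prob_le1 A : prob A <= 1.
Proof. by rewrite -expectation1; apply: le_expectation => om; case: (A om). Qed.

Lemma probU A B : prob (fun om => A om || B om) <= prob A + prob B.
Proof.
rewrite -expectationD; apply: le_expectation => om.
by case: (A om); case: (B om) => /=; lra.
Qed.

Lemma prob_exists (J : finType) (P : pred J) (A : J -> pred {set I}) :
  prob (fun om => [exists y, P y && A y om]) <= \sum_(y | P y) prob (A y).
Proof.
rewrite -expectation_sum; apply: le_expectation => om.
case: existsP => [[y /andP[Py Ay]] | _]; last exact: sumr_ge0.
by rewrite (bigD1 y) //= Ay lerDl sumr_ge0.
Qed.

(** [Q] selects the outcomes after which the continuation is fresh and controlled. Keeping the
    factor [prob w (fun om => Q (X om))] lets the bounds of successive stages multiply. *)
Lemma prob_adaptive_le (Y : finType) (X : {set I} -> Y) (B : Y -> pred {set I})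
    (D : Y -> {set I}) (Q : pred Y) (b : R) :
  (forall y, depends_on (D y) (fun om => X om == y)) ->
  (forall y, Q y -> depends_on (~: D y) (B y)) ->
  (forall y, Q y -> prob (B y) <= b) ->
  prob (fun om => Q (X om) && B (X om) om) <= b * prob (fun om => Q (X om)).
Proof.
move=> XD BD Bb.
rewrite (@prob_adaptive _ X (fun y om => Q y && B y om) D) //; last first.
  move=> y om /=; case Qy: (Q y) => //=; exact: BD.
have -> : prob (fun om => Q (X om)) = \sum_y prob (fun om => X om == y) * (Q y)%:R.
  rewrite (eq_bigr (fun y => prob (fun om => X om == y) * prob (fun=> Q y))).
    by rewrite -(@prob_adaptive _ X (fun y om => Q y) D).
  by move=> y _; rewrite prob_cst.
rewrite mulr_sumr; apply: ler_sum => y _; rewrite mulrCA ler_wpM2l ?prob_ge0 //.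
case Qy: (Q y) => /=; first by rewrite mulr1 Bb.
by rewrite mulr0 prob_cst.
Qed.

Lemma prob_adaptive_ge (Y : finType) (X : {set I} -> Y) (B : Y -> pred {set I})
    (D : Y -> {set I}) (Q : pred Y) (b : R) :
  (forall y, depends_on (D y) (fun om => X om == y)) ->
  (forall y, Q y -> depends_on (~: D y) (B y)) ->
  (forall y, Q y -> b <= prob (B y)) ->
  b * prob (fun om => Q (X om)) <= prob (fun om => Q (X om) && B (X om) om).
Proof.
move=> XD BD Bb.
rewrite (@prob_adaptive _ X (fun y om => Q y && B y om) D) //; last first.
  move=> y om /=; case Qy: (Q y) => //=; exact: BD.
have -> : prob (fun om => Q (X om)) = \sum_y prob (fun om => X om == y) * (Q y)%:R.
  rewrite (eq_bigr (fun y => prob (fun om => X om == y) * prob (fun=> Q y))).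
    by rewrite -(@prob_adaptive _ X (fun y om => Q y) D).
  by move=> y _; rewrite prob_cst.
rewrite mulr_sumr; apply: ler_sum => y _; rewrite mulrCA ler_wpM2l ?prob_ge0 //.
case Qy: (Q y) => /=; first by rewrite mulr1 Bb.
by rewrite mulr0 prob_ge0.
Qed.

End Bernoulli.

(** * Connected sets of an incidence structure *)

Section Incidence.
Variables (T X : finType) (inc : T -> X -> bool).

Definition links (E : {set X}) (A B : {set T}) :=
  [exists e in E, [exists J in A, inc J e] && [exists J in B, inc J e]].

Lemma linksP (E : {set X}) (A B : {set T}) :
  reflect (exists e J J', [/\ e \in E, J \in A, J' \in B, inc J e & inc J' e]) (links E A B).
Proof.
apply: (iffP existsP) => [[e /and3P[eE /existsP[J /andP[JA Je]] /existsP[J' /andP[J'B J'e]]]] | ].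
  by exists e, J, J'.
move=> [e [J [J' [eE JA J'B Je J'e]]]]; exists e; rewrite eE /=.
by apply/andP; split; apply/existsP; [exists J; rewrite JA | exists J'; rewrite J'B].
Qed.

Lemma links_sym (E : {set X}) (A B : {set T}) : links E A B = links E B A.
Proof. by apply/linksP/linksP => -[e [J [J' [? ? ? ? ?]]]]; exists e, J', J. Qed.

Lemma linksS (E : {set X}) (A A' B B' : {set T}) :
  A \subset A' -> B \subset B' -> links E A B -> links E A' B'.
Proof.
move=> /subsetP sA /subsetP sB /linksP[e [J [J' [eE JA J'B Je J'e]]]].
by apply/linksP; exists e, J, J'; split; rewrite ?sA ?sB.
Qed.

(** Hypergraph connectivity by cuts instead of paths, so that edges holding many members of [S] need
    no special treatment. *)
Definition connects (E : {set X}) (S : {set T}) :=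
  [forall A : {set T}, [&& A \subset S, A != set0 & A != S] ==> links E A (S :\: A)].

Lemma connectsP E (S : {set T}) :
  reflect (forall A : {set T}, A \subset S -> A != set0 -> A != S -> links E A (S :\: A))
    (connects E S).
Proof.
apply: (iffP forallP) => [conn A sA A0 AS | conn A].
  by have := conn A; rewrite sA A0 AS.
by apply/implyP => /and3P[]; apply: conn.
Qed.

Lemma connects0 E : connects E set0.
Proof. by apply/connectsP => A; rewrite subset0 => ->. Qed.

Lemma connects1 E J : connects E [set J].
Proof. by apply/connectsP => A; rewrite subset1 orbC => /orP[] ->. Qed.

(** A cut of the union either cuts [C] or [C'] properly, where their own connectivity applies, or is
    [C] or [C'] itself, where the link between them crosses. *)
Lemma connectsU E (C C' : {set T}) : [disjoint C & C'] ->
  connects E C -> connects E C' -> links E C C' -> connects E (C :|: C').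
Proof.
move=> dCC' /connectsP conC /connectsP conC' lCC'; apply/connectsP => A sA A0 AS.
have dec : A = (A :&: C) :|: (A :&: C') by rewrite -setIUr; apply/esym/setIidPl.
have [AC0 | AC0] := eqVneq (A :&: C) set0.
  rewrite AC0 set0U in dec.
  have [AC' | AC'] := eqVneq A C'.
    rewrite AC' setDUl setDv setU0 links_sym; apply: linksS lCC' => //.
    by rewrite subsetD subxx.
  apply: (@linksS _ A A (C' :\: A)) => //; first by rewrite setSD // subsetUr.
  by apply: conC'; rewrite // dec subsetIr.
have [ACC | ACC] := eqVneq (A :&: C) C; last first.
  apply: (@linksS _ (A :&: C) A (C :\: (A :&: C))).
  - exact: subsetIl.
  - by rewrite setDIr setDv setU0 setSD // subsetUl.
  - by apply: conC; rewrite // subsetIr.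
have [AC'0 | AC'0] := eqVneq (A :&: C') set0.
  rewrite AC'0 setU0 ACC in dec; rewrite dec setDUl setDv set0U.
  apply: linksS lCC' => //; by rewrite subsetD subxx disjoint_sym.
have [ACC' | ACC'] := eqVneq (A :&: C') C'.
  by rewrite ACC ACC' in dec; rewrite dec eqxx in AS.
apply: (@linksS _ (A :&: C') A (C' :\: (A :&: C'))).
- exact: subsetIl.
- by rewrite setDIr setDv setU0 setSD // subsetUr.
- by apply: conC'; rewrite // subsetIr.
Qed.

Section JointlyConnected.
Variables (s : nat) (H : 'I_s -> {set X}) (Q : pred 'I_s).

Definition jointly_connected (S : {set T}) := [forall (i | Q i), connects (H i) S].

Lemma jointly_connectedP (S : {set T}) :
  reflect (forall i, Q i -> connects (H i) S) (jointly_connected S).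
Proof. exact: forall_inP. Qed.

(* Aizenman--Lebowitz: merging the classes of a labelling two at a time, a
   jointly connected class cannot jump over the window ]L, 2L]. *)
Lemma jointly_connected_window (L : nat) :
  (0 < L)%N -> (L < #|T|)%N ->
  (forall f : T -> T, (forall a b, (forall i, Q i -> links (H i) (f @^-1: [set a]) (f @^-1: [set b])) ->
                          f @^-1: [set a] != set0 -> f @^-1: [set b] != set0 -> a = b) ->
     forall J J', f J = f J') ->
  exists2 S, jointly_connected S & (L < #|S| <= 2 * L)%N.
Proof.
move=> L0 LT stab.
have [T0 _] : exists T0 : T, true by case/card_gt0P: (leq_ltn_trans (leq0n _) LT) => x; exists x.
(* Induction on the number of labels in use, all classes being jointly connected and of size at most
   [L]. Two linked classes merge into at most [2 * L] points: this is the window, or one label less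
   remains. *)
suff step m (f : {ffun T -> T}) : #|f @: setT| = m ->
    (forall a, jointly_connected (f @^-1: [set a])) -> (forall a, #|f @^-1: [set a]| <= L)%N ->
    exists2 S, jointly_connected S & (L < #|S| <= 2 * L)%N.
  have pre1 (a : T) : [ffun x : T => x] @^-1: [set a] = [set a].
    by apply/setP => x; rewrite !inE ffunE.
  apply: (step _ [ffun x => x] erefl) => a; rewrite pre1 ?cards1 //.
  apply/jointly_connectedP => i _; exact: connects1.
elim/ltn_ind: m f => m IHm f fm fconn fL.
have [/existsP[a /existsP[b /and4P[nab /forall_inP lab fa fb]]] | none] := boolP
  [exists a, exists b, [&& a != b, [forall (i | Q i), links (H i) (f @^-1: [set a]) (f @^-1: [set b])],
     f @^-1: [set a] != set0 & f @^-1: [set b] != set0]].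
  have dab : [disjoint f @^-1: [set a] & f @^-1: [set b]].
    rewrite -setI_eq0; apply/eqP/setP => x; rewrite !inE; apply/negP => /andP[/eqP-> ].
    by apply/negP.
  have cab : jointly_connected (f @^-1: [set a] :|: f @^-1: [set b]).
    apply/jointly_connectedP => i Qi.
    by apply: connectsU => //; [exact/jointly_connectedP | exact/jointly_connectedP | apply: lab].
  have card_ab : #|f @^-1: [set a] :|: f @^-1: [set b]| = (#|f @^-1: [set a]| + #|f @^-1: [set b]|)%N.
    by rewrite cardsU; have /eqP -> : f @^-1: [set a] :&: f @^-1: [set b] == set0;
      rewrite ?setI_eq0 // cards0 subn0.
  have [big | small] := ltnP L (#|f @^-1: [set a]| + #|f @^-1: [set b]|).
    exists (f @^-1: [set a] :|: f @^-1: [set b]) => //.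
    by rewrite card_ab big /=; have := fL a; have := fL b; lia.
  pose g : {ffun T -> T} := [ffun x => if f x == b then a else f x].
  have preg c : g @^-1: [set c] = if c == a then f @^-1: [set a] :|: f @^-1: [set b]
                                 else if c == b then set0 else f @^-1: [set c].
    apply/setP => x; rewrite !inE ffunE.
    case: (eqVneq c a) => [-> | ca].
      by rewrite !inE; case: (eqVneq (f x) b) => [-> | _]; rewrite ?eqxx ?orbT ?orbF.
    case: (eqVneq c b) => [-> | cb]; rewrite !inE.
      by case: (eqVneq (f x) b) => [_ | /negbTE]; rewrite // (negbTE nab).
    case: (eqVneq (f x) b) => // ->; rewrite !(eq_sym _ c); by rewrite (negbTE ca) (negbTE cb).
  apply: (IHm #|g @: setT| _ g erefl).
  - rewrite -fm proper_card //; apply/properP; split.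
      apply/subsetP => _ /imsetP[x _ ->]; rewrite ffunE; case: ifP => _; last exact: imset_f.
      by case/set0Pn: fa => y; rewrite !inE => /eqP <-; apply: imset_f.
    exists b.
      by case/set0Pn: fb => y; rewrite !inE => /eqP <-; apply: imset_f.
    apply/imsetP => -[x _]; rewrite ffunE.
    by case: (eqVneq (f x) b) => [_ ba | /eqP nfb /esym //]; rewrite ba eqxx in nab.
  - move=> c; rewrite preg; case: ifP => // _; case: ifP => // _.
    by apply/jointly_connectedP => i _; exact: connects0.
  - by move=> c; rewrite preg; case: ifP => _; [rewrite card_ab | case: ifP; rewrite ?cards0].
have fconst : forall J J', f J = f J'.
  apply: stab => a b lab fa fb; apply/eqP; apply: contraNT none => nab.
  apply/existsP; exists a; apply/existsP; exists b; rewrite nab fa fb /= andbT.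
  exact/forall_inP.
have : (#|T| <= L)%N.
  apply: leq_trans (fL (f T0)); rewrite -cardsT subset_leq_card //.
  by apply/subsetP => x _; rewrite !inE (fconst x T0).
by rewrite leqNgt LT.
Qed.

End JointlyConnected.

Definition touches (J0 : T) (E : {set X}) (e : X) :=
  [exists J, inc J e && ((J == J0) || [exists e' in E, inc J e'])].

(** Reachability of all of [E] from [J0] through shared points; for the empty subfamily of a
    nonempty [E] it gives an edge through [J0] itself. *)
Definition rooted (J0 : T) (E : {set X}) :=
  [forall E' : {set X}, (E' \proper E) ==> [exists e in E :\: E', touches J0 E' e]].

Definition thick (S : {set T}) : {set X} := [set e | (1 < #|[set J in S | inc J e]|)%N].

Lemma connects_thick E S : connects E S -> connects (E :&: thick S) S.
Proof.
move/connectsP => conn; apply/connectsP => A sA A0 AS.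
have /linksP[e [J [J' [eE JA]]]] := conn A sA A0 AS.
rewrite inE => /andP[J'A J'S] Je J'e; apply/linksP; exists e, J, J'.
rewrite !inE J'A J'S; split => //; rewrite eE /=.
apply: (@leq_trans #|[set J; J']|); first by rewrite cards2; case: eqVneq J'A JA => // -> /negbTE->.
apply/subset_leq_card/subsetP => K; rewrite !inE => /orP[] /eqP ->; rewrite ?J'S ?J'e //.
by rewrite (subsetP sA) // Je.
Qed.

(** A spanning tree argument: starting from one point, each new point is reached by a single edge of
    [E]. *)
Lemma connects_sparse E (S : {set T}) : S != set0 -> connects E S ->
  exists2 E' : {set X}, E' \subset E & connects E' S /\ (#|E'| < #|S|)%N.
Proof.
case/set0Pn => J0 J0S /connectsP conn.
(* Only cuts [B] containing the part [A] already reached have to be crossed; a cut missing [J0] is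
   replaced by its complement, as [links] is symmetric. *)
suff ext m (A : {set T}) : A \subset S -> J0 \in A -> #|S :\: A| = m ->
    exists2 E' : {set X}, E' \subset E & (#|E'| <= m)%N /\
      forall B : {set T}, A \subset B -> B \proper S -> links E' B (S :\: B).
  have [| |E' sE' [cE' E'P]] := ext _ [set J0] _ _ erefl; rewrite ?sub1set ?inE //.
  exists E' => //; split; last first.
    by rewrite (cardsD1 J0 S) J0S add1n ltnS.
  apply/connectsP => B sB B0 BS.
  have [J0B | J0B] := boolP (J0 \in B).
    by apply: E'P; rewrite ?sub1set // properEneq BS.
  have SDB : S :\: (S :\: B) = B by rewrite setDDr setDv set0U; apply/setIidPr.
  rewrite links_sym -{2}SDB.
  apply: E'P; first by rewrite sub1set inE J0B.
  rewrite properEneq subsetDl andbT; apply: contra B0 => /eqP SB.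
  rewrite -subset0; apply/subsetP => x xB; have := subsetP sB x xB.
  by rewrite -SB inE xB.
elim/ltn_ind: m A => m IHm A sA J0A cm.
have [AS | AS] := eqVneq A S.
  exists set0; rewrite ?sub0set // cards0; split => // B; rewrite AS => sSB.
  by rewrite properE sSB andbF.
have /linksP[e [J [J' [eE JA]]]] : links E A (S :\: A).
  by apply: conn => //; apply/set0Pn; exists J0.
rewrite inE => /andP[J'A J'S] Je J'e.
have cm' : #|S :\: A| = #|S :\: (J' |: A)|.+1.
  by rewrite (cardsD1 J' (S :\: A)) inE J'A J'S add1n setDDl setUC.
have [| | |E' sE' [cE' E'P]] := IHm #|S :\: (J' |: A)| _ (J' |: A) _ _ erefl.
- by rewrite -cm cm'.
- by rewrite subUset sub1set J'S.
- by rewrite inE J0A orbT.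
exists (e |: E'); first by rewrite subUset sub1set eE.
split; first by rewrite cardsU1; case: (e \in E') => /=; lia.
move=> B sAB BS; have [J'B | J'B] := boolP (J' \in B).
  have /linksP[e' [K [K' [e'E ? ? ? ?]]]] : links E' B (S :\: B).
    by apply: E'P; rewrite // subUset sub1set J'B.
  by apply/linksP; exists e', K, K'; rewrite inE e'E orbT.
apply/linksP; exists e, J, J'; rewrite !inE eqxx J'B J'S; split => //.
exact: (subsetP sAB).
Qed.

(** [#|E|] is minimised over all pairs of a colour in [Q] and a connecting subfamily. Intersecting
    with [thick inc S] keeps a family connecting, so [E] is thick, and the thick edges of any colour
    in [Q] form a competitor of [E]. *)
Lemma minimal_connecting_family (s : nat) (H : 'I_s -> {set X}) (Q : pred 'I_s) (S : {set T}) (i0 : 'I_s) :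
  Q i0 -> (1 < #|S|)%N -> jointly_connected H Q S ->
  exists i J0 (E : {set X}),
    [/\ Q i /\ E \subset H i, rooted J0 E, (#|E| < #|S|)%N,
        S \subset [set J | [exists e in E, inc J e]] &
        forall i', Q i' -> (#|E| <= #|H i' :&: thick S|)%N].
Proof.
move=> Qi0 S1 /jointly_connectedP conn.
have S0 : S != set0 by rewrite -card_gt0 ltnW.
pose P (z : 'I_s * {set X}) := [&& Q z.1, z.2 \subset H z.1 & connects z.2 S].
have P0 : P (i0, H i0) by rewrite /P /= Qi0 subxx conn.
have [[i E] /= /and3P[/= Qi EH cE] Emin] := arg_minnP (fun z : 'I_s * {set X} => #|z.2|) P0.
have Ethick : E \subset thick S.
  have := Emin (i, E :&: thick S); rewrite /P /= Qi connects_thick //.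
  rewrite (subset_trans _ EH) ?subsetIl // => /(_ isT) le.
  by apply/setIidPl/eqP; rewrite eqEcard subsetIl le.
have /set0Pn[J0 J0S] := S0.
exists i, J0, E; split => //.
- apply/forallP => E'; apply/implyP => /properP[sE' [e0 e0E e0E']].
  pose A := [set J in S | (J == J0) || [exists e' in E', inc J e']].
  (* If the points reached by [E'] exhaust [S], any missing edge touches [E'], because it is thick
     and so contains a point of [S]; otherwise [E] crosses the cut [A]. *)
  have [AS | AS] := eqVneq A S.
    apply/existsP; exists e0; rewrite inE e0E e0E' /=.
    have : (0 < #|[set J in S | inc J e0]|)%N.
      by have := subsetP Ethick _ e0E; rewrite inE; apply: ltn_trans.
    case/card_gt0P => J; rewrite inE => /andP[JS Je0]; apply/existsP; exists J.
    by move: JS; rewrite -AS inE Je0 => /andP[_ ->].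
  have sA : A \subset S by apply/subsetP => J; rewrite inE => /andP[].
  have /linksP[e [J [J' [eE JA]]]] : links E A (S :\: A).
    by apply: (connectsP _ _ cE) => //; apply/set0Pn; exists J0; rewrite inE J0S eqxx.
  rewrite inE => /andP[J'A J'S] Je J'e.
  apply/existsP; exists e; rewrite inE eE andbT; apply/andP; split.
    apply: contra J'A => eE'; rewrite inE J'S /=; apply/orP; right.
    by apply/existsP; exists e; rewrite eE'.
  by apply/existsP; exists J; rewrite Je /=; move: JA; rewrite inE => /andP[].
- have [E' sE' [cE' ltE']] := connects_sparse S0 cE.
  apply: leq_ltn_trans ltE'; apply: (Emin (i, E')).
  by rewrite /P /= Qi (subset_trans sE') ?cE'.
- apply/subsetP => J JS; rewrite inE.
  have /linksP[e [K [K' [eE]]]] : links E [set J] (S :\: [set J]).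
    apply: (connectsP _ _ cE); rewrite ?sub1set //; first by apply/set0Pn; exists J; rewrite inE.
    by apply: contraTneq S1 => <-; rewrite cards1.
  by rewrite inE => /eqP-> _ Je _; apply/existsP; exists e; rewrite eE.
- move=> i' Qi'; apply: (Emin (i', H i' :&: thick S)).
  by rewrite /P /= Qi' subsetIl connects_thick // conn.
Qed.

End Incidence.

(** * Counting rooted families of edges *)

Lemma card_bigcup_le (I T : finType) (P : pred I) (F : I -> {set T}) (b : nat) :
  (forall i, P i -> (#|F i| <= b)%N) -> (#|\bigcup_(i | P i) F i| <= #|[pred i | P i]| * b)%N.
Proof.
move=> Fb; rewrite -sum_nat_const.
elim/big_rec2: _ => [|i A m Pi IH]; first by rewrite cards0.
by rewrite (leq_trans (leq_card_setU _ _)) // leq_add // Fb.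
Qed.

(** A weak Stirling bound: passing from [m] to [m.+1] costs a factor (1 + 1/m)^m, which is at most
    e. *)
Lemma exp_ge_self_fact (R : realType) (m : nat) : (m%:R : R) ^+ m <= expR 1 ^+ m * m`!%:R.
Proof.
elim: m => [|m IHm]; first by rewrite !expr0 mul1r.
have [-> | m_gt0] := posnP m.
  by rewrite !expr1 mulr1; have := expR_ge1Dx (1 : R); lra.
have m0 : 0 < m%:R :> R by rewrite ltr0n.
have -> : (m.+1%:R : R) ^+ m.+1 = m.+1%:R * (m%:R ^+ m * (1 + m%:R^-1) ^+ m).
  by rewrite exprS -exprMn; congr (_ * _ ^+ _); rewrite mulrDr mulr1 mulfV ?gt_eqF // natr1.
have le_e : (1 + m%:R^-1) ^+ m <= expR 1 :> R.
  apply: le_trans (_ : expR (m%:R^-1) ^+ m <= _).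
    by rewrite lerXn2r ?nnegrE ?addr_ge0 ?invr_ge0 ?expR_ge0 // expR_ge1Dx.
  by rewrite -expRM_natl mulfV ?gt_eqF.
have -> : expR 1 ^+ m.+1 * (m.+1)`!%:R = m.+1%:R * (expR 1 ^+ m * m`!%:R * expR 1) :> R.
  by rewrite factS natrM exprS; ring.
rewrite ler_wpM2l // ler_pM ?exprn_ge0 // addr_ge0 // invr_ge0 ltW //.
Qed.

Lemma bin_le_expn (N m : nat) : ('C(N, m) * m`! <= N ^ m)%N.
Proof.
rewrite bin_ffact; elim: m => [|m IHm]; first by rewrite ffactn0.
by rewrite ffactnSr expnSr leq_mul // leq_subr.
Qed.

Lemma bin_le_exp (R : realType) (N m : nat) (a : R) : 0 <= a ->
  N%:R <= a * m%:R -> ('C(N, m))%:R <= (expR 1 * a) ^+ m.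
Proof.
move=> a0 Na.
have fm : 0 < m`!%:R :> R by rewrite ltr0n fact_gt0.
rewrite -(ler_pM2r fm) -natrM.
apply: le_trans (_ : (N ^ m)%:R <= _); first by rewrite ler_nat bin_le_expn.
rewrite natrX; apply: le_trans (_ : (a * m%:R) ^+ m <= _).
  by rewrite lerXn2r ?nnegrE ?mulr_ge0.
rewrite !exprMn [_ * a ^+ m]mulrC -mulrA ler_wpM2l ?exprn_ge0 //.
exact: exp_ge_self_fact.
Qed.

Section Animals.
Variables (R : realType) (T X : finType) (inc : T -> X -> bool) (K D : nat).
Hypothesis incK : forall e, (#|[set J | inc J e]| <= K)%N.
Hypothesis incD : forall J, (#|[set e | inc J e]| <= D)%N.

Definition span_points (E : {set X}) : {set T} := [set J | [exists e in E, inc J e]].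

Lemma card_span_points (E : {set X}) : (#|span_points E| <= #|E| * K)%N.
Proof.
have -> : span_points E = \bigcup_(e in E) [set J | inc J e].
  apply/setP => J; rewrite inE; apply/existsP/bigcupP => [[e /andP[eE Je]] | [e eE]].
    by exists e; rewrite ?inE.
  by rewrite inE => Je; exists e; rewrite eE.
apply: leq_trans (card_bigcup_le (fun e _ => incK e)) _.
by rewrite leq_mul2r; apply/orP; right; apply: subset_leq_card; apply/subsetP.
Qed.

Definition boundary (J0 : T) (E : {set X}) : {set X} := [set e | (e \notin E) && touches inc J0 E e].

Lemma card_boundary J0 (E : {set X}) : (#|boundary J0 E| <= (1 + K * #|E|) * D)%N.
Proof.
have sub : boundary J0 E \subset \bigcup_(J in J0 |: span_points E) [set e | inc J e].
  apply/subsetP => e; rewrite inE => /andP[_ /existsP[J /andP[Je JE]]].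
  by apply/bigcupP; exists J; rewrite !inE.
rewrite (leq_trans (subset_leq_card sub)) //.
apply: leq_trans (card_bigcup_le (fun J _ => incD J)) _.
rewrite leq_mul2r; apply/orP; right.
apply: (@leq_trans #|J0 |: span_points E|).
  by apply: subset_leq_card; apply/subsetP.
rewrite cardsU1 leq_add //; first by case: (_ \notin _).
by rewrite mulnC card_span_points.
Qed.

(** Otherwise rootedness yields an edge of [E] outside [E'] touching their intersection; it lies in
    the boundary of [E'], so it would be both in [om] and excluded from it. *)
Lemma rooted_unique J0 (E E' om : {set X}) :
  rooted inc J0 E -> E \subset om -> [disjoint boundary J0 E' & om] ->
  E \subset E'.
Proof.
move=> /forallP rE sE dE'; apply/setIidPl/eqP; apply: contraT => nE.
have := rE (E :&: E'); rewrite properEneq nE subsetIl /=.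
case/existsP => e /andP[]; rewrite !inE negb_and => /andP[/orP[/negbTE-> //| eE'] eE].
case/existsP=> J /andP[Je JE].
have : e \in boundary J0 E'.
  rewrite inE eE' /=; apply/existsP; exists J; rewrite Je /=.
  case/orP: JE => [-> // | /existsP[e' /andP[]]]; rewrite inE => /andP[_ e'E'] Je'.
  by apply/orP; right; apply/existsP; exists e'; rewrite e'E'.
by move/(disjointFr dE'); rewrite (subsetP sE).
Qed.

(* In the Bernoulli(1/(D+1)) model, the events that the component of [J0] is
   exactly [E] are disjoint, so their probabilities sum to at most one. *)
Lemma count_rooted J0 (m : nat) : (0 < D)%N ->
  (#|[set E : {set X} | (#|E| == m) && rooted inc J0 E]|)%:R <=
  D.+1%:R ^+ m * expR 1 ^+ (1 + K * m) :> R.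
Proof.
move=> D_gt0.
have D0 : 0 < D%:R :> R by rewrite ltr0n.
pose q : R := D.+1%:R^-1.
have q0 : 0 < q by rewrite invr_gt0 ltr0n.
have q1 : q < 1 by rewrite invf_lt1 ?ltr0n // ltr1n.
pose w (e : X) : R := q.
have w01 e : 0 <= w e <= 1 by rewrite /w; lra.
pose A := [set E : {set X} | (#|E| == m) && rooted inc J0 E].
have sum_le1 : \sum_(E in A) prob w (fun om => (E \subset om) && [disjoint boundary J0 E & om]) <= 1.
  rewrite -expectation_sum -[X in _ <= X](expectation1 w); apply: le_expectation => // om.
  case: (pickP [pred E in A | (E \subset om) && [disjoint boundary J0 E & om]]) => [E0 | none].
    case/and3P=> E0A sE0 dE0.
    rewrite (bigD1 E0) //= sE0 dE0 /= big1 ?addr0 // => E /andP[EA nEE0].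
    apply/eqP; rewrite pnatr_eq0 eqb0; apply: contra nEE0 => /andP[sE dE].
    move: EA E0A; rewrite !inE => /andP[/eqP cE rE] /andP[/eqP cE0 rE0].
    by rewrite eqEcard (rooted_unique rE sE dE0) cE cE0 leqnn.
  rewrite big1 // => E EA; have := none E; rewrite /= EA /=.
  by move=> ->.
have term E : E \in A ->
    q ^+ m * expR (-1) ^+ (1 + K * m) <=
    prob w (fun om => (E \subset om) && [disjoint boundary J0 E & om]).
  rewrite inE => /andP[/eqP cE _].
  rewrite prob_pattern; last first.
    by rewrite disjoint_sym disjoints_subset; apply/subsetP => e; rewrite !inE => /andP[].
  rewrite !prodr_const cE ler_pM2l ?exprn_gt0 //.
  apply: le_trans (_ : (1 - q) ^+ ((1 + K * m) * D) <= _); last first.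
    rewrite /w prodr_const; apply: ler_wiXn2l; [lra | lra | by rewrite -cE card_boundary].
  rewrite [((1 + _) * D)%N]mulnC exprM lerXn2r ?nnegrE ?expR_ge0 ?exprn_ge0 //; first lra.
  (* The reason for [q = 1/(D+1)]: the [D]-th power of [1/(1 + 1/D)] is at least 1/e, so each point
     costs one factor e. *)
  have -> : 1 - q = (1 + D%:R^-1)^-1.
    by rewrite /q -natr1; field; rewrite natr1 !pnatr_eq0 -lt0n D_gt0.
  rewrite expRN exprVn lef_pV2 ?posrE ?expR_gt0 ?exprn_gt0 ?addr_gt0 ?invr_gt0 //.
  apply: le_trans (_ : expR (D%:R^-1) ^+ D <= _).
    by rewrite lerXn2r ?nnegrE ?addr_ge0 ?invr_ge0 ?expR_ge0 // expR_ge1Dx.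
  by rewrite -expRM_natl mulfV ?gt_eqF.
have : \sum_(E in A) (q ^+ m * expR (-1) ^+ (1 + K * m)) <= 1.
  by apply: le_trans sum_le1; apply: ler_sum => E; apply: term.
rewrite sumr_const -[_ *+ #|A|]mulr_natr.
have c0 : 0 < D.+1%:R ^+ m * expR 1 ^+ (1 + K * m) :> R.
  by rewrite mulr_gt0 ?exprn_gt0 ?expR_gt0 ?ltr0n.
rewrite /q expRN !exprVn -invfM mulrC ler_pdivrMr // mul1r.
by apply: le_trans; rewrite ler_nat.
Qed.

End Animals.

(** * Independent colours and the union bound over witnesses *)

Section ColourClasses.
Variables (R : realType) (s : nat) (X : finType) (p : 'I_s -> R).

Definition colour_class (om : {set 'I_s * X}) (i : 'I_s) : {set X} := [set e | (i, e) \in om].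

Definition colour_weight (x : 'I_s * X) : R := p x.1.

Lemma prod_colour_weight (q : 'I_s -> R) (F : 'I_s -> {set X}) :
  \prod_(x : 'I_s * X | x.2 \in F x.1) q x.1 = \prod_i q i ^+ #|F i|.
Proof.
rewrite -(pair_big_dep xpredT (fun i e => e \in F i) (fun i e => q i)) /=.
by apply: eq_bigr => i _; rewrite prodr_const.
Qed.

Lemma prob_colour_subset (F : 'I_s -> {set X}) :
  prob colour_weight (fun om => [forall i, F i \subset colour_class om i]) =
  \prod_i p i ^+ #|F i|.
Proof.
rewrite -prod_colour_weight.
transitivity (prob colour_weight (fun om => [set x : 'I_s * X | x.2 \in F x.1] \subset om)).
  apply: eq_prob => om; apply/forallP/subsetP => [sF [i e] | sF i].
    by rewrite inE /= => eF; have := subsetP (sF i) e eF; rewrite inE.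
  by apply/subsetP => e eF; rewrite inE; apply: sF; rewrite inE.
by rewrite prob_subset; apply: eq_bigl => x; rewrite inE.
Qed.

Hypothesis p01 : forall i, 0 <= p i <= 1.

Lemma colour_weight01 x : 0 <= colour_weight x <= 1.
Proof. exact: p01. Qed.

(** Expanding the product of sums gives a sum over all choices of one family per colour, and a fixed
    choice is present with exactly the product probability; a union bound over the choices
    suffices. *)
Lemma prob_colour_families (Fam : 'I_s -> pred {set X}) :
  prob colour_weight (fun om => [forall i, [exists B, Fam i B && (B \subset colour_class om i)]]) <=
  \prod_i \sum_(B | Fam i B) p i ^+ #|B|.
Proof.
rewrite bigA_distr_big_dep.
apply: le_trans (_ : \sum_(F : {ffun 'I_s -> {set X}} | F \in family Fam)
    prob colour_weight (fun om => [forall i, F i \subset colour_class om i]) <= _); last first.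
  by apply: ler_sum => F _; rewrite prob_colour_subset.
apply: le_trans (prob_exists colour_weight01 _ _).
apply: le_prob; first exact: colour_weight01.
move=> om /forallP HF.
have {}HF i : exists B, Fam i B && (B \subset colour_class om i) by exact/existsP.
pose F := [ffun i => xchoose (HF i)].
have FP i : Fam i (F i) && (F i \subset colour_class om i).
  by rewrite ffunE; exact: (xchooseP (HF i)).
apply/existsP; exists F; apply/andP; split.
  by apply/familyP => i; have /andP[] := FP i.
by apply/forallP => i; have /andP[] := FP i.
Qed.

End ColourClasses.

Section UnionBound.
Variables (R : realType) (s : nat) (T X : finType) (inc : T -> X -> bool).
Variables (p : 'I_s -> R) (Q : pred 'I_s) (K D D' : nat).
Hypothesis p01 : forall i, 0 <= p i <= 1.
Hypothesis incK : forall e, (#|[set J | inc J e]| <= K)%N.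
Hypothesis incD : forall J, (#|[set e | inc J e]| <= D)%N.
Hypothesis incD' : forall J J', J != J' -> (#|[set e | inc J e && inc J' e]| <= D')%N.

Let w := colour_weight (X := X) p.

Lemma card_thick (S : {set T}) : (#|thick inc S| <= #|S| ^ 2 * D')%N.
Proof.
have sub : thick inc S \subset \bigcup_(z : T * T | [&& z.1 \in S, z.2 \in S & z.1 != z.2])
    [set e | inc z.1 e && inc z.2 e].
  apply/subsetP => e; rewrite inE => /card_gt1P[J [J' []]]; rewrite !inE.
  move=> /andP[JS Je] /andP[J'S J'e] nJ.
  by apply/bigcupP; exists (J, J'); rewrite ?inE /= ?JS ?J'S ?Je.
rewrite (leq_trans (subset_leq_card sub)) //.
apply: leq_trans (card_bigcup_le (b := D') _) _; first by move=> z /and3P[_ _]; apply: incD'.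
rewrite leq_mul2r; apply/orP; right.
rewrite expnS expn1 -cardsX; apply: subset_leq_card; apply/subsetP => -[J J'] /=.
by rewrite !inE /= => /and3P[-> ->].
Qed.

Definition witness (m : nat) (i : 'I_s) (E : {set X}) (S : {set T}) (om : {set 'I_s * X}) :=
  (E \subset colour_class om i) &&
  [forall i', Q i' ==> (m <= #|colour_class om i' :&: thick inc S|)%N].

(** The [m] thick edges of another colour form an [m]-subset of at most [(K * m) ^ 2 * D'] edges;
    [bin_le_exp] divides by [m] and leaves [e * K ^ 2 * m * D'] per edge. Only [#|Q|.-1] colours pay
    this, as colour [i] is pinned to [E]. *)
Lemma prob_witness m i (E : {set X}) (S : {set T}) : Q i -> #|E| = m -> (#|S| <= K * m)%N ->
  prob w (witness m i E S) <=
  (\prod_(i' | Q i') p i') ^+ m * ((expR 1 * (K ^ 2 * m * D')%:R) ^+ m) ^+ #|Q|.-1.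
Proof.
move=> Qi Em Sm.
pose Fam i' : pred {set X} := fun B =>
  if i' == i then B == E else if Q i' then (B \subset thick inc S) && (#|B| == m) else B == set0.
apply: le_trans (_ : prob w (fun om => [forall i', [exists B, Fam i' B && (B \subset colour_class om i')]]) <= _).
  apply: le_prob; first exact: colour_weight01.
  move=> om /andP[sE /forallP big]; apply/forallP => i'; apply/existsP; rewrite /Fam.
  have [-> | ni] := eqVneq i' i; first by exists E; rewrite eqxx.
  case Qi': (Q i'); last by exists set0; rewrite eqxx sub0set.
  have := big i'; rewrite Qi' /=; set A := _ :&: _ => mA.
  have [B sB cB] : exists2 B : {set X}, B \subset A & #|B| = m.
    exists [set x in take m (enum A)].
      by apply/subsetP => x; rewrite inE => /mem_take; rewrite mem_enum.
    rewrite cardsE (card_uniqP _) ?take_uniq ?enum_uniq // size_take -cardE.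
    by case: ltngtP mA.
  exists B; rewrite cB eqxx andbT (subset_trans sB) ?subsetIr //=.
  exact: subset_trans sB (subsetIl _ _).
apply: le_trans (prob_colour_families p01 Fam) _.
set c := expR 1 * _.
have c0 : 0 <= c by rewrite mulr_ge0 ?expR_ge0.
have -> : (\prod_(i' | Q i') p i') ^+ m * (c ^+ m) ^+ #|Q|.-1 =
    \prod_i' (if i' == i then p i ^+ m else if Q i' then p i' ^+ m * c ^+ m else 1).
  rewrite [RHS](bigD1 i) //= eqxx (bigD1 i) //= exprMn -mulrA; congr (_ * _).
  transitivity (\prod_(i' | Q i' && (i' != i)) (p i' ^+ m * c ^+ m)).
    rewrite big_split /= prodrXl; congr (_ * _); rewrite prodr_const; congr (_ ^+ _).
    rewrite [#|Q|](cardD1 i) unfold_in Qi add1n /=; apply: eq_card => x.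
    by rewrite !unfold_in /= andbC.
  rewrite big_mkcond [RHS]big_mkcond; apply: eq_bigr => x _ /=.
  by case: eqVneq => [->|_]; rewrite ?andbF ?andbT.
apply: ler_prod => i' _; rewrite /Fam; apply/andP; split.
  by apply: sumr_ge0 => B _; rewrite exprn_ge0 //; have /andP[] := p01 i'.
case: eqVneq => [-> | _]; first by rewrite big_pred1_eq Em.
case: ifP => Qi'; last by rewrite big_pred1_eq cards0.
rewrite (eq_bigr (fun=> p i' ^+ m)); last by move=> B /andP[_ /eqP ->].
rewrite sumr_const -[X in X <= _]mulr_natr ler_wpM2l ?exprn_ge0 //.
  by have /andP[] := p01 i'.
have -> : #|(fun B : {set X} => (B \subset thick inc S) && (#|B| == m))| = 'C(#|thick inc S|, m).
  by rewrite -cards_draws; apply: eq_card => B; rewrite [RHS]inE.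
apply: bin_le_exp; first exact: ler0n.
rewrite -natrM ler_nat (leq_trans (card_thick S)) //.
rewrite (_ : K ^ 2 * m * D' * m = (K * m) ^ 2 * D')%N; last by rewrite expnMn; lia.
by rewrite leq_mul2r leq_exp2r // Sm orbT.
Qed.

(** For [m] edges, [count_rooted] bounds the families and [2 ^ (K * m)] the sets [S] in their span.
    Together with [prob_witness] everything except one factor e is the [m]-th power of a base at
    most [th]; since [th <= 1], every size from [m0] on is covered by the power [m0]. *)
Lemma prob_exists_witness (m0 m1 : nat) (th : R) : (0 < D)%N -> 0 <= th <= 1 ->
  D.+1%:R * (expR 1 * 2) ^+ K * (\prod_(i | Q i) p i) *
    (expR 1 * (K ^ 2 * m1 * D')%:R) ^+ #|Q|.-1 <= th ->
  prob w (fun om => [exists i, Q i && [exists J0 : T, [exists m : 'I_m1.+1, (m0 <= m)%N &&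
     [exists E : {set X}, ((#|E| == m) && rooted inc J0 E) &&
     [exists S : {set T}, (S \subset span_points inc E) && witness m i E S om]]]]]) <=
  s%:R * #|T|%:R * m1.+1%:R * expR 1 * th ^+ m0.
Proof.
move=> D0 /andP[th0 th1] le_th.
have w01 : forall x, 0 <= w x <= 1 by exact: colour_weight01.
have pi0 : 0 <= \prod_(i | Q i) p i by apply: prodr_ge0 => i _; have /andP[] := p01 i.
have inner i J0 (m : 'I_m1.+1) : Q i -> (m0 <= m)%N ->
    prob w (fun om => [exists E : {set X}, ((#|E| == m) && rooted inc J0 E) &&
     [exists S : {set T}, (S \subset span_points inc E) && witness m i E S om]]) <=
    expR 1 * th ^+ m0.
  move=> Qi m0m.
  set W := (\prod_(i' | Q i') p i') ^+ m * ((expR 1 * (K ^ 2 * m * D')%:R) ^+ m) ^+ #|Q|.-1.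
  have W0 : 0 <= W by rewrite mulr_ge0 ?exprn_ge0 // mulr_ge0 ?expR_ge0.
  apply: le_trans (prob_exists w01 _ _) _.
  apply: le_trans (_ : \sum_(E : {set X} | (#|E| == m) && rooted inc J0 E) 2 ^+ (K * m) * W <= _).
    apply: ler_sum => E /andP[/eqP Em _]; apply: le_trans (prob_exists w01 _ _) _.
    have cs : (#|span_points inc E| <= K * m)%N by rewrite mulnC -Em (card_span_points incK).
    apply: le_trans (_ : \sum_(S : {set T} | S \subset span_points inc E) W <= _).
      apply: ler_sum => S sS; apply: prob_witness => //.
      exact: leq_trans (subset_leq_card sS) cs.
    rewrite sumr_const -[X in X <= _]mulr_natl ler_wpM2r //.
    have -> : #|(fun S : {set T} => S \subset span_points inc E)| = #|powerset (span_points inc E)|.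
      by apply: eq_card => S; rewrite inE.
    by rewrite card_powerset natrX ler_weXn2l // ler1n.
  rewrite sumr_const -[X in X <= _]mulr_natl.
  have cnt := @count_rooted R T X inc K D incK incD J0 m D0.
  rewrite cardsE in cnt.
  apply: le_trans (ler_wpM2r _ cnt) _; first by rewrite mulr_ge0 ?exprn_ge0.
  have -> : D.+1%:R ^+ m * expR 1 ^+ (1 + K * m) * (2 ^+ (K * m) * W) =
     expR 1 * (D.+1%:R * (expR 1 * 2) ^+ K * (\prod_(i | Q i) p i) *
        (expR 1 * (K ^ 2 * m * D')%:R) ^+ #|Q|.-1) ^+ m.
    rewrite /W exprD expr1 !exprMn [(2 ^+ K) ^+ m]exprAC ![(_ ^+ #|Q|.-1) ^+ m]exprAC.
    by rewrite !exprM ![(_ ^+ K) ^+ m]exprAC; ring.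
  rewrite ler_wpM2l ?expR_ge0 //.
  apply: le_trans (_ : th ^+ m <= _); last exact: ler_wiXn2l.
  rewrite lerXn2r ?nnegrE //.
    by rewrite !mulr_ge0 ?exprn_ge0 ?mulr_ge0 ?expR_ge0.
  apply: le_trans le_th; rewrite ler_wpM2l ?mulr_ge0 ?exprn_ge0 ?mulr_ge0 ?expR_ge0 //.
  rewrite lerXn2r ?nnegrE ?mulr_ge0 ?expR_ge0 // ler_wpM2l ?expR_ge0 // ler_nat.
  by rewrite leq_mul2r leq_mul2l; have := ltn_ord m; lia.
have e0 : 0 <= expR 1 * th ^+ m0 by rewrite mulr_ge0 ?expR_ge0 ?exprn_ge0.
apply: le_trans (prob_exists w01 _ _) _.
apply: le_trans (_ : \sum_(i | Q i) \sum_(J0 : T) \sum_(m : 'I_m1.+1 | (m0 <= m)%N)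
    (expR 1 * th ^+ m0) <= _).
  apply: ler_sum => i Qi; apply: le_trans (prob_exists w01 xpredT _) _.
  apply: ler_sum => J0 _; apply: le_trans (prob_exists w01 _ _) _.
  by apply: ler_sum => m m0m; apply: inner.
rewrite !sumr_const -!mulrnA -[X in X <= _]mulr_natl -2!natrM -!mulrA ler_wpM2r // ler_nat.
rewrite mulnC [(_ * #|Q|)%N]mulnC; apply: leq_mul; last first.
  by rewrite (leq_trans (max_card _)) // card_ord.
by apply: leq_mul; rewrite (leq_trans (max_card _)) // card_ord.
Qed.

End UnionBound.

(** * Asymptotics of the logarithm *)

Section Asymptotics.
Variable R : realType.
Local Notation lg n := (ln (n%:R : R)).

Lemma ln_nat_large (A : R) : exists N : nat, forall n, (N <= n)%N -> A <= lg n.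
Proof.
exists (Num.trunc (expR A)).+1 => n Nn.
rewrite -ler_expR lnK ?posrE ?ltr0n ?(leq_trans _ Nn) //.
apply: ltW; apply: lt_le_trans (truncnS_gt _) _; by rewrite ler_nat.
Qed.

Lemma expR_ln_nat (n : nat) : (0 < n)%N -> expR (lg n) = n%:R.
Proof. by move=> n0; rewrite lnK // posrE ltr0n. Qed.

(** [expR (lg n / 2)] is the square root of n; the term of degree [m.+1] of the exponential series
    already beats the power [m] of the logarithm. *)
Lemma ln_nat_poly (eps : R) (m : nat) : 0 < eps ->
  exists N : nat, forall n, (N <= n)%N -> lg n ^+ m <= eps * expR (lg n / 2).
Proof.
move=> eps0; pose C : R := 2 ^+ m.+1 * (m.+1)`!%:R.
have f0 : 0 < (m.+1)`!%:R :> R by rewrite ltr0n fact_gt0.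
have C0 : 0 < C by rewrite mulr_gt0 ?exprn_gt0.
have [N NP] := ln_nat_large (C / eps); exists N => n /NP lnC.
have l0 : 0 < lg n by apply: lt_le_trans lnC; rewrite divr_gt0.
have l20 : 0 <= lg n / 2 by lra.
have := expR_ge1Dxn m l20.
rewrite expr_div_n -mulrA -invfM => h.
have {}h : lg n ^+ m.+1 / C <= expR (lg n / 2) by rewrite /C; lra.
apply: le_trans (_ : eps * (lg n ^+ m.+1 / C) <= _); last by rewrite ler_pM2l.
have -> : eps * (lg n ^+ m.+1 / C) = lg n ^+ m * (lg n * eps / C) by rewrite exprS; ring.
rewrite ler_peMr ?exprn_ge0 ?(ltW l0) // ler_pdivlMr // mul1r.
by rewrite ler_pdivrMr // in lnC.
Qed.

End Asymptotics.

Section Cards.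
Variables (n : nat).

Lemma card_supersets (k : nat) (B : {set 'I_n}) :
  (#|[set e : subsets n k | B \subset val e]| <= n ^ (k - #|B|))%N.
Proof.
apply: (@leq_trans #|[set A : {set 'I_n} | #|A| == (k - #|B|)%N]|); last first.
  rewrite card_draws card_ord.
  by apply: leq_trans (bin_le_expn _ _); rewrite leq_pmulr // fact_gt0.
rewrite -(@card_in_imset _ _ (fun e : subsets n k => val e :\: B)).
  apply/subset_leq_card/subsetP => _ /imsetP[e + ->]; rewrite !inE => sB.
  by rewrite cardsD (setIidPr sB) (eqP (valP e)).
move=> e e'; rewrite !inE => sB sB' eq_ee'; apply: val_inj.
by rewrite -(setID (val e) B) -(setID (val e') B) eq_ee' !(setIidPr _).
Qed.

Lemma card_subsets_in (k j : nat) (e : subsets n k) :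
  (#|[set J : subsets n j | val J \subset val e]| <= 'C(k, j))%N.
Proof.
have <- : #|[set A : {set 'I_n} | A \subset val e & #|A| == j]| = 'C(k, j).
  by rewrite cards_draws (eqP (valP e)).
rewrite -(@card_in_imset _ _ (fun J : subsets n j => val J)).
  by apply/subset_leq_card/subsetP => _ /imsetP[J + ->]; rewrite !inE => ->; rewrite (valP J).
by move=> J J' _ _; apply: val_inj.
Qed.

Lemma card_setU_neq (j : nat) (J J' : subsets n j) : J != J' -> (j < #|val J :|: val J'|)%N.
Proof.
move=> nJ; apply: (@leq_ltn_trans #|val J|); first by rewrite (eqP (valP J)).
rewrite proper_card // properEneq subsetUl andbT.
apply: contra nJ => /eqP eJ; apply/eqP/val_inj/esym/eqP.
by rewrite eqEcard (eqP (valP J)) (eqP (valP J')) leqnn eJ subsetUr.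
Qed.

(** Two distinct j-sets have a union of at least [j + 1] elements, which costs one more factor n
    than a single j-set. *)
Lemma card_supersets2 (k j : nat) (J J' : subsets n j) : (0 < n)%N -> J != J' ->
  (#|[set e : subsets n k | (val J \subset val e) && (val J' \subset val e)]| <= n ^ (k - j - 1))%N.
Proof.
move=> n0 nJ.
have -> : [set e : subsets n k | (val J \subset val e) && (val J' \subset val e)] =
    [set e : subsets n k | val J :|: val J' \subset val e].
  by apply/setP => e; rewrite !inE subUset.
apply: leq_trans (card_supersets _ _) _; rewrite leq_pexp2l //.
by have := card_setU_neq nJ; lia.
Qed.

Lemma card_subsets (j : nat) : #|{: subsets n j}| = 'C(n, j).
Proof. by rewrite card_sig -[in RHS](card_ord n) -card_draws cardsE. Qed.

End Cards.

Lemma card_ord_lt (s r : nat) : (r <= s)%N -> #|(fun i : 'I_s => (i < r)%N)| = r.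
Proof.
move=> rs; transitivity (\sum_(i < s | (i < r)%N) 1)%N; first by rewrite sum1_card.
by rewrite -(big_ord_widen s (fun=> 1%N) rs) sum1_card card_ord.
Qed.

Definition graph_of (s k n : nat) (om : {set 'I_s * subsets n k}) : sfold_graph s k n :=
  [ffun i => colour_class om i].

(** * The subcritical regime: no jointly connected sets of logarithmic size *)

Section Subcritical.
Variables (R : realType) (s k j : nat).
Hypothesis hj : (1 <= j)%N.
Hypothesis hjk : (j < k)%N.

Let K := 'C(k, j).

Let inc n (J : subsets n j) (e : subsets n k) := val J \subset val e.

(** The window for [#|S|] confines [#|E|]: fewer edges than points from above, and from below at
    least [#|S| / K] edges, because an edge covers at most [K] points. *)
Lemma percolates_witness n (om : {set 'I_s * subsets n k}) (r L m0 : nat) (i0 : 'I_s) :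
  (0 < L)%N -> (L < 'C(n, j))%N -> (i0 < r)%N -> (K * m0 <= L.+1)%N ->
  percolates j (graph_of om) ->
  [exists i : 'I_s, (i < r)%N && [exists J0 : subsets n j, [exists m : 'I_(2 * L).+1, (m0 <= m)%N &&
     [exists E : {set subsets n k}, ((#|E| == m) && rooted (@inc n) J0 E) &&
     [exists S : {set subsets n j}, (S \subset span_points (@inc n) E) &&
        witness (@inc n) (fun i : 'I_s => (i < r)%N) m i E S om]]]]].
Proof.
move=> L0 LC i0r Km0 perc.
have s0 : (0 < s)%N by case: (i0) => i /=; case: (s).
pose Q := fun i : 'I_s => (i < r)%N.
have [| f stab | S cS /andP[LS SL]] := @jointly_connected_window _ _ (@inc n) s (colour_class om) Q L L0 _ _.
- by rewrite card_subsets.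
- apply: (percolates_stable s0 perc) => J J' link; apply: stab.
  + move=> i _; have [E + [J1 [J1' [eJ eJ' JE JE']]]] := link i.
    by rewrite ffunE => EH; apply/linksP; exists E, J1, J1'; split => //; rewrite !inE ?eJ ?eJ'.
  + by apply/set0Pn; exists J; rewrite !inE.
  + by apply/set0Pn; exists J'; rewrite !inE.
have S1 : (1 < #|S|)%N by apply: leq_trans LS.
have [i [J0 [E [[Qi sE] rE cE sS big]]]] := minimal_connecting_family i0r S1 cS.
have cSE : (#|S| <= #|E| * K)%N.
  by apply: leq_trans (subset_leq_card sS) (card_span_points (@card_subsets_in n k j) E).
have m1P : (#|E| < (2 * L).+1)%N by rewrite ltnS ltnW // (leq_trans cE).
apply/existsP; exists i; apply/andP; split => //.
apply/existsP; exists J0; apply/existsP; exists (Ordinal m1P); apply/andP; split => /=.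
  have K0 : (0 < K)%N by rewrite bin_gt0 ltnW.
  by rewrite -(leq_pmul2l K0); apply: leq_trans Km0 _; rewrite mulnC; apply: leq_trans cSE.
apply/existsP; exists E; rewrite eqxx rE /=; apply/existsP; exists S; rewrite sS /=.
apply/andP; split => //; apply/forallP => i'; apply/implyP; exact: big.
Qed.

Lemma prob_percolates_le n (p : 'I_s -> R) (r L m0 : nat) (th : R) :
  (forall i, 0 <= p i <= 1) -> (0 < L)%N -> (L < 'C(n, j))%N -> (0 < r <= s)%N ->
  (K * m0 <= L.+1)%N -> 0 <= th <= 1 ->
  (n ^ (k - j)).+1%:R * (expR 1 * 2) ^+ K * (\prod_(i < s | (i < r)%N) p i) *
    (expR 1 * (K ^ 2 * (2 * L) * n ^ (k - j - 1))%:R) ^+ r.-1 <= th ->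
  prob (colour_weight (X := subsets n k) p) (fun om => `[< percolates j (graph_of om) >]) <=
  s%:R * (n ^ j)%:R * (2 * L).+1%:R * expR 1 * th ^+ m0.
Proof.
move=> p01 L0 LC /andP[r0 rs] Km0 th01 le_th.
have n0 : (0 < n)%N by case: n LC {le_th} => //; rewrite bin0n; case: (j) hj.
have s0 : (0 < s)%N by apply: leq_trans rs.
have cQ := card_ord_lt rs.
have incD (J : subsets n j) : (#|[set e | inc J e]| <= n ^ (k - j))%N.
  by apply: leq_trans (card_supersets _ _) _; rewrite (eqP (valP J)).
have incD' (J J' : subsets n j) : J != J' -> (#|[set e | inc J e && inc J' e]| <= n ^ (k - j - 1))%N.
  by move=> nJ; apply: card_supersets2.
have D0 : (0 < n ^ (k - j))%N by rewrite expn_gt0 n0.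
rewrite -[r.-1](congr1 predn cQ) in le_th.
have := prob_exists_witness p01 (@card_subsets_in n k j) incD incD' m0 D0 th01 le_th.
move=> h; apply: le_trans (le_trans _ h) _.
  apply: le_prob; first exact: colour_weight01.
  by move=> om /asboolP; apply: (@percolates_witness _ _ _ _ _ (Ordinal s0)).
have [th0 _] := andP th01.
rewrite ler_wpM2r ?exprn_ge0 // ler_wpM2r ?expR_ge0 // ler_wpM2r // ler_wpM2l // ler_nat card_subsets.
by apply: leq_trans (bin_le_expn _ _); rewrite leq_pmulr // fact_gt0.
Qed.

End Subcritical.

(** * Constants below the threshold for p_1...p_r *)

Lemma bin_ge_linear (n j : nat) : (0 < j <= n)%N -> (n <= j * 'C(n, j))%N.
Proof.
case: j => [|j] // /andP[_ jn]; rewrite -mul_bin_diag leq_pmulr // bin_gt0.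
by case: n jn.
Qed.

Section SubcriticalProduct.
Variables (R : realType) (s k j : nat).
Hypothesis hj : (1 <= j)%N.
Hypothesis hjk : (j < k)%N.

(** With [L] of order log n, the quantity compared with [th] is a constant over [c]: the powers of n
    cancel because (k-j) + (r-1)(k-j-1) = r(k-j-1) + 1, and each further colour brings one logarithm
    through [L]. *)
Lemma subcritical_product : exists2 c0 : R, 0 < c0 & forall c, c0 <= c -> forall eps : R, 0 < eps ->
  exists N : nat, forall n, (N <= n)%N -> forall p : 'I_s -> R, (forall i, 0 <= p i <= 1) ->
  forall r : nat, (2 <= r <= s)%N ->
    \prod_(i < s | (i < r)%N) p i <=
            1 / (c * n%:R ^+ (r * (k - j - 1) + 1) * ln n%:R ^+ (r - 1)) ->
  prob (colour_weight (X := subsets n k) p) (fun om => `[< percolates j (graph_of om) >]) <= eps.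
Proof.
pose K := 'C(k, j).
have K0 : (0 < K)%N by rewrite bin_gt0 ltnW.
(* [A] absorbs [e * K ^ 2 * (2 * L)] with [L <= 2 * ln n]. In [G] the power [A ^+ s] stands for
   [A ^+ r.-1], so that the constant does not depend on [r]. *)
pose A : R := 4 * expR 1 * K%:R ^+ 2.
have e2 : 1 <= expR 1 :> R by have := expR_ge1Dx (1 : R); lra.
have A1 : 1 <= A.
  rewrite /A -mulrA mulr_ege1 ?mulr_ege1 ?exprn_ege1 ?ler1n //; lra.
pose G : R := 2 * (expR 1 * 2) ^+ K * A ^+ s.
(* About [ln n / K] edges are guaranteed, so [th ^+ m0] is of order n^-(j+2), which beats n^j roots
   times a logarithm. *)
pose th : R := expR (- (K * (j + 2))%:R).
have th01 : 0 <= th <= 1 by rewrite expR_ge0 expR_le1 oppr_le0 ler0n.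
have th0 : 0 < th by exact: expR_gt0.
have G0 : 0 < G.
  rewrite /G; apply: mulr_gt0; last by apply: exprn_gt0; lra.
  by rewrite mulr_gt0 ?exprn_gt0 ?mulr_gt0 ?expR_gt0.
exists (G / th); first by rewrite divr_gt0.
move=> c cG eps eps0.
have c0 : 0 < c by apply: lt_le_trans cG; rewrite divr_gt0.
have [N1 N1P] := ln_nat_large (1 : R).
pose C : R := 5 * s%:R * expR 1 * expR ((j + 2) * K)%:R + 1.
have C0 : 0 < C by rewrite ltr_wpDl // !mulr_ge0 ?expR_ge0.
have [N2 N2P] := @ln_nat_poly R (eps / C) 1 (divr_gt0 eps0 C0).
have jR0 : 0 < j%:R :> R by rewrite ltr0n.
have [N3 N3P] := @ln_nat_poly R ((3 * j%:R)^-1) 1 ltac:(by rewrite invr_gt0 mulr_gt0).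
exists (N1 + N2 + N3 + j + 1)%N => n Nn p p01 r /andP[r2 rs] le_p.
have n_gt0 : (0 < n)%N by clear -Nn; lia.
have n0 : 0 < n%:R :> R by rewrite ltr0n.
have l1 : 1 <= ln n%:R :> R by apply: N1P; clear -Nn; lia.
set l := ln n%:R in l1 le_p *.
have l0 : 0 < l by lra.
have el : expR l = n%:R by exact: expR_ln_nat.
have eh : expR (l / 2) <= n%:R by rewrite -el ler_expR; lra.
pose L := (Num.trunc l).+1.
have Ll : l <= L%:R by apply/ltW/truncnS_gt.
have L2 : L%:R <= 2 * l.
  have : (Num.trunc l)%:R <= l by rewrite truncn_le ltW.
  by rewrite /L -natr1; lra.
have L_gt0 : (0 < L)%N by [].
clearbody L.
have jC : (n <= j * 'C(n, j))%N by apply: bin_ge_linear; clear -Nn hj; lia.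
have LC : (L < 'C(n, j))%N.
  rewrite -(ltr_nat R) -(ltr_pM2l jR0); apply: lt_le_trans (_ : n%:R <= _); last first.
    by rewrite -natrM ler_nat.
  have := N3P n ltac:(clear -Nn; lia); rewrite expr1 -/l mulrC ler_pdivlMr ?mulr_gt0 // => h.
  apply: le_lt_trans (_ : j%:R * (2 * l) < _); first by rewrite ler_pM2l.
  by have := mulr_gt0 jR0 l0; lra.
pose m0 := (L.+1 %/ K)%N.
have Km0 : (K * m0 <= L.+1)%N by rewrite mulnC leq_trunc_div.
have Km0' : (L <= K * m0 + K)%N.
  by rewrite /m0; have := divn_eq L.+1 K; have := ltn_pmod L.+1 K0; clear; nia.
clearbody m0.
have le_th : (n ^ (k - j)).+1%:R * (expR 1 * 2) ^+ K * (\prod_(i < s | (i < r)%N) p i) *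
    (expR 1 * (K ^ 2 * (2 * L) * n ^ (k - j - 1))%:R) ^+ r.-1 <= th.
  set P := \prod_(i < s | _) _ in le_p *.
  have P0 : 0 <= P by apply: prodr_ge0 => i _; have /andP[] := p01 i.
  pose Y : R := n%:R ^+ (k - j - 1).
  have Y0 : 0 < Y by exact: exprn_gt0.
  have nk : n%:R ^+ (k - j) = n%:R * Y by rewrite -exprS; congr (_ ^+ _); clear -hjk; lia.
  have h1 : (n ^ (k - j)).+1%:R <= 2 * (n%:R * Y).
    rewrite -nk -natrX -natrM ler_nat; have := expn_gt0 n (k - j); rewrite n_gt0 /=; clear; lia.
  have h2 : (expR 1 * (K ^ 2 * (2 * L) * n ^ (k - j - 1))%:R) ^+ r.-1 <= (A * l * Y) ^+ r.-1.
    have AlY : 0 <= A * l * Y by apply: mulr_ge0 (ltW Y0); apply: mulr_ge0; lra.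
    apply: lerXn2r; rewrite ?nnegrE //; first by rewrite mulr_ge0 ?expR_ge0.
    rewrite !natrM !natrX -/Y mulrA ler_pM2r //.
    have z0 : 0 <= expR 1 * K%:R ^+ 2 :> R by rewrite mulr_ge0 ?expR_ge0 ?exprn_ge0.
    have -> : A * l = expR 1 * K%:R ^+ 2 * (4 * l) by rewrite /A; ring.
    by rewrite mulrA; apply: ler_wpM2l => //; lra.
  have Q0 : 0 < (expR 1 * 2) ^+ K :> R by rewrite exprn_gt0 // mulr_gt0 ?expR_gt0.
  apply: le_trans (_ : 2 * (n%:R * Y) * (expR 1 * 2) ^+ K * P * (A * l * Y) ^+ r.-1 <= _).
    rewrite ler_pM ?exprn_ge0 ?mulr_ge0 ?expR_ge0 ?(ltW Q0) //.
    by rewrite ler_wpM2r // ler_pM2r.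
  have den : n%:R ^+ (r * (k - j - 1) + 1) = n%:R * Y * Y ^+ r.-1.
    rewrite addn1 exprS -mulrA; congr (_ * _).
    by rewrite mulnC exprM -/Y -exprS prednK //; clear -r2; lia.
  have le_p' : P * (n%:R * Y * (A * l * Y) ^+ r.-1) <= A ^+ r.-1 / c.
    have pos : 0 < c * n%:R ^+ (r * (k - j - 1) + 1) * l ^+ (r - 1).
      by rewrite !mulr_gt0 ?exprn_gt0.
    move: le_p; rewrite ler_pdivlMr // den subn1 => le_p.
    rewrite ler_pdivlMr //.
    have -> : P * (n%:R * Y * (A * l * Y) ^+ r.-1) * c =
        A ^+ r.-1 * (P * (c * (n%:R * Y * Y ^+ r.-1) * l ^+ r.-1)).
      by rewrite [(A * l * Y) ^+ _]exprMn [(A * l) ^+ _]exprMn; ring.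
    by rewrite -[X in _ <= X]mulr1 ler_wpM2l // exprn_ge0 //; lra.
  have -> : 2 * (n%:R * Y) * (expR 1 * 2) ^+ K * P * (A * l * Y) ^+ r.-1 =
    2 * (expR 1 * 2) ^+ K * (P * (n%:R * Y * (A * l * Y) ^+ r.-1)) by ring.
  apply: le_trans (ler_wpM2l _ le_p') _; first by rewrite mulr_ge0 ?ltW.
  rewrite mulrA ler_pdivrMr //; apply: le_trans (_ : G <= _).
    rewrite /G ler_wpM2l ?mulr_ge0 ?(ltW Q0) //; apply: ler_weXn2l => //; clear -r2 rs; lia.
  by rewrite mulrC -ler_pdivrMr.
have r0s : (0 < r <= s)%N by clear -r2 rs; lia.
apply: le_trans (prob_percolates_le hj hjk p01 _ LC r0s Km0 th01 le_th) _ => //.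
have thm : th ^+ m0 <= expR ((j + 2) * K)%:R / n%:R ^+ (j + 2).
  rewrite /th -el -!expRM_natl -expRB ler_expR.
  have : l <= K%:R * m0%:R + K%:R by apply: le_trans Ll _; rewrite -natrM -natrD ler_nat.
  rewrite !natrM => h.
  have := ler_wpM2l (ler0n R (j + 2)) h; lra.
have L5 : (2 * L).+1%:R <= 5 * l by rewrite -natr1 natrM; clear -L2 l1; lra.
apply: le_trans (_ : s%:R * (n ^ j)%:R * (5 * l) * expR 1 * (expR ((j + 2) * K)%:R / n%:R ^+ (j + 2)) <= _).
  apply: ler_pM => //; rewrite ?mulr_ge0 ?expR_ge0 ?exprn_ge0 //; first by case/andP: th01.
  by rewrite ler_wpM2r ?expR_ge0 // ler_wpM2l ?mulr_ge0.
have -> : s%:R * (n ^ j)%:R * (5 * l) * expR 1 * (expR ((j + 2) * K)%:R / n%:R ^+ (j + 2)) =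
    (C - 1) * l / n%:R ^+ 2.
  by rewrite natrX exprD /C; field; rewrite !expf_neq0 // gt_eqF.
have := N2P n ltac:(clear -Nn; lia); rewrite expr1 -/l => h.
rewrite ler_pdivrMr ?exprn_gt0 //.
apply: le_trans (_ : C * l <= _); first by rewrite ler_pM2r //; lra.
apply: le_trans (_ : eps * n%:R <= _).
  rewrite mulrC -ler_pdivlMr //; apply: le_trans h _.
  by rewrite [eps * n%:R / C]mulrAC ler_wpM2l // divr_ge0 ?ltW.
by rewrite ler_pM2l // expr2 ler_peMr ?(ltW n0) // ler1n.
Qed.

End SubcriticalProduct.

(** * Isolated j-sets below the threshold for p_1 *)

Lemma second_moment (R : realFieldType) (I Y : finType) (w : I -> R) (A : Y -> pred {set I}) :
  (forall x, 0 <= w x <= 1) ->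
  (\sum_y prob w (A y)) ^+ 2 * prob w (fun om => [forall y, ~~ A y om]) <=
  \sum_y \sum_y' prob w (fun om => A y om && A y' om) - (\sum_y prob w (A y)) ^+ 2.
Proof.
move=> w01; set mu := \sum_y prob w (A y).
pose X om : R := \sum_y (A y om)%:R.
have EX : expectation w X = mu by rewrite /X expectation_sum.
have EX2 : expectation w (fun om => X om ^+ 2) = \sum_y \sum_y' prob w (fun om => A y om && A y' om).
  transitivity (expectation w (fun om => \sum_y \sum_y' (A y om && A y' om)%:R : R)).
    apply: eq_expectation => om; rewrite expr2 /X big_distrlr /=.
    by apply: eq_bigr => y _; apply: eq_bigr => y' _; rewrite -natrM mulnb.
  by rewrite expectation_sum; apply: eq_bigr => y _; rewrite expectation_sum.
have -> : \sum_y \sum_y' prob w (fun om => A y om && A y' om) - mu ^+ 2 =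
    expectation w (fun om => (X om - mu) ^+ 2).
  rewrite (@eq_expectation _ _ _ _ (fun om => X om ^+ 2 + ((- (2 * mu)) * X om + mu ^+ 2))); last by move=> om; ring.
  by rewrite !expectationD expectationZ expectation_cst EX EX2; ring.
(* Chebyshev: where none of the events occurs, [X] vanishes and [(X om - mu) ^+ 2] equals
   [mu ^+ 2]. *)
rewrite -expectationZ; apply: le_expectation => // om.
case: forallP => [none | _]; last by rewrite mulr0 sqr_ge0.
by rewrite mulr1 /X big1 ?sub0r ?sqrrN // => y _; rewrite (negbTE (none y)).
Qed.

Lemma exp_oneB_ge (R : realType) (q : R) (d : nat) : 0 <= q -> q <= 2^-1 ->
  expR (- (2 * q * d%:R)) <= (1 - q) ^+ d.
Proof.
move=> q0 q2; rewrite -mulNr expRM_natr lerXn2r ?nnegrE ?expR_ge0 //; first lra.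
rewrite expRN -[X in X <= _]mul1r ler_pdivrMr ?expR_gt0 //.
apply: le_trans (_ : (1 - q) * (1 + 2 * q) <= _); first by nra.
by rewrite ler_wpM2l ?expR_ge1Dx //; lra.
Qed.

Lemma bernoulli_ineq (R : realFieldType) (q : R) (m : nat) : 0 <= q <= 1 ->
  1 - q * m%:R <= (1 - q) ^+ m.
Proof.
move=> /andP[q0 q1]; elim: m => [|m IHm]; first by rewrite mulr0 subr0.
rewrite exprS; apply: le_trans (ler_wpM2l _ IHm); last lra.
by rewrite -natr1; have := mulr_ge0 (mulr_ge0 q0 q0) (ler0n R m); lra.
Qed.

Section Isolated.
Variables (R : realType) (s k j : nat).
Hypothesis hj : (1 <= j)%N.
Hypothesis hjk : (j < k)%N.

Definition star n (i0 : 'I_s) (J : subsets n j) : {set 'I_s * subsets n k} :=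
  [set x : 'I_s * subsets n k | (x.1 == i0) && (val J \subset val x.2)].

(** The indicator labelling of [J] is stable if no edge of colour [i0] contains [J], and it is not
    constant because [j < n] leaves a second j-set. *)
Lemma percolates_not_isolated n (i0 : 'I_s) (om : {set 'I_s * subsets n k}) (J : subsets n j) :
  (j < n)%N -> percolates j (graph_of om) -> ~~ [disjoint star i0 J & om].
Proof.
move=> jn perc; apply/negP => dJ.
have s0 : (0 < s)%N by case: (i0) => i /=; case: (s).
have : (1 < #|subsets n j|)%N.
  by rewrite card_subsets; have := @bin_ge_linear n j; have := mul_bin_diag n j.-1; nia.
case/card_gt1P => J1 [J2 [_ _ nJ]].
suff st : stable (graph_of om) (fun J' => J' == J).
  have const := percolates_stable s0 perc st.
  by move: nJ; rewrite (eqP (_ : J1 == J)) ?(const J1 J) // (eqP (_ : J2 == J)) ?(const J2 J) ?eqxx.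
have noJ E (J' : subsets n j) : E \in graph_of om i0 -> val J' \subset val E -> J' != J.
  rewrite ffunE inE => Eom JE; apply/eqP => eJ; rewrite eJ in JE.
  have : (i0, E) \in star i0 J by rewrite inE eqxx.
  by move/(disjointFr dJ); rewrite Eom.
move=> J' J'' link; have [E EH [K1 [K2 [e1 e2 s1 s2]]]] := link i0.
by rewrite -e1 -e2 (negbTE (noJ _ _ EH s1)) (negbTE (noJ _ _ EH s2)).
Qed.

(** Since [c >= 4], twice the expected degree of a j-set is at most [ln n / 2], so it is isolated
    with probability at least n^(-1/2), and at least n/j such sets give a mean of at least
    sqrt(n)/j. Two distinct stars share at most n^(k-j-1) edges, so the events are nearly
    uncorrelated. *)
Lemma subcritical_isolated (c : R) : 4 <= c -> forall eps : R, 0 < eps ->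
  exists N : nat, forall n, (N <= n)%N -> forall p : 'I_s -> R, (forall i, 0 <= p i <= 1) ->
  forall i0 : 'I_s, p i0 <= ln n%:R / (c * n%:R ^+ (k - j)) ->
  prob (colour_weight (X := subsets n k) p) (fun om => `[< percolates j (graph_of om) >]) <= eps.
Proof.
move=> c4 eps eps0.
have c0 : 0 < c by lra.
have jR0 : 0 < j%:R :> R by rewrite ltr0n.
have [N1 N1P] := ln_nat_large (4 * j%:R / eps + 1 : R).
(* The final bound is [1/mu + 2 * del] with [mu >= 2/eps]; the cap 1/2 is for
   [(1 - del) * (1 + 2 * del) >= 1]. *)
pose del := Num.min (2^-1) (eps / 4).
have del0 : 0 < del by rewrite lt_min; apply/andP; split; lra.
have del2 : del <= 2^-1 by rewrite ge_min lexx.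
have del4 : del <= eps / 4 by rewrite ge_min lexx orbT.
have del_ge : 1 <= (1 - del) * (1 + 2 * del) by nra.
have del2' : 0 <= 1 + 2 * del by lra.
have half_eps : 0 < (eps / 2)^-1 by rewrite invr_gt0; lra.
have eps_sum (x y : R) : x <= eps / 2 -> y <= eps / 4 -> x + 2 * y <= eps by lra.
have [N2 N2P] := @ln_nat_poly R del 1 del0.
exists (N1 + N2 + k + 1)%N => n Nn p p01 i0 le_p.
have n_gt0 : (0 < n)%N by clear -Nn; lia.
have n0 : 0 < n%:R :> R by rewrite ltr0n.
have n1 : 1 <= n%:R :> R by rewrite ler1n.
have jn : (j < n)%N by clear -Nn hjk; lia.
have lbig := N1P n ltac:(clear -Nn; lia).
have lsmall := N2P n ltac:(clear -Nn; lia); rewrite expr1 in lsmall.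
set l := ln n%:R in lbig lsmall le_p.
have l0 : 0 < l by apply: lt_le_trans lbig; rewrite ltr_wpDl // divr_ge0 ?mulr_ge0 ?ltW.
have l_big : 2 / eps * j%:R <= 1 + l / 2.
  have -> : 2 / eps * j%:R = (4 * j%:R / eps) / 2 by field; rewrite gt_eqF.
  by lra.
have l_half : l / 2 + l / 2 = l by field.
have el : expR l = n%:R by exact: expR_ln_nat.
have eh : expR (l / 2) <= n%:R by rewrite -el ler_expR; lra.
have q01 := p01 i0; set q := p i0 in le_p q01; case/andP: q01 => q0 q1.
have Y0 : 0 < n%:R ^+ (k - j) :> R by exact: exprn_gt0.
have qd : q * n%:R ^+ (k - j) <= l / 4.
  move: le_p; rewrite invfM mulrA ler_pdivlMr // => h; apply: le_trans h _.
  by rewrite ler_pM2l // lef_pV2 ?posrE.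
have qn : q * n%:R ^+ (k - j - 1) <= del.
  rewrite -(ler_pM2r n0) -mulrA -exprSr (_ : (k - j - 1).+1 = (k - j)%N); last by clear -hjk; lia.
  apply: le_trans qd _; apply: le_trans (_ : l <= _); first lra.
  by apply: le_trans lsmall _; rewrite ler_pM2l.
have q2 : q <= 2^-1.
  apply: le_trans del2; apply: le_trans qn; rewrite ler_peMr // exprn_ege1 //.
have q1' : 0 < 1 - q by lra.
pose w := colour_weight (X := subsets n k) p.
have w01 : forall x, 0 <= w x <= 1 by exact: colour_weight01.
pose iso (J : subsets n j) : pred {set 'I_s * subsets n k} := fun om => [disjoint star i0 J & om].
have Pdisj (B : {set 'I_s * subsets n k}) : (forall x, x \in B -> x.1 = i0) ->
    prob w (fun om => [disjoint B & om]) = (1 - q) ^+ #|B|.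
  move=> HB; rewrite prob_disjoint -prodr_const; apply: eq_bigr => x /HB xi.
  by rewrite /w /colour_weight xi.
have star_i0 J x : x \in star i0 J -> x.1 = i0 by rewrite inE => /andP[/eqP].
pose a (J : subsets n j) : R := (1 - q) ^+ #|star i0 J|.
have Piso J : prob w (iso J) = a J by apply: Pdisj; apply: star_i0.
have a0 J : 0 < a J by rewrite exprn_gt0.
have card_star (B : {set 'I_n}) m : (#|[set e : subsets n k | B \subset val e]| <= m)%N ->
    (#|[set x : 'I_s * subsets n k | (x.1 == i0) && (B \subset val x.2)]| <= m)%N.
  move=> h; apply: leq_trans h.
  rewrite -(@card_in_imset _ _ snd); last first.
    move=> [i e] [i' e']; rewrite !inE /= => /andP[/eqP-> _] /andP[/eqP-> _] -> //.
  by apply/subset_leq_card/subsetP => _ /imsetP[[i e] + ->]; rewrite !inE /= => /andP[_].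
have a_ge J : expR (- (l / 2)) <= a J.
  apply: le_trans (exp_oneB_ge _ q0 q2); rewrite ler_expR lerN2.
  have : (#|star i0 J| <= n ^ (k - j))%N.
    by apply: card_star; apply: leq_trans (card_supersets _ _) _; rewrite (eqP (valP J)).
  rewrite -(ler_nat R) natrX => /(ler_wpM2l q0); lra.
pose mu := \sum_J a J.
have mu_ge : expR (l / 2) / j%:R <= mu.
  apply: le_trans (_ : \sum_(J : subsets n j) expR (- (l / 2)) <= _); last by apply: ler_sum.
  rewrite sumr_const -[X in _ <= X]mulr_natl cardT -cardE card_subsets.
  rewrite ler_pdivrMr // mulrAC expRN ler_pdivlMr ?expR_gt0 // -expRD.
  by rewrite l_half el -natrM ler_nat mulnC bin_ge_linear // hj ltnW.
have mu0 : 0 < mu by apply: lt_le_trans mu_ge; rewrite divr_gt0 ?expR_gt0.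
have := second_moment iso w01.
rewrite (eq_bigr a) => [|J _]; last exact: Piso.
rewrite -/mu => h.
apply: le_trans (_ : prob w (fun om => [forall J, ~~ iso J om]) <= _).
  apply: le_prob => // om /asboolP perc; apply/forallP => J; exact: percolates_not_isolated.
have pair_le J J' : prob w (fun om => iso J om && iso J' om) <=
    (if J == J' then a J else 0) + a J * a J' * (1 + 2 * del).
  have [<- | nJ] := eqVneq J J'.
    rewrite (@eq_prob _ _ _ _ (iso J)); last by move=> om; rewrite andbb.
    rewrite Piso lerDl; apply: mulr_ge0; first by apply: mulr_ge0; exact: ltW.
    by rewrite addr_ge0 // mulr_ge0 // ltW.
  rewrite add0r.
  rewrite (@eq_prob _ _ _ _ (fun om => [disjoint star i0 J :|: star i0 J' & om])); last first.
    by move=> om; rewrite /iso !disjoints_subset subUset.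
  rewrite Pdisj; last by move=> x; rewrite inE => /orP[]; apply: star_i0.
  set U := star i0 J :|: _; set I' := star i0 J :&: star i0 J'.
  (* The joint probability is the product [a J * a J'] divided by the probability that the common
     part is empty, which is at least [1 - del]. *)
  have cUI : (1 - q) ^+ #|U| * (1 - q) ^+ #|I'| = a J * a J' by rewrite -!exprD cardsUI.
  have cI : (#|I'| <= n ^ (k - j - 1))%N.
    have -> : I' = [set x : 'I_s * subsets n k | (x.1 == i0) && (val J :|: val J' \subset val x.2)].
      by apply/setP => x; rewrite !inE subUset; case: (x.1 == i0).
    apply: card_star; have := card_supersets2 k n_gt0 nJ.
    by under eq_finset do rewrite -subUset.
  have I_ge : 1 - del <= (1 - q) ^+ #|I'|.
    apply: le_trans (bernoulli_ineq _ _); last by rewrite q0.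
    rewrite lerD2l lerN2; apply: le_trans qn.
    by rewrite ler_wpM2l // -natrX ler_nat.
  have U0 : 0 <= (1 - q) ^+ #|U| by rewrite exprn_ge0 // subr_ge0.
  rewrite -cUI -mulrA ler_peMr //.
  by apply: le_trans del_ge _; rewrite ler_wpM2r.
have sum_le : \sum_J \sum_J' prob w (fun om => iso J om && iso J' om) <= mu + mu ^+ 2 * (1 + 2 * del).
  apply: le_trans (_ : \sum_J \sum_J' ((if J == J' then a J else 0) + a J * a J' * (1 + 2 * del)) <= _).
    by apply: ler_sum => J _; apply: ler_sum => J' _; apply: pair_le.
  under eq_bigr do rewrite big_split /=.
  rewrite big_split /=; apply: lerD.
    apply: ler_sum => J _; rewrite -big_mkcond /= (eq_bigl (pred1 J)); last by move=> J'; rewrite /= eq_sym.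
    by rewrite big_pred1_eq.
  rewrite expr2 {1}/mu big_distrlr /= mulr_suml; apply: ler_sum => J _.
  by rewrite mulr_suml.
have {}h : mu ^+ 2 * prob w (fun om => [forall J, ~~ iso J om]) <= mu + mu ^+ 2 * (2 * del).
  have -> : mu + mu ^+ 2 * (2 * del) = mu + mu ^+ 2 * (1 + 2 * del) - mu ^+ 2 by ring.
  by apply: le_trans h _; rewrite lerD2r.
have mu_inv : mu^-1 <= eps / 2.
  rewrite -[X in _ <= X]invrK lef_pV2 ?posrE //.
  apply: le_trans mu_ge; rewrite ler_pdivlMr // invf_div.
  apply: le_trans (expR_ge1Dx _).
  exact: l_big.
apply: le_trans (eps_sum _ _ mu_inv del4).
rewrite -(ler_pM2l (exprn_gt0 2 mu0)); apply: le_trans h _.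
by rewrite mulrDr lerD2r expr2 mulfK // gt_eqF.
Qed.

End Isolated.

(** * Joint exploration of several random graphs on one vertex set *)

Lemma disjoint_setI (I : finType) (A D om : {set I}) : A \subset D ->
  [disjoint A & om :&: D] = [disjoint A & om].
Proof.
move=> /setIidPl AD; rewrite -!setI_eq0; congr (_ == set0).
by rewrite setIA setIAC AD.
Qed.

Section Joint.
Variables (R : realType) (s : nat) (I V : finType).
Variables (col : I -> 'I_s) (ends : I -> {set V}) (p : 'I_s -> R) (M : nat) (V0 : {set V}).
Hypothesis p01 : forall i, 0 <= p i <= 1.
Hypothesis cardM : forall (i : 'I_s) u v, u \in V0 -> v \in V0 -> u != v ->
  (M <= #|[set x | (col x == i) && (ends x == [set u; v])]|)%N.

Let w (x : I) : R := p (col x).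

Let w01 x : 0 <= w x <= 1. Proof. exact: p01. Qed.

(** Several coordinates may have the same [ends]; [cardM] guarantees [M] of each colour over every
    pair in [V0]. Revealed information is tracked as sets of coordinates of the form
    [between A B]. *)
Definition between (A B : {set V}) : {set I} :=
  [set x | [exists a in A, [exists b in B, ends x == [set a; b]]]].

Lemma betweenP (A B : {set V}) x :
  reflect (exists a b, [/\ a \in A, b \in B & ends x = [set a; b]]) (x \in between A B).
Proof.
rewrite inE; apply: (iffP existsP) => [[a /andP[aA /existsP[b /andP[bB /eqP xab]]]] | ].
  by exists a, b.
by move=> [a [b [aA bB xab]]]; exists a; rewrite aA; apply/existsP; exists b; rewrite bB xab /=.
Qed.

Lemma betweenS (A A' B B' : {set V}) : A \subset A' -> B \subset B' -> between A B \subset between A' B'.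
Proof.
move=> /subsetP sA /subsetP sB; apply/subsetP => x /betweenP[a [b [aA bB xab]]].
by apply/betweenP; exists a, b; rewrite sA ?sB.
Qed.

Lemma between_sym A B : between A B = between B A.
Proof.
by apply/setP => x; apply/betweenP/betweenP => -[a [b [aA bB xab]]]; exists b, a; rewrite setUC.
Qed.

(** A coordinate between [A] and [B] has an endpoint in [A], which those between [A'] and [B'] lack.
    This is how freshness of a later stage is checked. *)
Lemma between_disjoint (A B A' B' : {set V}) :
  [disjoint A & A'] -> [disjoint A & B'] -> between A' B' \subset ~: between A B.
Proof.
move=> dA dB; apply/subsetP => x /betweenP[a' [b' [aA' bB' xab']]]; rewrite inE.
apply/betweenP => -[a [b [aA bB xab]]].
have : a \in [set a'; b'] by rewrite -xab' xab !inE eqxx.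
by rewrite !inE => /orP[] /eqP ea; [have := disjointFr dA aA | have := disjointFr dB aA];
   rewrite ea ?aA' ?bB'.
Qed.

Definition edges_to (i : 'I_s) (u : V) (S : {set V}) : {set I} :=
  [set x in between [set u] S | col x == i].

Lemma edges_toP i u (S : {set V}) x :
  reflect (col x = i /\ exists2 v, v \in S & ends x = [set u; v]) (x \in edges_to i u S).
Proof.
rewrite inE; apply: (iffP andP) => [[/betweenP[u' [v []]]] | [-> [v vS xuv]]].
  by rewrite inE => /eqP-> vS xuv /eqP xi; split => //; exists v.
by rewrite eqxx; split => //; apply/betweenP; exists u, v; rewrite inE.
Qed.

(** Different colours may reach [S] at different vertices. *)
Definition jadj (om : {set I}) (u : V) (S : {set V}) :=
  [forall i, ~~ [disjoint edges_to i u S & om]].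

Lemma jadj_dep u S : depends_on (between [set u] S) (fun om => jadj om u S).
Proof.
move=> om; rewrite /jadj; apply: eq_forallb => i; congr (~~ _).
by apply: disjoint_setI; apply/subsetP => x; rewrite inE => /andP[].
Qed.

Lemma jadjP (om : {set I}) u (S : {set V}) :
  reflect (forall i, exists x v, [/\ x \in om, col x = i, v \in S & ends x = [set u; v]])
    (jadj om u S).
Proof.
apply: (iffP forallP) => adj i.
  have /pred0Pn[x /= /andP[/edges_toP[xi [v vS xuv]] xom]] := adj i.
  by exists x, v.
have [x [v [xom xi vS xuv]]] := adj i; apply/pred0Pn; exists x; rewrite /= xom andbT.
by apply/edges_toP; split => //; exists v.
Qed.

Lemma jadjS (om : {set I}) u (S S' : {set V}) : S \subset S' -> jadj om u S -> jadj om u S'.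
Proof.
move=> /subsetP sS /jadjP adj; apply/jadjP => i; have [x [v [? ? vS ?]]] := adj i.
by exists x, v; rewrite sS.
Qed.

Definition join_rate (t : nat) : R := \prod_i (1 - (1 - p i) ^+ (M * t)).

Lemma join_rate01 t : 0 <= join_rate t <= 1.
Proof.
have fac i : 0 <= 1 - (1 - p i) ^+ (M * t) <= 1.
  have /andP[p0 p1] := p01 i.
  have q0 : 0 <= (1 - p i) ^+ (M * t) by rewrite exprn_ge0 //; lra.
  have q1 : (1 - p i) ^+ (M * t) <= 1 by rewrite exprn_ile1 //; lra.
  lra.
apply/andP; split; first by apply: prodr_ge0 => i _; have /andP[] := fac i.
have <- : \prod_(i < s) 1 = 1 :> R by rewrite big1.
exact: ler_prod.
Qed.

Lemma card_edges_to i u (S : {set V}) : S \subset V0 -> u \in V0 -> u \notin S ->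
  (M * #|S| <= #|edges_to i u S|)%N.
Proof.
move=> /subsetP sS uV uS.
rewrite mulnC -sum_nat_const.
apply: (@leq_trans (\sum_(v in S) #|[set x | (col x == i) && (ends x == [set u; v])]|)).
  by apply: leq_sum => v vS; apply: cardM => //; [exact: sS | apply: contraNneq uS => ->].
under eq_bigr do rewrite -sum1_card big_mkcond.
rewrite exchange_big /= -sum1_card [X in (_ <= X)%N]big_mkcond /=; apply: leq_sum => x _.
have [ | none] := boolP [exists v in S, x \in [set x | (col x == i) && (ends x == [set u; v])]]; last first.
  rewrite big1 // => v vS; case: ifP => // xv; case/negP: none; apply/existsP; exists v.
  by rewrite vS xv.
case/existsP => v /andP[vS]; rewrite inE => /andP[xi /eqP xuv].
have -> : x \in edges_to i u S.
  by apply/edges_toP; split; [exact/eqP | exists v].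
rewrite (bigD1 v) //= inE xi xuv eqxx /= big1 // => v' /andP[v'S nv].
rewrite inE xi /= xuv; case: eqP => // /setP/(_ v'); rewrite !inE eqxx orbT.
by rewrite (negbTE nv) orbF => /eqP ev; rewrite -ev v'S in uS.
Qed.

Lemma prob_jadj u (S : {set V}) : S \subset V0 -> u \in V0 -> u \notin S ->
  join_rate #|S| <= prob w (fun om => jadj om u S).
Proof.
move=> sS uV uS.
have -> : prob w (fun om => jadj om u S) =
    expectation w (fun om => \prod_(i <- enum 'I_s) (~~ [disjoint edges_to i u S & om])%:R).
  apply: eq_expectation => om; rewrite big_enum /=.
  have [/forallP all_i | /forallPn[i ni]] := boolP (jadj om u S).
    by rewrite big1 // => i _; rewrite all_i.
  by rewrite (bigD1 i) //= (negbTE ni) mul0r.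
rewrite (@expectation_prod_indep _ _ _ _ _ (fun i => edges_to i u S)) ?enum_uniq //; first last.
- by move=> i _ om; rewrite disjoint_setI.
- move=> i i' _ _ ni; rewrite -setI_eq0; apply/eqP/setP => x; rewrite !inE.
  by apply/negP => /andP[/andP[_ /eqP ->] /andP[_ /eqP ei]]; rewrite ei eqxx in ni.
rewrite big_enum /=; apply: ler_prod => i _.
have /andP[p0 p1] := p01 i.
have q0 : 0 <= (1 - p i) ^+ (M * #|S|) by rewrite exprn_ge0 //; lra.
have q1 : (1 - p i) ^+ (M * #|S|) <= 1 by rewrite exprn_ile1 //; lra.
apply/andP; split; first lra.
rewrite [X in _ <= X](_ : _ = prob w (fun om => ~~ [disjoint edges_to i u S & om])) //.
rewrite probC prob_disjoint lerD2l lerN2.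
rewrite (eq_bigr (fun=> 1 - p i)); last by move=> x; rewrite inE /w => /andP[_ /eqP ->].
rewrite prodr_const; apply: ler_wiXn2l; [lra | lra | exact: card_edges_to].
Qed.

Definition nbrs (om : {set I}) (S P : {set V}) : {set V} := [set u in P | jadj om u S].

Lemma nbrs_dep S P : depends_on (between P S) (fun om => nbrs om S P).
Proof.
move=> om; apply/setP => u; rewrite !inE; case: (boolP (u \in P)) => //= uP.
apply: (depends_onS _ (@jadj_dep u S)); apply: betweenS; by rewrite ?sub1set.
Qed.

Lemma nbrs_sub om S P : nbrs om S P \subset P.
Proof. by apply/subsetP => u; rewrite inE => /andP[]. Qed.

(** Different vertices of [P] look at disjoint coordinates, so the generating function factorises.
    Setting [x = 0] gives the chance of no neighbour, since [0 ^+ 0 = 1], and [x = 1/2] a Chernoff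
    bound. *)
Lemma expectation_nbrs (x : R) (S P : {set V}) : 0 <= x <= 1 ->
  S \subset V0 -> P \subset V0 -> [disjoint P & S] ->
  expectation w (fun om => x ^+ #|nbrs om S P|) <= (1 - (1 - x) * join_rate #|S|) ^+ #|P|.
Proof.
move=> /andP[x0 x1] sS sP dPS.
have -> : expectation w (fun om => x ^+ #|nbrs om S P|) =
    expectation w (fun om => \prod_(u <- enum P) (1 - (1 - x) * (jadj om u S)%:R)).
  apply: eq_expectation => om; rewrite big_enum /= -prodr_const.
  rewrite [LHS](eq_bigl (fun u => (u \in P) && jadj om u S)); last by move=> u; rewrite inE.
  rewrite big_mkcondr; apply: eq_bigr => u _; case: ifP => _ /=; rewrite ?mulr1 ?mulr0 ?subr0 //.
  by ring.
rewrite (@expectation_prod_indep _ _ _ _ _ (fun u => between [set u] S)) ?enum_uniq //; first last.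
- by move=> u _ om; rewrite jadj_dep.
- move=> u u'; rewrite !mem_enum => uP u'P nu.
  rewrite disjoint_sym disjoints_subset; apply: between_disjoint.
    by rewrite disjoints1 inE.
  by rewrite disjoints1 (disjointFr dPS).
rewrite big_enum /= -prodr_const; apply: ler_prod => u uP; apply/andP; split.
  apply: sumr_ge0 => om _; rewrite mulr_ge0 ?mass_ge0 //; case: (jadj om u S) => /=; lra.
rewrite (@eq_expectation _ _ _ _ (fun om => 1 + (- (1 - x)) * (jadj om u S)%:R)); last by move=> om; ring.
rewrite expectationD expectation_cst expectationZ lerD2l mulNr lerN2 ler_wpM2l ?subr_ge0 //.
by apply: prob_jadj; rewrite ?(subsetP sP) ?(disjointFr dPS).
Qed.

Lemma prob_nbrs0 (S P : {set V}) : S \subset V0 -> P \subset V0 -> [disjoint P & S] ->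
  prob w (fun om => nbrs om S P == set0) <= (1 - join_rate #|S|) ^+ #|P|.
Proof.
move=> sS sP dPS; have := @expectation_nbrs 0 S P _ sS sP dPS.
rewrite lexx ler01 subr0 mul1r => /(_ isT); apply: le_trans; apply: le_expectation => // om.
by rewrite expr0n cards_eq0.
Qed.

Lemma prob_nbrs_few (m : nat) (S P : {set V}) : S \subset V0 -> P \subset V0 -> [disjoint P & S] ->
  prob w (fun om => (#|nbrs om S P| < m)%N) <= 2 ^+ m * (1 - join_rate #|S| / 2) ^+ #|P|.
Proof.
move=> sS sP dPS; have h : 0 <= (2^-1 : R) <= 1 by lra.
have := @expectation_nbrs 2^-1 S P h sS sP dPS.
have -> : (1 - 2^-1) * join_rate #|S| = join_rate #|S| / 2 by field.
rewrite -(ler_pM2l (exprn_gt0 m (ltr0Sn R 1))); apply: le_trans.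
rewrite -expectationZ; apply: le_expectation => // om.
have [lt_m | _] /= := ltnP; last by rewrite mulr_ge0 ?exprn_ge0 // invr_ge0.
by rewrite exprVn ler_pdivlMr ?exprn_gt0 // mul1r ler_weXn2l ?ler1n // ltnW.
Qed.

(** The frontier [S] is replaced by its new neighbours, not enlarged by them, so the coordinates
    between the next frontier and the remaining pool are unrevealed. Exhausting the [d] rounds
    counts as failure. *)
Fixpoint expand (Y : {set V}) (K d : nat) (S P : {set V}) (om : {set I}) : bool :=
  if (K <= #|S|)%N then [forall (y | y \in Y), jadj om y S]
  else if d is d'.+1 then expand Y K d' (nbrs om S P) (P :\: nbrs om S P) om else false.

Lemma expand_dep Y K d (S P : {set V}) :
  depends_on (between (S :|: P) (P :|: Y)) (expand Y K d S P).
Proof.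
elim: d S P => [|d IHd] S P om /=; case: ifP => // _.
1,2: by apply: eq_forallb => y; case: (boolP (y \in Y)) => //= yY;
  apply: (depends_onS _ (@jadj_dep y S)); rewrite between_sym;
  apply: betweenS; rewrite ?sub1set ?subsetUl // inE yY orbT.
have nD : nbrs (om :&: between (S :|: P) (P :|: Y)) S P = nbrs om S P.
  apply: (depends_onS _ (@nbrs_dep S P)); rewrite between_sym; apply: betweenS; exact: subsetUl.
rewrite nD; apply: (depends_onS _ (IHd _ _)); apply: betweenS.
  by rewrite subUset (subset_trans (nbrs_sub _ _ _)) ?subsetUr // (subset_trans (subsetDl _ _)) ?subsetUr.
by rewrite setSU // subsetDl.
Qed.

(** If [S] is too small to be tested against [Y] directly, every inspected coordinate has an
    endpoint in the pool [P], because all later frontiers lie in [P]. *)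
Lemma expand_depS Y K d (S P : {set V}) : (#|S| < K)%N ->
  depends_on (between P setT) (expand Y K d S P).
Proof.
case: d => [|d] SK om /=; rewrite leqNgt SK //=.
have nD : nbrs (om :&: between P setT) S P = nbrs om S P.
  apply: (depends_onS _ (@nbrs_dep S P)); apply: betweenS => //; exact: subsetT.
rewrite nD; apply: (depends_onS _ (@expand_dep _ _ _ _ _)); apply: betweenS (subsetT _).
by rewrite subUset nbrs_sub subsetDl.
Qed.

Definition closed_set (om : {set I}) (C : {set V}) :=
  forall u (S : {set V}), u \in V0 -> S \subset C -> jadj om u S -> u \in C.

Lemma expand_sound om K d (Y S P C : {set V}) : closed_set om C -> Y \subset V0 -> P \subset V0 ->
  S \subset C -> expand Y K d S P om -> Y \subset C.
Proof.
move=> clC sY; elim: d S P => [|d IHd] S P sP sS /=; case: ifP => // _.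
1,2: move=> /forall_inP adj; apply/subsetP => y yY; apply: (clC y S) => //; [exact: (subsetP sY) | exact: adj].
apply: IHd; first exact: subset_trans (subsetDl _ _) sP.
by apply/subsetP => u; rewrite inE => /andP[uP]; apply: clC => //; exact: (subsetP sP).
Qed.

(** [#|P| + 2 * #|S|] never drops: a new frontier [y] in [P] with [#|y| >= 2 * #|S|] changes it to
    [#|P| + #|y|]. So the pool stays large while frontiers are small, and [#|S| * 2 ^ d] ensures
    that size [K] is reached in time. *)
Lemma prob_expand_fail (Y : {set V}) (T K r0 : nat) (del z : R) d (S P : {set V}) :
  (forall t m, (T <= t < K)%N -> (r0 <= m + 2 * t)%N ->
     2 ^+ (2 * t) * (1 - join_rate t / 2) ^+ m <= del) ->
  (forall t, (K <= t)%N -> 1 - join_rate t <= z) -> 0 <= del -> (0 < T)%N ->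
  S \subset V0 -> P \subset V0 -> Y \subset V0 ->
  [disjoint S & P] -> [disjoint S & Y] -> [disjoint P & Y] ->
  (T <= #|S|)%N -> (r0 <= #|P| + 2 * #|S|)%N -> (K <= #|S| * 2 ^ d)%N ->
  prob w (fun om => ~~ expand Y K d S P om) <= d%:R * del + #|Y|%:R * z.
Proof.
move=> Hdel Hz del0 T0; move: d S P.
have terminal d (S : {set V}) : (K <= #|S|)%N -> S \subset V0 -> Y \subset V0 -> [disjoint S & Y] ->
    prob w (fun om => ~~ [forall (y | y \in Y), jadj om y S]) <= d%:R * del + #|Y|%:R * z.
  move=> KS sS sY dSY.
  apply: le_trans (_ : \sum_(y in Y) prob w (fun om => ~~ jadj om y S) <= _).
    apply: le_trans (prob_exists w01 _ _); apply: le_prob => // om.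
    by rewrite negb_forall => /existsP[y]; rewrite negb_imply => h; apply/existsP; exists y.
  apply: le_trans (_ : \sum_(y in Y) z <= _); last first.
    by rewrite sumr_const -[z *+ _]mulr_natl lerDr mulr_ge0.
  apply: ler_sum => y yY; rewrite probC; apply: le_trans (Hz _ KS); rewrite lerD2l lerN2.
  by apply: prob_jadj; rewrite ?(subsetP sY) ?(disjointFl dSY).
elim=> [|d IHd] S P sS sP sY dSP dSY dPY TS rP KS /=; have [KS' | KS'] := leqP K #|S|.
- exact: (terminal 0%N).
- by rewrite expn0 muln1 leqNgt KS' in KS.
- exact: (terminal d.+1).
pose Q (y : {set V}) := (y \subset P) && (2 * #|S| <= #|y|)%N.
apply: le_trans (_ : prob w (fun om => (#|nbrs om S P| < 2 * #|S|)%N) +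
    prob w (fun om => Q (nbrs om S P) && ~~ expand Y K d (nbrs om S P) (P :\: nbrs om S P) om) <= _).
  apply: le_trans (probU w01 _ _); apply: le_prob => // om fail.
  by rewrite /Q nbrs_sub fail andbT /=; case: ltnP.
rewrite -natr1 mulrDl mul1r addrAC [X in _ <= X]addrC lerD //.
  apply: le_trans (@prob_nbrs_few _ S P sS sP _) _; first by rewrite disjoint_sym.
  by apply: Hdel => //; rewrite TS.
have bnd0 : 0 <= d%:R * del + #|Y|%:R * z.
  have z0 : 0 <= z by apply: le_trans (Hz K (leqnn _)); have := join_rate01 K; lra.
  by rewrite addr_ge0 // mulr_ge0.
apply: le_trans (_ : (d%:R * del + #|Y|%:R * z) * prob w (fun om => Q (nbrs om S P)) <= _); last first.
  by rewrite ler_piMr // prob_le1.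
apply: (@prob_adaptive_le _ _ w w01 _ (fun om => nbrs om S P)
         (fun y om => ~~ expand Y K d y (P :\: y) om) (fun=> between P S)).
- by move=> y om; rewrite nbrs_dep.
- move=> y /andP[yP _] om; rewrite (depends_onS _ (@expand_dep _ _ _ _ _)) //.
  rewrite [between P S]between_sym; apply: between_disjoint.
    by apply: disjointWr dSP; rewrite subUset yP subsetDl.
  by rewrite -setI_eq0 setIUr setU_eq0 !setI_eq0 dSY (disjointWr (subsetDl _ _)).
- move=> y /andP[yP yS]; apply: IHd => //.
  + exact: subset_trans yP sP.
  + exact: subset_trans (subsetDl _ _) sP.
  + by rewrite disjoints_subset; apply/subsetP => u uy; rewrite !inE uy.
  + exact: disjointWl yP dPY.
  + exact: disjointWl (subsetDl _ _) dPY.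
  + by clear -TS yS T0; lia.
  + have := cardsID y P; rewrite (setIidPr yP); clear -rP yS; lia.
  + by apply: leq_trans KS _; rewrite expnS mulnA leq_mul2r [(#|S| * 2)%N]mulnC yS orbT.
Qed.

(** The internally spanned sets of bootstrap percolation: the closure of some vertex inside [S] is
    all of [S]. Only coordinates within [S] matter. *)
Definition spans (om : {set I}) (S : {set V}) :=
  [exists v0 in S, [forall C : {set V}, [&& C \subset S, v0 \in C &
     [forall (u | u \in S), jadj om u C ==> (u \in C)]] ==> (C == S)]].

Lemma spansP om (S : {set V}) :
  reflect (exists2 v0, v0 \in S & forall C : {set V}, C \subset S -> v0 \in C ->
             {in S, forall u, jadj om u C -> u \in C} -> C = S)
    (spans om S).
Proof.
apply: (iffP existsP) => [[v0 /andP[v0S /forallP sp]] | [v0 v0S sp]].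
  exists v0 => // C sC v0C clC; apply/eqP/(implyP (sp C)); rewrite sC v0C /=.
  by apply/forall_inP => u uS; apply/implyP; apply: clC.
exists v0; rewrite v0S /=; apply/forallP => C; apply/implyP => /and3P[sC v0C /forall_inP clC].
by apply/eqP; apply: sp => // u uS; apply: (implyP (clC u uS)).
Qed.

Lemma spans_dep (S : {set V}) : depends_on (between S S) (fun om => spans om S).
Proof.
move=> om; rewrite /spans; apply: eq_existsb => v0; congr (_ && _); apply: eq_forallb => C.
case: (boolP (C \subset S)) => //= sC; congr (_ && _ ==> _).
apply: eq_forallb => u; case: (boolP (u \in S)) => //= uS; congr (_ ==> _).
by apply: (depends_onS _ (@jadj_dep u C)); apply: betweenS; rewrite ?sub1set.
Qed.

Lemma spans1 om v : spans om [set v].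
Proof.
apply/spansP; exists v; rewrite ?inE // => C sC vC _.
by apply/eqP; rewrite eqEsubset sC sub1set.
Qed.

Lemma spansU1 om u S : spans om S -> jadj om u S -> spans om (u |: S).
Proof.
move=> /spansP[v0 v0S sp] adj; apply/spansP; exists v0 => [|C sC v0C clC].
  by rewrite inE v0S orbT.
have CS : C :&: S = S.
  apply: sp; rewrite ?subsetIr ?inE ?v0C // => u' u'S adj'; rewrite inE u'S andbT.
  by apply: clC; rewrite ?inE ?u'S ?orbT //; apply: jadjS adj'; exact: subsetIl.
have sSC : S \subset C by rewrite -CS subsetIl.
apply/eqP; rewrite eqEsubset sC subUset sSC sub1set andbT.
by apply: clC; rewrite ?inE ?eqxx //; apply: jadjS adj.
Qed.

Lemma spans_sound om (S : {set V}) : S \subset V0 -> spans om S ->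
  exists2 v0, v0 \in S & forall C, closed_set om C -> v0 \in C -> S \subset C.
Proof.
move=> sS /spansP[v0 v0S sp]; exists v0 => // C clC v0C.
rewrite -(sp (C :&: S)) ?subsetIl ?subsetIr ?inE ?v0C // => u uS adj.
by rewrite inE uS andbT; apply: clC adj; [exact: (subsetP sS) | exact: subsetIl].
Qed.

(** Each new vertex is sought in a fresh block, whose coordinates towards the current set are
    unrevealed. A block without a suitable vertex ends the attempt. *)
Fixpoint attempt (om : {set I}) (S : {set V}) (Ps : seq {set V}) : {set V} :=
  if Ps is P :: Ps' then
    if [pick u in P | jadj om u S] is Some u then attempt om (u |: S) Ps' else S
  else S.

Fixpoint blocks_ok (b : nat) (S : {set V}) (Ps : seq {set V}) : bool :=
  if Ps is P :: Ps' then
    [&& P \subset V0, (b <= #|P|)%N, [disjoint P & S] & blocks_ok b (S :|: P) Ps']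
  else true.

Definition blocks_union (Ps : seq {set V}) : {set V} := \bigcup_(P <- Ps) P.

Lemma blocks_okS b (S S' : {set V}) Ps : S' \subset S -> blocks_ok b S Ps -> blocks_ok b S' Ps.
Proof.
elim: Ps S S' => [|P Ps IH] S S' sS //= /and4P[-> -> dPS ok] /=.
by rewrite (disjointWr sS dPS) (IH _ _ _ ok) // setSU.
Qed.

Lemma blocks_ok_disjoint b (S : {set V}) Ps : blocks_ok b S Ps -> [disjoint S & blocks_union Ps].
Proof.
rewrite /blocks_union; elim: Ps S => [|P Ps IH] S /=.
  by rewrite big_nil -setI_eq0 setI0.
case/and4P => _ _ dPS ok; rewrite big_cons -setI_eq0 setIUr setU_eq0 !setI_eq0 disjoint_sym dPS /=.
exact: disjointWl (subsetUl _ _) (IH _ ok).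
Qed.

Lemma blocks_ok_exists b m (S A : {set V}) : A \subset V0 -> [disjoint A & S] -> (m * b <= #|A|)%N ->
  exists Ps, [/\ size Ps = m, blocks_ok b S Ps & blocks_union Ps \subset A].
Proof.
elim: m S A => [|m IHm] S A sA dAS cA.
  by exists [::]; rewrite /blocks_union big_nil sub0set.
have [P sP cP] : exists2 P : {set V}, P \subset A & #|P| = b.
  exists [set x in take b (enum A)].
    by apply/subsetP => x; rewrite inE => /mem_take; rewrite mem_enum.
  rewrite cardsE (card_uniqP _) ?take_uniq ?enum_uniq // size_take -cardE.
  by case: ltngtP cA => //; rewrite mulSn; clear; lia.
have [] := IHm (S :|: P) (A :\: P).
- exact: subset_trans (subsetDl _ _) sA.
- rewrite -setI_eq0 setIUr setU_eq0 !setI_eq0 (disjointWl (subsetDl _ _)) //=.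
  by rewrite disjoints_subset; apply/subsetP => u; rewrite !inE => /andP[].
- by rewrite cardsD (setIidPr sP) cP; move: cA; rewrite mulSn; clear; lia.
move=> Ps [sz ok sPs]; exists (P :: Ps); rewrite /= sz ok cP leqnn (subset_trans sP) //=.
rewrite (disjointWl sP) //; split => //; rewrite /blocks_union big_cons subUset sP.
exact: subset_trans sPs (subsetDl _ _).
Qed.

Lemma attempt_sub om (S : {set V}) Ps : S \subset attempt om S Ps.
Proof.
elim: Ps S => [|P Ps IH] S //=; case: pickP => // u _.
exact: subset_trans (subsetUr _ _) (IH _).
Qed.

Lemma attempt_sup om (S : {set V}) Ps : attempt om S Ps \subset S :|: blocks_union Ps.
Proof.
rewrite /blocks_union; elim: Ps S => [|P Ps IH] S /=; first exact: subsetUl.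
rewrite big_cons; case: pickP => [u /andP[uP _] | _]; last exact: subsetUl.
apply: subset_trans (IH _) _; rewrite !subUset sub1set !inE uP orbT /=.
by rewrite subsetUl /= setUA subsetUr.
Qed.

Lemma card_attempt om (S : {set V}) Ps : (#|attempt om S Ps| <= #|S| + size Ps)%N.
Proof.
elim: Ps S => [|P Ps IH] S /=; first by rewrite addn0.
case: pickP => [u _ | _]; last exact: leq_addr.
by apply: leq_trans (IH _) _; rewrite cardsU1 addnS -addSn leq_add2r -add1n leq_add2r; case: (_ \notin _).
Qed.

Lemma spans_attempt om S Ps : spans om S -> spans om (attempt om S Ps).
Proof.
elim: Ps S => [|P Ps IH] S //= sp; case: pickP => // u /andP[_ adj].
by apply: IH; apply: spansU1.
Qed.

Lemma attempt_dep S Ps : depends_on (between (blocks_union Ps) setT) (fun om => attempt om S Ps).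
Proof.
rewrite /blocks_union; elim: Ps S => [|P Ps IH] S om //=; rewrite big_cons.
set D := between _ _.
have sD : between (\bigcup_(Q <- Ps) Q) setT \subset D by apply: betweenS => //; exact: subsetUr.
have -> : [pick u in P | jadj (om :&: D) u S] = [pick u in P | jadj om u S].
  apply: eq_pick => u; case: (boolP (u \in P)) => //= uP.
  apply: (depends_onS _ (@jadj_dep u S)); apply: betweenS; last exact: subsetT.
  by rewrite sub1set inE uP.
case: pickP => // u _; exact: (depends_onS sD (IH (u |: S))).
Qed.

(** Every test on the way has one end in the current set, and this set is contained in the final
    value [S']. Hence a failed attempt spoils only the vertices of its result. *)
Lemma attempt_eq_dep S Ps S' : depends_on (between S' setT) (fun om => attempt om S Ps == S').
Proof.
elim: Ps S => [|P Ps IH] S om //=.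
have [sS | sS] := boolP (S \subset S'); last first.
  have neq om' : (attempt om' S (P :: Ps) == S') = false.
    by apply: contraNF sS => /eqP <-; exact: attempt_sub.
  by rewrite !(neq _ : (if _ is Some _ then _ else _) == _ = _).
have -> : [pick u in P | jadj (om :&: between S' setT) u S] = [pick u in P | jadj om u S].
  apply: eq_pick => u; congr (_ && _); apply: (depends_onS _ (@jadj_dep u S)).
  by rewrite between_sym; apply: betweenS => //; exact: subsetT.
case: pickP => // u _; exact: IH.
Qed.

Lemma prob_attempt b (S : {set V}) Ps : S \subset V0 -> blocks_ok b S Ps ->
  \prod_(t < size Ps) (1 - (1 - join_rate (#|S| + t)) ^+ b) <=
  prob w (fun om => (#|S| + size Ps <= #|attempt om S Ps|)%N).
Proof.
elim: Ps S => [|P Ps IH] S sS /=.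
  by move=> _; rewrite big_ord0 addn0 leqnn prob_cst.
case/and4P => sP bP dPS ok.
pose X om := [pick u in P | jadj om u S].
pose Q (y : option V) := if y is Some u then u \in P else false.
pose B (y : option V) om := if y is Some u then (#|S| + (size Ps).+1 <= #|attempt om (u |: S) Ps|)%N else false.
have dS := disjointWl (subsetUl _ _) (blocks_ok_disjoint ok).
have dP := disjointWl (subsetUr _ _) (blocks_ok_disjoint ok).
apply: le_trans (_ : prob w (fun om => Q (X om) && B (X om) om) <= _); last first.
  by apply: le_prob => // om; rewrite /Q /B /X; case: pickP => [u _ /andP[_] |].
rewrite big_ord_recl /= mulrC addn0.
set pr := \prod_(i < size Ps) _.
have pr0 : 0 <= pr.
  apply: prodr_ge0 => t _; have := join_rate01 (#|S| + bump 0 t) => /andP[j0 j1].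
  rewrite subr_ge0 exprn_ile1 // ?subr_ge0 // lerBlDr lerDl //.
have QX : 1 - (1 - join_rate #|S|) ^+ b <= prob w (fun om => Q (X om)).
  apply: le_trans (_ : 1 - prob w (fun om => nbrs om S P == set0) <= _).
    rewrite lerD2l lerN2; apply: le_trans (prob_nbrs0 sS sP dPS) _.
    have /andP[j0 j1] := join_rate01 #|S|.
    by apply: ler_wiXn2l; rewrite ?subr_ge0 // lerBlDr lerDl.
  rewrite -probC; apply: le_prob => // om /set0Pn[u]; rewrite inE => /andP[uP adj].
  rewrite /Q /X; case: pickP => [u' /andP[] // | /(_ u)]; by rewrite /= uP adj.
apply: le_trans (ler_wpM2l pr0 QX) _.
apply: (@prob_adaptive_ge _ _ w w01 _ X B (fun=> between P S)).
- move=> y om; rewrite /X; congr (_ == y); apply: eq_pick => u; case: (boolP (u \in P)) => //= uP.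
  by apply: (depends_onS _ (@jadj_dep u S)); apply: betweenS; rewrite ?sub1set.
- move=> [u|] // uP om; rewrite /B; congr (_ <= #|pred_of_set _|)%N.
  apply: (depends_onS _ (@attempt_dep _ _)); rewrite -disjoints_subset disjoint_sym disjoints_subset.
  by apply: between_disjoint; rewrite disjoint_sym.
- move=> [u|] // uP; rewrite /B.
  have uS : u \notin S by rewrite (disjointFr dPS uP).
  have cu : #|u |: S| = #|S|.+1 by rewrite cardsU1 uS.
  have suS : u |: S \subset V0 by rewrite subUset sS sub1set (subsetP sP).
  have su : u |: S \subset S :|: P by rewrite setUC setUS // sub1set.
  have := IH _ suS (blocks_okS su ok); rewrite cu addSnnS; apply: le_trans.
  rewrite le_eqVlt; apply/orP; left; apply/eqP; apply: eq_bigr => t _.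
  by rewrite addSnnS.
Qed.

(** * From repeated attempts to a complete exploration *)

Section Nucleus.
Variables (U : {set V}) (T b : nat) (rho : R).
Hypothesis sU : U \subset V0.
Hypothesis T_gt0 : (0 < T)%N.
Hypothesis rho0 : 0 <= rho.
Hypothesis rho_le : rho <= \prod_(t < T.-1) (1 - (1 - join_rate (1 + t)) ^+ b).

Definition no_nucleus (Z : {set V}) (om : {set I}) :=
  [forall S : {set V}, (S \subset U :\: Z) && (#|S| == T) ==> ~~ spans om S].

Lemma no_nucleus_dep Z : depends_on (between (U :\: Z) (U :\: Z)) (no_nucleus Z).
Proof.
move=> om; apply: eq_forallb => S; case: (boolP (S \subset _)) => //= sS; congr (_ ==> ~~ _).
by apply: (depends_onS _ (@spans_dep S)); apply: betweenS.
Qed.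

(** A failed attempt discards fewer than [T] vertices, since by [attempt_eq_dep] the coordinates
    away from its result are fresh. The room [1 + T.-1 * b] is one starting vertex and [T.-1] blocks
    of size [b]. *)
Lemma prob_no_nucleus m (Z : {set V}) : (m * T + (1 + T.-1 * b) <= #|U :\: Z|)%N ->
  prob w (no_nucleus Z) <= (1 - rho) ^+ m.
Proof.
elim: m Z => [|m IHm] Z cZ; first by rewrite expr0 prob_le1.
have /card_gt0P[v vU] : (0 < #|U :\: Z|)%N by apply: leq_trans cZ; clear; lia.
pose A := (U :\: Z) :\ v.
have cA : (T.-1 * b <= #|A|)%N by move: cZ; rewrite (cardsD1 v (U :\: Z)) vU -/A; clear; lia.
have sA : A \subset V0 by apply: subset_trans sU; apply: subset_trans (subD1set _ _) (subsetDl _ _).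
have dA : [disjoint A & [set v]] by rewrite disjoint_sym disjoints1 !inE eqxx.
have [Ps [sz ok sPs]] := blocks_ok_exists sA dA cA.
have vV : [set v] \subset V0.
  by rewrite sub1set; apply: (subsetP sU); move: vU; rewrite inE => /andP[].
pose X om := attempt om [set v] Ps.
have sX om : X om \subset U :\: Z.
  apply: subset_trans (attempt_sup _ _ _) _; rewrite subUset sub1set vU.
  exact: subset_trans sPs (subD1set _ _).
have cX om : (#|X om| <= T)%N.
  by apply: leq_trans (card_attempt _ _ _) _; rewrite cards1 sz add1n prednK.
pose Q (y : {set V}) := (#|y| < T)%N.
apply: le_trans (_ : prob w (fun om => Q (X om) && no_nucleus (Z :|: X om) om) <= _).
  apply: le_prob => // om /forallP none; apply/andP; split.
    rewrite /Q ltn_neqAle cX andbT; apply/negP => cXT.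
    by have := none (X om); rewrite sX cXT /= spans_attempt ?spans1.
  apply/forallP => S; apply/implyP => /andP[sS cS]; have := none S; rewrite cS andbT => /implyP; apply.
  by apply: subset_trans sS _; apply: setDS; exact: subsetUl.
apply: le_trans (_ : (1 - rho) ^+ m * prob w (fun om => Q (X om)) <= _); last first.
  have r1 : rho <= 1.
    apply: le_trans rho_le _; apply: le_trans (_ : \prod_(t < T.-1) (1 : R) <= _); last by rewrite big1.
    apply: ler_prod => t _; have := join_rate01 (1 + t) => /andP[j0 j1].
    have h0 : 0 <= (1 - join_rate (1 + t)) ^+ b by rewrite exprn_ge0 // subr_ge0.
    have h1 : (1 - join_rate (1 + t)) ^+ b <= 1 by rewrite exprn_ile1 ?subr_ge0 // lerBlDr lerDl.
    by rewrite subr_ge0 h1 lerBlDr lerDl h0.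
  rewrite exprSr ler_wpM2l ?exprn_ge0 ?subr_ge0 //.
  have := prob_attempt vV ok; rewrite cards1 sz => hsucc.
  have -> : prob w (fun om => Q (X om)) = 1 - prob w (fun om => (1 + T.-1 <= #|X om|)%N).
    by rewrite -probC; apply: eq_prob => om; rewrite add1n prednK // -ltnNge.
  by rewrite lerD2l lerN2; apply: le_trans hsucc.
apply: (@prob_adaptive_le _ _ w w01 _ X (fun y => no_nucleus (Z :|: y)) (fun y => between y setT)).
- by move=> y; exact: attempt_eq_dep.
- move=> y _; apply: depends_onS (@no_nucleus_dep _).
  by apply: between_disjoint; rewrite disjoints_subset; apply/subsetP => u uy; rewrite !inE uy orbT.
- move=> y Qy; apply: IHm; rewrite -setDDl.
  have := cardsID y (U :\: Z); have := subset_leq_card (subsetIr (U :\: Z) y).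
  by move: cZ Qy; rewrite /Q mulSn; clear; lia.
Qed.

Variables (W : {set V}) (K d r0 m : nat) (del z : R).
Hypothesis sW : W \subset V0.
Hypothesis dUW : [disjoint U & W].
Hypothesis T_lt_K : (T < K)%N.
Hypothesis del0 : 0 <= del.
Hypothesis Hdel : forall t m, (T <= t < K)%N -> (r0 <= m + 2 * t)%N ->
     2 ^+ (2 * t) * (1 - join_rate t / 2) ^+ m <= del.
Hypothesis Hz : forall t, (K <= t)%N -> 1 - join_rate t <= z.
Hypothesis cW : (r0 <= #|W|)%N.
Hypothesis K_d : (K <= T * 2 ^ d)%N.
Hypothesis cU : (m * T + (1 + T.-1 * b) <= #|U|)%N.

(** The nucleus is sought inside [U] and doubled inside [W]; the last stage returns to absorb the
    rest of [U]. *)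
Definition explored (om : {set I}) : bool :=
  if [pick S : {set V} | [&& S \subset U, #|S| == T & spans om S]] is Some A
  then expand (U :\: A) K d A W om else false.

Lemma explored_sound om : explored om ->
  exists2 v0, v0 \in U & forall C, closed_set om C -> v0 \in C -> U \subset C.
Proof.
rewrite /explored; case: pickP => // S /and3P[sS /eqP cS sp] ex.
have [v0 v0S sound] := spans_sound (subset_trans sS sU) sp.
exists v0; first exact: (subsetP sS).
move=> C clC v0C; have sSC := sound C clC v0C.
have sUS : U :\: S \subset V0 by exact: subset_trans (subsetDl _ _) sU.
have := expand_sound clC sUS sW sSC ex.
by move=> sUC; rewrite -(setID U S) subUset sUC andbT (subset_trans (subsetIr _ _)).
Qed.

(** [T < K] prevents the nucleus from being tested against [U] itself, so the expansion uses only
    coordinates touching [W] and is independent of the choice made inside [U]. *)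
Lemma prob_not_explored :
  prob w (fun om => ~~ explored om) <= (1 - rho) ^+ m + (d%:R * del + #|U|%:R * z).
Proof.
pose X om := [pick S : {set V} | [&& S \subset U, #|S| == T & spans om S]].
pose Q (y : option {set V}) := if y is Some A then (A \subset U) && (#|A| == T) else false.
pose B (y : option {set V}) om := if y is Some A then ~~ expand (U :\: A) K d A W om else false.
have z0 : 0 <= z by apply: le_trans (Hz (leqnn _)); have := join_rate01 K; lra.
apply: le_trans (_ : prob w (no_nucleus set0) + prob w (fun om => Q (X om) && B (X om) om) <= _).
  apply: le_trans (probU w01 _ _); apply: le_prob => // om.
  rewrite /explored /Q /B /X; case: pickP => [S /and3P[-> -> _] -> | none _]; first by rewrite orbT.
  rewrite orbF; apply/forallP => S; apply/implyP => /andP[]; rewrite setD0 => sS cS.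
  by have := none S; rewrite sS cS /= => ->.
apply: lerD; first by apply: prob_no_nucleus; rewrite setD0.
apply: le_trans (_ : (d%:R * del + #|U|%:R * z) * prob w (fun om => Q (X om)) <= _); last first.
  by rewrite ler_piMr ?prob_le1 // addr_ge0 // mulr_ge0.
apply: (@prob_adaptive_le _ _ w w01 _ X B (fun=> between U U)).
- move=> y om; rewrite /X; congr (_ == y); apply: eq_pick => S; case: (boolP (S \subset U)) => //= sS.
  by congr (_ && _); apply: (depends_onS _ (@spans_dep S)); apply: betweenS.
- move=> [S|] // /andP[sS /eqP cS] om; rewrite /B; congr (~~ _).
  have SK : (#|S| < K)%N by rewrite cS.
  apply: (depends_onS _ (@expand_depS _ _ _ _ _ SK)).
  rewrite -disjoints_subset disjoint_sym disjoints_subset.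
  by apply: between_disjoint; rewrite disjoint_sym.
- move=> [S|] // /andP[sS /eqP cS]; rewrite /B.
  apply: le_trans (_ : d%:R * del + #|U :\: S|%:R * z <= _); last first.
    by rewrite lerD2l ler_wpM2r // ler_nat subset_leq_card // subsetDl.
  apply: (prob_expand_fail (T := T) (r0 := r0)) => //.
  + exact: subset_trans sS sU.
  + exact: subset_trans (subsetDl _ _) sU.
  + exact: disjointWl sS dUW.
  + by rewrite disjoints_subset; apply/subsetP => u uS; rewrite !inE uS.
  + by rewrite disjoint_sym; apply: disjointWl (subsetDl _ _) dUW.
  + by rewrite cS.
  + exact: leq_trans cW (leq_addr _ _).
  + by rewrite cS.
Qed.

End Nucleus.

End Joint.

(** * Growth rates in the supercritical regime *)

Lemma exp_oneB_le (R : realType) (q : R) (m : nat) : q <= 1 -> (1 - q) ^+ m <= expR (- (q * m%:R)).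
Proof.
move=> q1; rewrite -mulNr expRM_natr lerXn2r ?nnegrE ?expR_ge0 ?subr_ge0 //.
exact: expR_ge1Dx.
Qed.

(** For [u = Num.min 1 x], the power is at most [expR (- u) <= 1 / (1 + u)], and
    [u / (1 + u) >= u / 2] because [u <= 1]. *)
Lemma min_half_le (R : realType) (q x : R) (m : nat) : 0 <= q <= 1 -> 0 <= x -> x <= q * m%:R ->
  Num.min 1 x / 2 <= 1 - (1 - q) ^+ m.
Proof.
move=> /andP[q0 q1] x0 xm; set u := Num.min 1 x.
have u0 : 0 <= u by rewrite le_min ler01.
have u1 : u <= 1 by rewrite ge_min lexx.
have um : u <= q * m%:R by apply: le_trans xm; rewrite ge_min lexx orbT.
suff : (1 - q) ^+ m <= (1 + u)^-1.
  move=> h; have : u / 2 <= 1 - (1 + u)^-1.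
    have -> : 1 - (1 + u)^-1 = u / (1 + u) by field; lra.
    by rewrite ler_wpM2l // lef_pV2 ?posrE; lra.
  by lra.
apply: le_trans (exp_oneB_le m q1) _; rewrite expRN lef_pV2 ?posrE ?expR_gt0 //; last lra.
by apply: le_trans (expR_ge1Dx u) _; rewrite ler_expR.
Qed.

Lemma prod_oneB_ge (R : realFieldType) (I : Type) (r : seq I) (q : I -> R) :
  (forall i, 0 <= q i <= 1) -> 1 - \sum_(i <- r) q i <= \prod_(i <- r) (1 - q i).
Proof.
move=> q01.
elim: r => [|i r IHr]; first by rewrite !big_nil subr0.
rewrite !big_cons; have /andP[q0 q1] := q01 i.
apply: le_trans (ler_wpM2l _ IHr); last by rewrite subr_ge0.
have : 0 <= q i * \sum_(i <- r) q i.
  by rewrite mulr_ge0 // sumr_ge0 // => i' _; have /andP[] := q01 i'.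
lra.
Qed.

Lemma rate_identity (F : fieldType) (t b N c l : F) (kap r : nat) : N != 0 -> l != 0 ->
  (t * (b * N ^+ kap)) ^+ r.+1 * (c / (N ^+ (r.+1 * kap + 1) * l ^+ r)) =
  c * b * (t / N) * (b * t / l) ^+ r.
Proof.
move=> N0 l0; rewrite addn1 [N ^+ (_ * _).+1]exprS [(r.+1 * kap)%N]mulnC exprM; set Z := N ^+ kap.
have Z0 : Z != 0 by exact: expf_neq0.
rewrite !exprS !exprMn exprVn; have := expf_neq0 r Z0; have := expf_neq0 r l0.
move: (Z ^+ r) (l ^+ r) (t ^+ r) (b ^+ r) => z y x w y0 z0; field.
by rewrite N0 Z0 y0 z0.
Qed.

Section Rates.
Variables (R : realType) (s kap n M : nat) (p : 'I_s -> R) (c beta l : R).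
Hypothesis p01 : forall i, 0 <= p i <= 1.
Hypothesis p_mono : forall i i' : 'I_s, (i <= i')%N -> p i <= p i'.
Hypothesis n_gt0 : (0 < n)%N.
Hypothesis l1 : 1 <= l.
Hypothesis c0 : 0 < c.
Hypothesis beta0 : 0 < beta.
Hypothesis beta1 : beta <= 1.
Hypothesis p_min : forall i, c * l / n%:R ^+ kap.+1 <= p i.
Hypothesis p_prod : forall r, (2 <= r <= s)%N ->
  c / (n%:R ^+ (r * kap + 1) * l ^+ (r - 1)) <= \prod_(i < s | (i < r)%N) p i.
Hypothesis M_ge : beta * n%:R ^+ kap <= M%:R.

Let n0 : 0 < n%:R :> R. Proof. by rewrite ltr0n. Qed.
Let l0 : 0 < l. Proof. by apply: lt_le_trans l1. Qed.

(** By monotonicity the colours with [y i] below 1 are the first [r] for some [r], and the others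
    contribute constants. The threshold condition for exactly this [r] bounds the product, the bound
    on p_1 serving for [r = 1]; this is why conditions for all [r] enter. *)
Lemma join_rate_ge (t : nat) : (0 < s)%N ->
  2^-1 ^+ s * Num.min 1 (c * beta * (t%:R / n%:R) * Num.min 1 (beta * t%:R / l) ^+ s.-1)
  <= join_rate p M t.
Proof.
move=> s0; pose y i := t%:R * (beta * n%:R ^+ kap) * p i.
have Y0 : 0 <= t%:R * (beta * n%:R ^+ kap) by rewrite mulr_ge0 // mulr_ge0 ?exprn_ge0 // ltW.
have y0 i : 0 <= y i by rewrite mulr_ge0 //; have /andP[] := p01 i.
have y_mono (i i' : 'I_s) : (i <= i')%N -> y i <= y i' by move=> ii'; rewrite ler_wpM2l ?p_mono.
apply: le_trans (_ : \prod_i (2^-1 * Num.min 1 (y i)) <= _); last first.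
  apply: ler_prod => i _; apply/andP; split; first by rewrite mulr_ge0 ?invr_ge0 // le_min ler01 y0.
  rewrite mulrC; apply: min_half_le => //.
  have -> : y i = p i * (beta * n%:R ^+ kap * t%:R) by rewrite /y; ring.
  by rewrite natrM; apply: ler_wpM2l; [have /andP[] := p01 i | apply: ler_wpM2r].
rewrite big_split /= prodr_const card_ord ler_wpM2l ?exprn_ge0 ?invr_ge0 //.
pose P r := [forall i : 'I_s, (r <= i)%N ==> (1 <= y i)].
have exP : exists r, P r.
  by exists s; apply/forallP => i; apply/implyP; rewrite leqNgt ltn_ord.
case: (ex_minnP exP) => r /forallP Pr r_min.
have rs : (r <= s)%N by apply: r_min; apply/forallP => i; apply/implyP; rewrite leqNgt ltn_ord.
have small (i : 'I_s) : (i < r)%N -> y i <= 1.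
  move=> ir; rewrite leNgt; apply/negP => yi.
  have : (r <= i)%N; last by rewrite leqNgt ir.
  apply: r_min; apply/forallP => i'; apply/implyP => ii'.
  by apply: le_trans (ltW yi) (y_mono _ _ ii').
have -> : \prod_i Num.min 1 (y i) = \prod_(i < s | (i < r)%N) y i.
  rewrite [RHS]big_mkcond; apply: eq_bigr => i _; case: ifPn => ir; first by apply/min_idPr/small.
  by apply/min_idPl; have := Pr i; rewrite leqNgt ir.
rewrite big_split /= prodr_const card_ord_lt //.
set g := Num.min 1 (beta * t%:R / l).
have bt0 : 0 <= beta * t%:R / l by rewrite divr_ge0 ?mulr_ge0 // ltW.
have g0 : 0 <= g by rewrite le_min ler01 bt0.
have g1 : g <= 1 by rewrite ge_min lexx.
have A0 : 0 <= c * beta * (t%:R / n%:R).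
  by apply: mulr_ge0; [apply: mulr_ge0; exact: ltW | rewrite divr_ge0 // ltW].
have [-> | r0] := posnP r.
  by rewrite expr0 big_pred0 ?mulr1 // ge_min lexx.
rewrite ge_min; apply/orP; right.
have [r1 | r2] := leqP r 1%N.
  have {r1 r0} -> : r = 1%N by apply/eqP; rewrite eqn_leq r1.
  rewrite expr1 (bigD1 (Ordinal s0)) //= big1 ?mulr1; last first.
    by move=> i /andP[i1 i0]; case/negP: i0; apply/eqP/val_inj => /=; case: (val i) i1.
  apply: le_trans (_ : c * beta * (t%:R / n%:R) <= _).
    by rewrite ler_piMr // exprn_ile1.
  apply: le_trans (ler_wpM2l Y0 (p_min _)).
  have -> : t%:R * (beta * n%:R ^+ kap) * (c * l / n%:R ^+ kap.+1) =
    c * beta * (t%:R / n%:R) * l.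
    by rewrite exprS; field; rewrite expf_neq0 ?gt_eqF.
  by rewrite ler_peMr.
have r2s : (2 <= r <= s)%N by rewrite r2.
apply: le_trans (ler_wpM2l (exprn_ge0 _ Y0) (p_prod r2s)).
have -> : (t%:R * (beta * n%:R ^+ kap)) ^+ r * (c / (n%:R ^+ (r * kap + 1) * l ^+ (r - 1))) =
    c * beta * (t%:R / n%:R) * (beta * t%:R / l) ^+ r.-1.
  by rewrite subn1; case: (r) r0 => // r' _; apply: rate_identity; rewrite gt_eqF.
apply: ler_wpM2l => //.
apply: le_trans (_ : g ^+ r.-1 <= _).
  apply: ler_wiXn2l => //; clear -rs; lia.
by rewrite lerXn2r ?nnegrE // ge_min lexx orbT.
Qed.

Lemma join_rate_large (t : nat) (q : R) : 0 <= q -> q * n%:R <= t%:R ->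
  1 - join_rate p M t <= s%:R * expR (- (c * beta * q * l)).
Proof.
move=> q0 qt.
have b01 i : 0 <= (1 - p i) ^+ (M * t) <= 1.
  by have /andP[p0 p1] := p01 i; rewrite exprn_ge0 ?exprn_ile1 ?subr_ge0 // lerBlDr lerDl.
have := prod_oneB_ge (index_enum 'I_s) b01; rewrite -/(join_rate p M t) => h.
apply: le_trans (_ : \sum_i (1 - p i) ^+ (M * t) <= _); first by lra.
apply: le_trans (_ : \sum_(i < s) expR (- (c * beta * q * l)) <= _); last first.
  by rewrite sumr_const card_ord mulr_natl.
apply: ler_sum => i _; have /andP[p0 p1] := p01 i.
apply: le_trans (exp_oneB_le _ p1) _; rewrite ler_expR lerN2 natrM.
have -> : c * beta * q * l = c * l / n%:R ^+ kap.+1 * (beta * n%:R ^+ kap * (q * n%:R)).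
  by rewrite exprS; field; rewrite expf_neq0 ?gt_eqF.
have bn0 : 0 <= beta * n%:R ^+ kap by rewrite mulr_ge0 ?exprn_ge0 // ltW.
have qn0 : 0 <= q * n%:R by rewrite mulr_ge0 // ltW.
apply: ler_pM => //; first by rewrite divr_ge0 ?exprn_ge0 ?mulr_ge0 // ltW.
  exact: mulr_ge0.
exact: ler_pM.
Qed.

End Rates.

Lemma two_le_expR1 (R : realType) : 2 <= expR 1 :> R.
Proof. by have := expR_ge1Dx (1 : R); lra. Qed.

(** The product equals [(T! / T^T)^s / 2^(T-1)], and [T! / T^T] is at least e^(-T). So a nucleus of
    logarithmic size costs only a power of n. *)
Lemma prod_ratio_ge (R : realType) (s T : nat) : (0 < T)%N ->
  expR (- (s.+1%:R * T%:R)) <= \prod_(t < T.-1) (((1 + t)%:R / T%:R) ^+ s / 2) :> R.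
Proof.
move=> T_gt0.
have T0 : 0 < T%:R :> R by rewrite ltr0n.
have -> : \prod_(t < T.-1) (((1 + t)%:R / T%:R) ^+ s / 2) =
    (T`!%:R / T%:R ^+ T) ^+ s * 2^-1 ^+ T.-1 :> R.
  rewrite big_split /= prodr_const card_ord; congr (_ * _).
  rewrite prodrXl; congr (_ ^+ s).
  rewrite big_split /= prodr_const card_ord -natr_prod.
  have -> : (\prod_(t < T.-1) (1 + t))%N = (T.-1)`!.
    by rewrite fact_prod big_add1 big_mkord; apply: eq_bigr => t _; rewrite add1n.
  have -> : T`! = (T * (T.-1)`!)%N by rewrite -{1}(prednK T_gt0) factS prednK.
  rewrite -[in RHS](prednK T_gt0) exprS natrM prednK // exprVn invfM mulrACA mulfV ?gt_eqF // mul1r.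
  by [].
have -> : expR (- (s.+1%:R * T%:R)) = (expR (- T%:R)) ^+ s * expR (- T%:R) :> R.
  by rewrite -exprSr -expRM_natl mulrN.
have eT : (expR (- T%:R) : R) = (expR 1 ^+ T)^-1 by rewrite expRN -expRM_natl mulr1.
apply: ler_pM; rewrite ?exprn_ge0 ?expR_ge0 //.
  rewrite lerXn2r ?nnegrE ?expR_ge0 ?divr_ge0 ?exprn_ge0 //.
  rewrite eT ler_pdivlMr ?exprn_gt0 // mulrC ler_pdivrMr ?exprn_gt0 ?expR_gt0 // mulrC.
  exact: exp_ge_self_fact.
rewrite eT exprVn lef_pV2 ?posrE ?exprn_gt0 ?expR_gt0 //.
apply: le_trans (_ : expR 1 ^+ T.-1 <= _).
  by rewrite lerXn2r ?nnegrE ?expR_ge0 // two_le_expR1.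
apply: ler_weXn2l; last exact: leq_pred.
by apply: le_trans (two_le_expR1 R); lra.
Qed.

Section ExplorationRates.
Variables (R : realType) (s kap n M : nat) (p : 'I_s -> R) (c beta l : R).
Hypothesis s_gt0 : (0 < s)%N.
Hypothesis p01 : forall i, 0 <= p i <= 1.
Hypothesis p_mono : forall i i' : 'I_s, (i <= i')%N -> p i <= p i'.
Hypothesis n_gt0 : (0 < n)%N.
Hypothesis l1 : 1 <= l.
Hypothesis c0 : 0 < c.
Hypothesis beta0 : 0 < beta.
Hypothesis beta1 : beta <= 1.
Hypothesis p_min : forall i, c * l / n%:R ^+ kap.+1 <= p i.
Hypothesis p_prod : forall r, (2 <= r <= s)%N ->
  c / (n%:R ^+ (r * kap + 1) * l ^+ (r - 1)) <= \prod_(i < s | (i < r)%N) p i.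
Hypothesis M_ge : beta * n%:R ^+ kap <= M%:R.

Let n0 : 0 < n%:R :> R. Proof. by rewrite ltr0n. Qed.
Let l0 : 0 < l. Proof. by apply: lt_le_trans l1. Qed.
Let rate t := join_rate_ge p01 p_mono n_gt0 l1 c0 beta0 p_min p_prod M_ge t s_gt0.

(** For [u <= T <= l] the bound on [join_rate] is a constant or of order c (u/n)(u/l)^(s-1).
    Multiplied by the block size, at least n/(64 l), it exceeds [(u / T) ^ s] once [c] is large; the
    factor 1/2 is that of [min_half_le]. *)
Lemma nucleus_rate (T b : nat) (A : R) : (0 < T)%N -> T%:R <= l -> 0 < A -> l <= A * T%:R ->
  n%:R <= 64 * l * b%:R -> 2 ^+ s <= b%:R :> R -> 64 * 2 ^+ s * A ^+ s <= c * beta ^+ s ->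
  expR (- (s.+1%:R * T%:R)) <= \prod_(t < T.-1) (1 - (1 - join_rate p M (1 + t)) ^+ b).
Proof.
move=> T_gt0 Tl A0 lA nb sb cA.
have T0 : 0 < T%:R :> R by rewrite ltr0n.
apply: le_trans (prod_ratio_ge R s T_gt0) _.
apply: ler_prod => t _; set u := (1 + t)%N.
have uT : (u <= T)%N by rewrite /u; have := ltn_ord t; clear -T_gt0; lia.
have u0 : 0 < u%:R :> R by rewrite ltr0n.
have uTR : u%:R <= T%:R :> R by rewrite ler_nat.
set x := (u%:R / T%:R) ^+ s.
have x0 : 0 <= x by rewrite exprn_ge0 // divr_ge0.
have x1 : x <= 1 by rewrite exprn_ile1 ?divr_ge0 // ler_pdivrMr // mul1r.
rewrite divr_ge0 //=.
have -> : x = Num.min 1 x by apply/esym/min_idPr.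
apply: min_half_le => //; first exact: join_rate01.
apply: le_trans (ler_wpM2r (ler0n _ _) (rate u)).
set g := Num.min 1 (beta * u%:R / l).
have -> : g = beta * u%:R / l.
  apply/min_idPr; rewrite ler_pdivrMr // mul1r; apply: le_trans (_ : u%:R <= _).
    by rewrite ler_piMl // ltW.
  exact: le_trans Tl.
set m := Num.min 1 (c * _ * _ * _).
have -> : 2^-1 ^+ s * m * b%:R = b%:R * m / 2 ^+ s by rewrite exprVn; ring.
rewrite ler_pdivlMr ?exprn_gt0 // [x * _]mulrC.
have : m = 1 \/ m = c * beta * (u%:R / n%:R) * (beta * u%:R / l) ^+ s.-1.
  by rewrite /m; case: leP; [left | right].
case=> ->.
  by rewrite mulr1; apply: le_trans sb; rewrite ler_piMr // exprn_ge0.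
have -> : b%:R * (c * beta * (u%:R / n%:R) * (beta * u%:R / l) ^+ s.-1) =
    c * beta ^+ s * (l * b%:R / n%:R) * (u%:R / l) ^+ s.
  rewrite -(prednK s_gt0) /= !exprS !exprMn exprVn.
  have ls0 : l ^+ s.-1 != 0 by rewrite expf_neq0 ?gt_eqF.
  by field; rewrite ls0 !gt_eqF.
have h1 : 64^-1 <= l * b%:R / n%:R.
  by rewrite ler_pdivlMr //; lra.
apply: le_trans (_ : 64 * 2 ^+ s * A ^+ s * 64^-1 * (u%:R / l) ^+ s <= _); last first.
  rewrite ler_wpM2r ?exprn_ge0 ?divr_ge0 ?(ltW l0) //.
  have cb0 : 0 <= c * beta ^+ s by rewrite mulr_ge0 ?exprn_ge0 ?(ltW c0) ?(ltW beta0).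
  by apply: ler_pM => //; rewrite ?invr_ge0 // mulr_ge0 ?mulr_ge0 ?exprn_ge0 ?(ltW A0).
have -> : 64 * 2 ^+ s * A ^+ s * 64^-1 * (u%:R / l) ^+ s = 2 ^+ s * (A * (u%:R / l)) ^+ s :> R.
  by rewrite [(A * _) ^+ s]exprMn; field.
rewrite ler_wpM2l ?exprn_ge0 //.
apply: lerXn2r; rewrite ?nnegrE ?divr_ge0 //.
  by rewrite mulr_ge0 ?divr_ge0 ?(ltW A0) ?(ltW l0).
have -> : A * (u%:R / l) = u%:R * (A / l) by ring.
rewrite ler_pM2l // -[_^-1]mul1r ler_pdivrMr // mulrAC ler_pdivlMr // mul1r.
exact: lA.
Qed.

(** It suffices that [n * join_rate] is at least [32 * (B + 2) * t]: the 2 pays for [2 ^+ (2 * t)],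
    the 32 for the halved rate and for [m >= n / 16]. If the minimum in the rate is 1, this needs
    [t] below a small multiple of n, otherwise a large [c]. *)
Lemma expansion_rate (t m : nat) (g B : R) : 0 < g -> g <= 1 -> 0 <= B -> g <= beta * t%:R / l ->
  n%:R <= 16 * m%:R :> R -> 32 * 2 ^+ s * (B + 2) * t%:R <= n%:R ->
  32 * 2 ^+ s * (B + 2) <= c * beta * g ^+ s.-1 ->
  2 ^+ (2 * t) * (1 - join_rate p M t / 2) ^+ m <= expR (- (B * t%:R)).
Proof.
move=> g0 g1 B0 gt nm Bn Bc.
have /andP[j0 j1] := join_rate01 M p01 t.
have h2 : 2 ^+ (2 * t) <= expR (2 * t%:R) :> R.
  rewrite -natrM -[X in expR X]mulr1 expRM_natl lerXn2r ?nnegrE ?expR_ge0 //.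
  exact: two_le_expR1.
have h3 : (1 - join_rate p M t / 2) ^+ m <= expR (- (join_rate p M t / 2 * m%:R)).
  by apply: exp_oneB_le; lra.
apply: le_trans (_ : expR (2 * t%:R) * expR (- (join_rate p M t / 2 * m%:R)) <= _).
  by apply: ler_pM => //; rewrite exprn_ge0 //; lra.
rewrite -expRD ler_expR.
suff : (B + 2) * t%:R <= join_rate p M t / 2 * m%:R by lra.
have t0 : 0 <= t%:R :> R by [].
apply: le_trans (_ : join_rate p M t / 2 * (n%:R / 16) <= _); last first.
  by apply: ler_wpM2l; lra.
suff : 32 * (B + 2) * t%:R <= join_rate p M t * n%:R by lra.
apply: le_trans (ler_wpM2r (ltW n0) (rate t)).
set mm := Num.min 1 (c * _ * _ * _).
have -> : 2^-1 ^+ s * mm * n%:R = n%:R * mm / 2 ^+ s by rewrite exprVn; ring.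
rewrite ler_pdivlMr ?exprn_gt0 //.
have ge1 : g ^+ s.-1 <= Num.min 1 (beta * t%:R / l) ^+ s.-1.
  rewrite lerXn2r ?nnegrE ?(ltW g0) //; last by rewrite le_min g1 gt.
  by rewrite le_min ler01 (le_trans (ltW g0)).
have : mm = 1 \/ mm = c * beta * (t%:R / n%:R) * Num.min 1 (beta * t%:R / l) ^+ s.-1.
  by rewrite /mm; case: leP; [left | right].
case=> ->; first by rewrite mulr1; apply: le_trans Bn; rewrite le_eqVlt; apply/orP; left; apply/eqP; ring.
have -> : n%:R * (c * beta * (t%:R / n%:R) * Num.min 1 (beta * t%:R / l) ^+ s.-1) =
    c * beta * Num.min 1 (beta * t%:R / l) ^+ s.-1 * t%:R by field; rewrite gt_eqF.
have -> : 32 * (B + 2) * t%:R * 2 ^+ s = 32 * 2 ^+ s * (B + 2) * t%:R by ring.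
rewrite ler_wpM2r //; apply: le_trans Bc _; rewrite ler_wpM2l // mulr_ge0 ?(ltW c0) ?(ltW beta0) //.
Qed.

End ExplorationRates.

Lemma truncn_half (R : realType) (x : R) : 2 <= x ->
  x / 2 <= (Num.trunc x)%:R /\ (Num.trunc x)%:R <= x.
Proof.
move=> x2; have x0 : 0 <= x by lra.
have := truncnS_gt x; rewrite -natr1.
have : (Num.trunc x)%:R <= x by rewrite truncn_le.
by lra.
Qed.

Lemma half_split (R : realFieldType) (x y : R) : 1 <= x -> y / 2 = x * (2 * y / (4 * x)).
Proof. by move=> x1; field; rewrite gt_eqF //; lra. Qed.

(** With [rho] equal to n^(-1/2) and order n/log n attempts, all attempts fail with probability
    exponentially small in sqrt(n)/log n. Doubling and absorption fail with probability of order
    n^-(j+2) per round or per vertex. *)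
Lemma exploration_parameters (R : realType) (s kap j : nat) (beta : R) :
  (0 < s)%N -> 0 < beta -> beta <= 1 ->
  exists2 c0, 0 < c0 & forall c, c0 <= c -> exists N : nat, forall n, (N <= n)%N ->
  forall (p : 'I_s -> R) M,
    (forall i, 0 <= p i <= 1) -> (forall i i' : 'I_s, (i <= i')%N -> p i <= p i') ->
    (forall i, c * ln n%:R / n%:R ^+ kap.+1 <= p i) ->
    (forall r, (2 <= r <= s)%N ->
      c / (n%:R ^+ (r * kap + 1) * ln n%:R ^+ (r - 1)) <= \prod_(i < s | (i < r)%N) p i) ->
    beta * n%:R ^+ kap <= M%:R ->
  exists T b K m (rho del z : R),
   [/\ [/\ (0 < T)%N, rho <= \prod_(t < T.-1) (1 - (1 - join_rate p M (1 + t)) ^+ b),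
           (T < K)%N, 0 <= del & 0 <= z],
       forall t m, (T <= t < K)%N -> (n %/ 8 <= m + 2 * t)%N ->
         2 ^+ (2 * t) * (1 - join_rate p M t / 2) ^+ m <= del,
       forall t, (K <= t)%N -> 1 - join_rate p M t <= z,
       (K <= T * 2 ^ n)%N /\ (m * T + (1 + T.-1 * b) <= n %/ 8)%N &
       (1 - rho) ^+ m + (n%:R * del + n%:R * z) <= (s + 2)%:R * expR (- (j.+1%:R * ln n%:R))].
Proof.
move=> s_gt0 beta0 beta1.
(* [T] will lie between [l / A] and [2 * l / A], so that [s.+1 * T <= l / 2] and [rho] can be
   n^(-1/2). As [A * T >= l], the value of [B] makes [expR (- (B * t))] at most n^-(j+2) for
   [t >= T]. *)
pose A : R := 4 * s.+1%:R.
pose B : R := A * (j + 2)%:R.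
pose S2 : R := 2 ^+ s.
pose eps : R := (64 * S2 * (B + 2))^-1.
pose g : R := beta / A.
have s1 : 1 <= s.+1%:R :> R by rewrite ler1n.
have A4 : 4 <= A by rewrite /A; lra.
have A0 : 0 < A by lra.
have j2 : 2 <= (j + 2)%:R :> R by rewrite ler_nat leq_addl.
have B0 : 0 <= B by rewrite mulr_ge0 //; lra.
have S21 : 1 <= S2 by rewrite exprn_ege1 // ler1n.
have den0 : 128 <= 64 * S2 * (B + 2).
  have : 0 <= (S2 - 1) * (B + 2) by rewrite mulr_ge0 //; lra.
  by lra.
have eps0 : 0 < eps by rewrite invr_gt0; lra.
have eps_den : eps * (64 * S2 * (B + 2)) = 1 by rewrite mulVf // gt_eqF //; lra.
have eps128 : eps <= 128^-1 by rewrite lef_pV2 ?posrE; lra.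
have epsS : eps * (64 * S2) <= 1.
  rewrite -[X in _ <= X]eps_den [X in _ <= X]mulrA ler_peMr //; last lra.
  by rewrite !mulr_ge0 //; lra.
have g0 : 0 < g by rewrite divr_gt0.
have g1 : g <= 1 by rewrite ler_pdivrMr //; lra.
have bg0 : 0 < beta * g ^+ s.-1 by rewrite mulr_gt0 ?exprn_gt0.
have bs0 : 0 < beta ^+ s by rewrite exprn_gt0.
(* [c1] is demanded by the nucleus, [c2] by the doubling, [c3] by the final absorption. *)
pose c1 : R := 64 * S2 * A ^+ s / beta ^+ s.
pose c2 : R := 32 * S2 * (B + 2) / (beta * g ^+ s.-1).
pose c3 : R := (j + 2)%:R / (beta * eps).
have c1_0 : 0 < c1 by rewrite divr_gt0 // !mulr_gt0 ?exprn_gt0 //; lra.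
have c2_0 : 0 < c2 by rewrite divr_gt0 // !mulr_gt0 //; lra.
have c3_0 : 0 < c3 by rewrite divr_gt0 ?mulr_gt0 //; lra.
exists (c1 + c2 + c3); first lra.
move=> c cc.
have cle1 : c1 <= c by lra.
have cle2 : c2 <= c by lra.
have cle3 : c3 <= c by lra.
have c0 : 0 < c by lra.
have [N1 N1P] := ln_nat_large A.
have [N2 N2P] := @ln_nat_poly R eps 1 eps0.
have jp0 : 0 < (64 * j.+1%:R)^-1 :> R by rewrite invr_gt0 mulr_gt0 ?ltr0n.
have [N3 N3P] := @ln_nat_poly R _ 2 jp0.
exists (N1 + N2 + N3 + 64)%N => n Nn p M p01 p_mono p_min p_prod M_ge.
have n_gt0 : (0 < n)%N by clear -Nn; lia.
have n64 : (64 <= n)%N by clear -Nn; lia.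
have lA : A <= ln n%:R by apply: N1P; clear -Nn; lia.
have le_eps : ln n%:R ^+ 1 <= eps * expR (ln n%:R / 2) :> R by apply: N2P; clear -Nn; lia.
have l_sq : ln n%:R ^+ 2 <= (64 * j.+1%:R)^-1 * expR (ln n%:R / 2) :> R by apply: N3P; clear -Nn; lia.
have el : expR (ln n%:R) = n%:R :> R by exact: expR_ln_nat.
move: (ln n%:R) lA le_eps l_sq el p_min p_prod => l lA le_eps l_sq el p_min p_prod.
clear N1P N2P N3P jp0 cc N1 N2 N3 Nn.
have n0 : 0 < n%:R :> R by rewrite ltr0n.
have n64R : 64 <= n%:R :> R by rewrite ler_nat.
have l1 : 1 <= l by lra.
have l0 : 0 < l by lra.
have l_eps : l <= eps * n%:R.
  rewrite expr1 in le_eps; apply: le_trans le_eps _; rewrite ler_pM2l // -el ler_expR; lra.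
have l64 : 64 * S2 * l <= n%:R.
  have S20 : 0 <= 64 * S2 by lra.
  apply: le_trans (ler_wpM2l S20 l_eps) _; rewrite mulrA ler_piMl //; lra.
have [T_ge T_le] : l / A <= (Num.trunc (2 * l / A))%:R /\ (Num.trunc (2 * l / A))%:R <= 2 * l / A.
  have [|h1 h2] := @truncn_half R (2 * l / A); first by rewrite ler_pdivlMr //; lra.
  by split => //; move: h1; have -> : 2 * l / A / 2 = l / A by field; rewrite gt_eqF.
move: (Num.trunc _) T_ge T_le => T T_ge T_le.
have [b_ge b_le] : n%:R / (64 * l) <= (Num.trunc (n%:R / (32 * l)))%:R /\
    (Num.trunc (n%:R / (32 * l)))%:R <= n%:R / (32 * l).
  have l320 : 0 < 32 * l by lra.
  have [|h1 h2] := @truncn_half R (n%:R / (32 * l)).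
    rewrite ler_pdivlMr //; apply: le_trans l64; rewrite mulrA ler_pM2r //; lra.
  by split => //; move: h1; have -> : n%:R / (32 * l) / 2 = n%:R / (64 * l) by field; rewrite gt_eqF.
move: (Num.trunc _) b_ge b_le => b b_ge b_le.
pose K := (Num.trunc (eps * n%:R)).+1.
have K_ge : eps * n%:R <= K%:R by apply/ltW/truncnS_gt.
have en0 : 0 <= eps * n%:R by rewrite mulr_ge0 // ltW.
have K_le t : (t < K)%N -> t%:R <= eps * n%:R.
  rewrite ltnS => tK; apply: le_trans (_ : (Num.trunc (eps * n%:R))%:R <= _); first by rewrite ler_nat.
  by rewrite truncn_le.
have K_gt t : t%:R <= eps * n%:R -> (t < K)%N.
  by move=> h; rewrite -(ltr_nat R); apply: le_lt_trans h (truncnS_gt _).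
clearbody K.
have T_l : T%:R <= l.
  by apply: le_trans T_le _; rewrite ler_pdivrMr //; nra.
have T_half : s.+1%:R * T%:R <= l / 2.
  have -> : l / 2 = s.+1%:R * (2 * l / A).
    exact: half_split.
  by rewrite ler_pM2l //; lra.
have lAT : l <= A * T%:R by move: T_ge; rewrite ler_pdivrMr // mulrC.
have T_gt0 : (0 < T)%N.
  by rewrite -(ltr_nat R); apply: lt_le_trans T_ge; rewrite divr_gt0.
have TK : (T < K)%N by apply: K_gt; apply: le_trans l_eps.
have nb : n%:R <= 64 * l * b%:R by move: b_ge; rewrite ler_pdivrMr ?mulr_gt0 // mulrC.
have bS : S2 <= b%:R.
  apply: le_trans b_ge; rewrite ler_pdivlMr ?mulr_gt0 // mulrA [S2 * 64]mulrC; exact: l64.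
have bT : (32 * (b * T) <= n)%N.
  rewrite -(ler_nat R) !natrM.
  apply: le_trans (_ : 32 * (n%:R / (32 * l) * l) <= _); last first.
    by rewrite le_eqVlt; apply/orP; left; apply/eqP; field; rewrite gt_eqF.
  by rewrite ler_pM2l // ler_pM.
(* The block size [b] also serves as the number of attempts. Allowing [n] doubling rounds is crude
   but harmless, as each fails with probability at most n^-(j+2). *)
exists T, b, K, b, (expR (- (l / 2))), (expR (- ((j + 2)%:R * l))), (s%:R * expR (- ((j + 2)%:R * l))).
split.
- split => //; rewrite ?expR_ge0 ?mulr_ge0 ?expR_ge0 //.
  apply: le_trans (_ : expR (- (s.+1%:R * T%:R)) <= _); first by rewrite ler_expR lerN2.
  apply: (nucleus_rate s_gt0 p01 p_mono n_gt0 l1 c0 beta0 beta1 p_min p_prod M_ge T_gt0 T_l A0 lAT nb bS).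
  by move: cle1; rewrite /c1 ler_pdivrMr.
- move=> t m /andP[Tt tK] nm.
  have ten := K_le t tK.
  have TtR : T%:R <= t%:R :> R by rewrite ler_nat.
  have t0 : 0 <= t%:R :> R by [].
  have gt : g <= beta * t%:R / l.
    rewrite /g -mulrA ler_pM2l // ler_pdivlMr // mulrC -[_ * _^-1]/(l / A) ler_pdivrMr //.
    by apply: le_trans lAT _; rewrite mulrC ler_pM2r.
  have t128 : 128 * t%:R <= n%:R :> R.
    apply: le_trans (_ : 128 * (eps * n%:R) <= _); first by rewrite ler_pM2l.
    by rewrite mulrA ler_piMl //; lra.
  have n16 : n%:R <= 16 * m%:R :> R.
    by move: t128; rewrite -!natrM !ler_nat; move: nm n64; clear; lia.
  have Bt : 32 * S2 * (B + 2) * t%:R <= n%:R.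
    have C0 : 0 <= 32 * S2 * (B + 2) by rewrite !mulr_ge0 //; lra.
    apply: le_trans (ler_wpM2l C0 ten) _.
    have -> : 32 * S2 * (B + 2) * (eps * n%:R) = (eps * (64 * S2 * (B + 2))) * n%:R / 2 by field.
    by rewrite eps_den; lra.
  have Bc : 32 * S2 * (B + 2) <= c * beta * g ^+ s.-1.
    by move: cle2; rewrite /c2 ler_pdivrMr // mulrA.
  have h := expansion_rate s_gt0 p01 p_mono n_gt0 l1 c0 beta0 p_min p_prod M_ge g0 g1 B0 gt n16 Bt Bc.
  apply: le_trans h _; rewrite ler_expR lerN2.
  have -> : B * t%:R = (j + 2)%:R * (A * t%:R) by rewrite /B; ring.
  rewrite ler_wpM2l //.
  by apply: le_trans lAT _; rewrite ler_pM2l.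
- move=> t Kt.
  have ent : eps * n%:R <= t%:R by apply: le_trans K_ge _; rewrite ler_nat.
  apply: le_trans (join_rate_large p01 n_gt0 l1 c0 beta0 p_min M_ge (ltW eps0) ent) _.
  rewrite ler_wpM2l // ler_expR lerN2 ler_pM2r //.
  by move: cle3; rewrite /c3 ler_pdivrMr ?mulr_gt0 // mulrA.
- split.
    have Kn : (K <= n)%N.
      rewrite leqNgt; apply/negP => /K_le; rewrite leNgt => /negP; apply.
      by rewrite gtr_pMl //; lra.
    by apply: leq_trans Kn _; apply: leq_trans (ltnW (ltn_expl n (ltnSn 1))) _; rewrite leq_pmull.
  by move: bT n64; have := leq_mul (leq_pred T) (leqnn b); clear; lia.
have -> : (s + 2)%:R * expR (- (j.+1%:R * l)) = expR (- (j.+1%:R * l)) +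
    (n%:R * expR (- ((j + 2)%:R * l)) + n%:R * (s%:R * expR (- ((j + 2)%:R * l)))) :> R.
  have -> : expR (- ((j + 2)%:R * l)) = expR (- (j.+1%:R * l)) / n%:R :> R.
    by rewrite -el -expRB; congr expR; rewrite addn2 -[j.+2%:R]natr1; ring.
  by rewrite natrD; field; rewrite gt_eqF.
rewrite lerD2r.
have e1 : expR (- (l / 2)) <= 1 :> R by rewrite expR_le1; lra.
apply: le_trans (exp_oneB_le b e1) _; rewrite ler_expR lerN2.
apply: le_trans (_ : expR (- (l / 2)) * (n%:R / (64 * l)) <= _); last first.
  by rewrite ler_pM2l ?expR_gt0.
have -> : expR (- (l / 2)) * (n%:R / (64 * l)) = expR (l / 2) / (64 * l).
  rewrite -el mulrA -expRD; congr (expR _ / _); by field.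
rewrite ler_pdivlMr ?mulr_gt0 //.
move: l_sq; rewrite mulrC ler_pdivlMr ?mulr_gt0 ?ltr0n //; apply: le_trans.
by rewrite le_eqVlt; apply/orP; left; apply/eqP; ring.
Qed.

(** * Links of (j-1)-sets *)

Lemma ffact_ge_expn (N m : nat) : ((N - m) ^ m <= N ^_ m)%N.
Proof.
suff gen i : (i <= m)%N -> ((N - m) ^ i <= N ^_ i)%N by exact: gen.
elim: i => [|i IHi] im; first by rewrite ffactn0.
by rewrite ffactnSr expnSr leq_mul ?IHi ?(ltnW im) // leq_sub2l // ltnW.
Qed.

(** [n %/ 8 - kap] is at least n/32, which bounds each factor of the falling factorial. *)
Lemma bin_ge_power (R : realType) (kap n : nat) : (64 * kap.+1 <= n)%N ->
  (32 ^ kap * kap`!)%:R^-1 * n%:R ^+ kap <= 'C(n %/ 8, kap)%:R :> R.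
Proof.
move=> n_ge.
have pos : 0 < (32 ^ kap * kap`!)%:R :> R by rewrite ltr0n muln_gt0 expn_gt0 fact_gt0.
rewrite mulrC ler_pdivrMr // -natrX -natrM ler_nat.
rewrite mulnCA bin_ffact.
apply: (@leq_trans (32 ^ kap * (n %/ 8 - kap) ^ kap)%N); last by rewrite leq_mul2l ffact_ge_expn orbT.
rewrite -expnMn; case: (kap) n_ge => // m n_ge; rewrite leq_exp2r //.
by move: n_ge; clear; lia.
Qed.

Lemma card_residue (n a : nat) : (a < 4)%N -> (n %/ 4 <= #|[set v : 'I_n | v %% 4 == a]|)%N.
Proof.
move=> a4.
have lt_n (i : 'I_(n %/ 4)) : (4 * i + a < n)%N by have := ltn_ord i; clear -a4; lia.
pose h (i : 'I_(n %/ 4)) : 'I_n := Ordinal (lt_n i).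
rewrite -[X in (X <= _)%N]card_ord -(@card_imset _ _ h).
  apply/subset_leq_card/subsetP => _ /imsetP[i _ ->]; rewrite inE /=; apply/eqP.
  by clear -a4; lia.
by move=> i i' /(congr1 val) /= e; apply: ord_inj; move: e; clear; lia.
Qed.

Section Link.
Variables (s k j n : nat) (L F : {set 'I_n}).
Hypothesis hj : (1 <= j)%N.
Hypothesis hjk : (j < k)%N.
Hypothesis cL : #|L| = j.-1.
Hypothesis dFL : [disjoint F & L].

Let V0 : {set 'I_n} := ~: (L :|: F).

(** For an edge made of [L], two further vertices and [k - j - 1] vertices of [F], this is the
    further pair. Different completions in [F] give different coordinates over the same pair, whence
    the multiplicity [M]. *)
Definition link_ends (x : 'I_s * subsets n k) : {set 'I_n} :=
  if L \subset val x.2 then val x.2 :\: (L :|: F) else set0.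

Definition link_colour (x : 'I_s * subsets n k) : 'I_s := x.1.

Lemma card_link i u v : u \in V0 -> v \in V0 -> u != v ->
  ('C(#|F|, k - j - 1) <= #|[set x | (link_colour x == i) && (link_ends x == [set u; v])]|)%N.
Proof.
rewrite !in_setC !in_setU !negb_or => /andP[uL uF] /andP[vL vF] nuv.
rewrite -cards_draws.
set A := [set x | _].
apply: leq_trans (leq_imset_card (fun x => val x.2 :&: F) A).
apply/subset_leq_card/subsetP => Q; rewrite inE => /andP[sQ /eqP cQ].
have dQL : [disjoint Q & L] by exact: disjointWl sQ dFL.
pose e := L :|: ([set u; v] :|: Q).
have ce : #|e| == k.
  have uQ : u \notin Q by apply: contra uF; exact: (subsetP sQ).
  have vQ : v \notin Q by apply: contra vF; exact: (subsetP sQ).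
  have c1 : #|[set u; v] :|: Q| = (2 + (k - j - 1))%N.
    rewrite cardsU cards2 nuv cQ (_ : [set u; v] :&: Q = set0) ?cards0 ?subn0 //.
    apply/setP => y; rewrite !inE; apply/negP => /andP[/orP[] /eqP->]; exact/negP.
  rewrite cardsU c1 cL (_ : L :&: _ = set0) ?cards0 ?subn0.
    by apply/eqP; clear -hj hjk; lia.
  apply/setP => y; rewrite !inE; apply/negP => /andP[yL /orP[/orP[] /eqP ey | yQ]].
  - by rewrite -ey yL in uL.
  - by rewrite -ey yL in vL.
  - by rewrite (disjointFr dQL yQ) in yL.
apply/imsetP; exists (i, exist _ e ce); last first.
  apply/setP => y; rewrite !inE /=.
  case: (boolP (y \in F)) => yF; rewrite ?andbF ?andbT; last first.
    by apply/negP => yQ; rewrite (subsetP sQ _ yQ) in yF.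
  rewrite (disjointFr dFL yF) /=.
  case: (eqVneq y u) => [ey | _]; first by rewrite -ey yF in uF.
  by case: (eqVneq y v) => [ey | _] //; rewrite -ey yF in vF.
rewrite inE /link_colour /= eqxx /= /link_ends /= subsetUl; apply/eqP/setP => y; rewrite !inE.
case: (boolP (y \in L)) => yL /=.
  case: (eqVneq y u) => [ey | _]; first by rewrite -ey yL in uL.
  by case: (eqVneq y v) => [ey | _] //; rewrite -ey yL in vL.
case: (boolP (y \in F)) => yF /=.
  case: (eqVneq y u) => [ey | _]; first by rewrite -ey yF in uF.
  by case: (eqVneq y v) => [ey | _] //; rewrite -ey yF in vF.
case: (boolP (y \in Q)) => yQ; rewrite ?orbF //.
by rewrite (subsetP sQ _ yQ) in yF.
Qed.

Lemma link_extension u : u \notin L -> exists J : subsets n j, val J = u |: L.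
Proof.
move=> uL; have c : #|u |: L| == j by rewrite cardsU1 uL cL add1n prednK.
by exists (exist (fun A : {set 'I_n} => #|A| == j) _ c).
Qed.

(** If [u] is jointly adjacent to vertices with label [a], every colour has an edge containing
    [u |: L] and some [v |: L] with that label, so stability passes the label to [u |: L]. *)
Lemma link_closed (om : {set 'I_s * subsets n k}) (T : eqType) (f : subsets n j -> T) (a : T) :
  (0 < s)%N -> stable (graph_of om) f ->
  closed_set link_colour link_ends V0 om
    [set v in V0 | [exists J : subsets n j, (val J == v |: L) && (f J == a)]].
Proof.
move=> s0 stf u S uV sS /jadjP adj; rewrite inE uV /=.
have memC v : v \in S -> exists2 J : subsets n j, val J = v |: L & f J = a.
  move/(subsetP sS); rewrite inE => /andP[_ /existsP[J /andP[/eqP eJ /eqP fJ]]].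
  by exists J.
have uL : u \notin L by move: uV; rewrite in_setC in_setU negb_or => /andP[].
have [Ju eJu] := link_extension uL.
have [x0 [v0 [_ _ v0S _]]] := adj (Ordinal s0).
have [J0 eJ0 fJ0] := memC v0 v0S.
apply/existsP; exists Ju; rewrite eJu eqxx /= -fJ0; apply/eqP; apply: stf => i.
have [[i' E] [v [xom xi vS xuv]]] := adj i.
have [Jv eJv fJv] := memC v vS.
move: xuv xi; rewrite /link_ends /link_colour /=; case: ifP => [LE xuv xi | _ /setP/(_ u)]; last first.
  by rewrite !inE eqxx.
have sE : [set u; v] \subset val E by rewrite -xuv subsetDl.
exists E; first by rewrite ffunE inE -xi.
exists Ju, Jv; rewrite fJ0 fJv eJu eJv; split => //.
  by rewrite subUset LE sub1set (subsetP sE) // !inE eqxx.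
by rewrite subUset LE sub1set (subsetP sE) // !inE eqxx orbT.
Qed.

End Link.

(** Exchanging a vertex of [J] outside [J'] for one of [J'] outside [J] keeps the other [j.-1]
    elements and shrinks the difference. *)
Lemma exchange_connected (n j : nat) (T : Type) (f : subsets n j -> T) :
  (forall (L : {set 'I_n}) (J J' : subsets n j) u v, #|L| = j.-1 -> u \notin L -> v \notin L ->
     val J = u |: L -> val J' = v |: L -> f J = f J') ->
  forall J J', f J = f J'.
Proof.
move=> step J J'.
have [m] := ubnP #|val J :\: val J'|; elim: m J => // m IHm J; rewrite ltnS => cm.
have cJ := eqP (valP J); have cJ' := eqP (valP J').
have cD : #|val J :\: val J'| = #|val J' :\: val J|.
  have := cardsID (val J') (val J); have := cardsID (val J) (val J').
  by rewrite cJ cJ' setIC; clear; lia.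
have [D0 | ] := eqVneq (val J :\: val J') set0.
  have -> // : J = J'; apply/val_inj/eqP; rewrite eqEcard cJ cJ' leqnn andbT.
  by rewrite -setD_eq0 D0.
case/set0Pn => u uD; have : (0 < #|val J' :\: val J|)%N by rewrite -cD (cardsD1 u) uD.
case/card_gt0P => v vD.
move: (uD) (vD); rewrite !inE => /andP[uJ' uJ] /andP[vJ vJ'].
pose L := val J :\ u.
have cL : #|L| = j.-1 by have := cardsD1 u (val J); rewrite uJ cJ /L; clear; lia.
have j0 : (0 < j)%N by rewrite -cJ (cardsD1 u) uJ.
have vL : v \notin L by rewrite !inE negb_and vJ orbT.
have uL : u \notin L by rewrite !inE eqxx.
have c1 : #|v |: L| == j by rewrite cardsU1 vL cL add1n prednK.
pose J1 : subsets n j := exist (fun A : {set 'I_n} => #|A| == j) _ c1.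
have vJ1 : val J1 = v |: L by [].
rewrite (step L J J1 u v) ?setD1K //.
apply: IHm; apply: leq_trans cm; apply: proper_card; apply/properP; split.
  apply/subsetP => x; rewrite vJ1 in_setD => /andP[xJ' xJ1]; rewrite in_setD xJ' /=.
  move: xJ1; rewrite !inE => /orP[/eqP ex | /andP[_ //]].
  by rewrite ex vJ' in xJ'.
exists u => //; rewrite vJ1 in_setD uJ' /= !inE eqxx /= orbF.
by apply: contraNneq vJ => <-.
Qed.

(** The reason for quarters: two exchanged vertices occupy at most two residues, leaving one class
    for the completing vertices and one for the doubling, so that both vertices lie in the target
    set. *)
Lemma avoid_two_residues (x y : nat) : (x < 4)%N -> (y < 4)%N ->
  exists a b : 'I_4, [/\ a != b, x != a, x != b, y != a & y != b].
Proof.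
have I0 : (0 < 4)%N by []. have I1 : (1 < 4)%N by []. have I2 : (2 < 4)%N by []. have I3 : (3 < 4)%N by [].
move: x y => [|[|[|[|x]]]] [|[|[|[|y]]]] // _ _.
all: first [ by exists (Ordinal I0), (Ordinal I1) | by exists (Ordinal I0), (Ordinal I2)
           | by exists (Ordinal I0), (Ordinal I3) | by exists (Ordinal I1), (Ordinal I2)
           | by exists (Ordinal I1), (Ordinal I3) | by exists (Ordinal I2), (Ordinal I3) ].
Qed.

(** * Percolation from exploring all links at once *)

Section Supercritical.
Variables (R : realType) (s k j : nat).
Hypothesis hj : (1 <= j)%N.
Hypothesis hjk : (j < k)%N.
Hypothesis s_gt0 : (0 < s)%N.

Definition residue_block n (L : {set 'I_n}) (a : 'I_4) : {set 'I_n} :=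
  [set v : 'I_n | (v %% 4 == a)%N] :\: L.

Definition link_target n (L : {set 'I_n}) (a b : 'I_4) : {set 'I_n} :=
  ~: (L :|: residue_block L a) :\: residue_block L b.

Lemma card_residue_block n (L : {set 'I_n}) (a : 'I_4) : #|L| = j.-1 -> (16 * j + 16 <= n)%N ->
  (n %/ 8 <= #|residue_block L a|)%N.
Proof.
move=> cL nj; have := card_residue n (ltn_ord a); set A := [set v | _] => cA.
have := cardsID L A; have := subset_leq_card (subsetIr A L).
rewrite cL /residue_block -/A; move: cA nj; clear.
by move: #|A| #|A :&: L| #|A :\: L| => x y z; clear A; lia.
Qed.

Lemma card_link_target n (L : {set 'I_n}) (a b : 'I_4) : #|L| = j.-1 -> (16 * j + 16 <= n)%N ->
  (n %/ 8 <= #|link_target L a b|)%N.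
Proof.
move=> cL nj; have [e [_ [_ ae _ be _]]] := avoid_two_residues (ltn_ord a) (ltn_ord b).
apply: leq_trans (card_residue_block e cL nj) _; apply/subset_leq_card/subsetP => v.
rewrite !inE => /andP[vL /eqP ve]; rewrite (negbTE vL) /= ve.
by rewrite ![e == _ :> nat]eq_sym ae be.
Qed.

(** All pairs of distinct residues are included, because the suitable pair depends on the two
    vertices to be exchanged. *)
Definition all_explored n (T K : nat) (om : {set 'I_s * subsets n k}) :=
  [forall L : subsets n j.-1, [forall a : 'I_4, [forall b : 'I_4, (a != b) ==>
    explored (@link_colour s k n) (@link_ends s k n (val L) (residue_block (val L) a))
      (link_target (val L) a b) T (residue_block (val L) b) K n om]]].

Lemma all_explored_percolates n T K (om : {set 'I_s * subsets n k}) : (j <= n)%N ->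
  all_explored T K om -> percolates j (graph_of om).
Proof.
move=> jn /forallP expl; apply: stable_percolates => // f stf.
apply: exchange_connected => L J J' u v cL uL vL eJ eJ'.
have [||a [b [nab ua ub va vb]]] := @avoid_two_residues (u %% 4)%N (v %% 4)%N; rewrite ?ltn_pmod //.
have cL' : #|L| == j.-1 by rewrite cL.
have := expl (exist (fun A : {set 'I_n} => #|A| == j.-1) _ cL') => /forallP/(_ a)/forallP/(_ b).
rewrite nab /= => ex.
have sub : link_target L a b \subset ~: (L :|: residue_block L a) by exact: subsetDl.
have subW : residue_block L b \subset ~: (L :|: residue_block L a).
  apply/subsetP => x; rewrite !inE => /andP[xL /eqP xb]; rewrite xL (negbTE xL) /= xb.
  by apply: contra nab => /eqP e; apply/eqP/val_inj.
have [v0 v0U all_C] := explored_sound sub subW ex.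
have v0L : v0 \notin L by move: (subsetP sub _ v0U); rewrite in_setC in_setU negb_or => /andP[].
have [J0 eJ0] := link_extension hj cL v0L.
have inU x : x \notin L -> (x %% 4 != a)%N -> (x %% 4 != b)%N -> x \in link_target L a b.
  by move=> xL xa xb; rewrite !inE (negbTE xL) /= xa xb.
have sU : link_target L a b \subset
    [set v in ~: (L :|: residue_block L a) |
       [exists J : subsets n j, (val J == v |: L) && (f J == f J0)]].
  apply: all_C; first exact: link_closed.
  rewrite inE (subsetP sub) //=; apply/existsP; exists J0; by rewrite eJ0 !eqxx.
have lab x (Jx : subsets n j) : x \in link_target L a b -> val Jx = x |: L -> f Jx = f J0.
  move=> /(subsetP sU); rewrite inE => /andP[_ /existsP[J1 /andP[/eqP e1 /eqP <-]]] ex1.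
  by congr f; apply: val_inj; rewrite e1.
by rewrite (lab u J) ?(lab v J') ?inU.
Qed.

(** At most [16 * n^(j-1)] choices of [L] and residues, each failing with probability at most
    [(s + 2) * n^-(j+1)], give a total of order n^-2. *)
Lemma supercritical : exists2 c0 : R, 0 < c0 & forall c, c0 <= c -> forall eps : R, 0 < eps ->
  exists N : nat, forall n, (N <= n)%N -> forall p : 'I_s -> R, (forall i, 0 <= p i <= 1) ->
    (forall i i' : 'I_s, (i <= i')%N -> p i <= p i') ->
    (forall i, c * ln n%:R / n%:R ^+ (k - j) <= p i) ->
    (forall r, (2 <= r <= s)%N ->
      c / (n%:R ^+ (r * (k - j - 1) + 1) * ln n%:R ^+ (r - 1)) <= \prod_(i < s | (i < r)%N) p i) ->
  prob (colour_weight (X := subsets n k) p) (fun om => ~~ `[< percolates j (graph_of om) >]) <= eps.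
Proof.
pose kap := (k - j - 1)%N.
have kapS : (k - j)%N = kap.+1 by rewrite /kap; clear -hjk; lia.
pose beta : R := (32 ^ kap * kap`!)%:R^-1.
have bpos : (0 < 32 ^ kap * kap`!)%N by rewrite muln_gt0 expn_gt0 fact_gt0.
have beta0 : 0 < beta by rewrite invr_gt0 ltr0n.
have beta1 : beta <= 1 by rewrite invf_le1 ?ltr0n // ler1n.
have [c0 c0_gt0 par] := @exploration_parameters R s kap j beta s_gt0 beta0 beta1.
exists c0 => // c cc0 eps eps0; have [N1 N1P] := par c cc0.
have [N2 N2P] : exists N2 : nat, (16 * (s + 2))%:R / eps <= N2%:R.
  by exists (Num.trunc ((16 * (s + 2))%:R / eps)).+1; exact/ltW/truncnS_gt.
exists (N1 + 64 * kap.+1 + 16 * j + 16 + N2)%N.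
move=> n Nn p p01 p_mono p_min p_prod.
have nj : (16 * j + 16 <= n)%N by clear -Nn; lia.
have n_gt0 : (0 < n)%N by clear -Nn; lia.
have nk : (64 * kap.+1 <= n)%N by clear -Nn; lia.
have nN : (N1 <= n)%N by clear -Nn; lia.
have n_eps : (16 * (s + 2))%:R / eps <= n%:R.
  by apply: le_trans N2P _; rewrite ler_nat; clear -Nn; lia.
have n0 : 0 < n%:R :> R by rewrite ltr0n.
rewrite kapS in p_min.
pose M := 'C(n %/ 8, kap).
have M_ge : beta * n%:R ^+ kap <= M%:R by exact: bin_ge_power.
have [T [b [K [m [rho [del [z [[T0 rho_le TK del0 z0] Hdel Hz [K_d cU] total]]]]]]]] :=
  N1P n nN p M p01 p_mono p_min p_prod M_ge.
have w01 : forall x, 0 <= colour_weight (X := subsets n k) p x <= 1 by exact: colour_weight01.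
pose E0 : R := (s + 2)%:R * expR (- (j.+1%:R * ln n%:R)).
have one (L : subsets n j.-1) (a b' : 'I_4) : a != b' ->
    prob (colour_weight (X := subsets n k) p) (fun om => ~~
      explored (@link_colour s k n) (@link_ends s k n (val L) (residue_block (val L) a))
      (link_target (val L) a b') T (residue_block (val L) b') K n om) <= E0.
  move=> nab; have cL := eqP (valP L).
  have dFL : [disjoint residue_block (val L) a & val L].
    by rewrite disjoints_subset; apply/subsetP => x; rewrite !inE => /andP[].
  have sub : link_target (val L) a b' \subset ~: (val L :|: residue_block (val L) a) by exact: subsetDl.
  have subW : residue_block (val L) b' \subset ~: (val L :|: residue_block (val L) a).
    apply/subsetP => x; rewrite !inE => /andP[xL /eqP xb]; rewrite xL (negbTE xL) /= xb.
    by apply: contra nab => /eqP e; apply/eqP/val_inj.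
  have dUW : [disjoint link_target (val L) a b' & residue_block (val L) b'].
    by rewrite disjoints_subset; apply/subsetP => x; rewrite !inE => /andP[].
  have cardM i u v : u \in ~: (val L :|: residue_block (val L) a) ->
      v \in ~: (val L :|: residue_block (val L) a) -> u != v ->
      (M <= #|[set x | (@link_colour s k n x == i) &&
                (@link_ends s k n (val L) (residue_block (val L) a) x == [set u; v])]|)%N.
    move=> uV vV nuv; apply: leq_trans (card_link hj hjk cL dFL i uV vV nuv).
    by apply: leq_bin2l; apply: card_residue_block.
  have cU' : (m * T + (1 + T.-1 * b) <= #|link_target (val L) a b'|)%N.
    by apply: leq_trans cU _; apply: card_link_target.
  have := prob_not_explored p01 cardM sub T0 rho_le subW dUW TK del0 Hdel Hz
    (card_residue_block b' cL nj) K_d cU'.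
  move=> h; apply: le_trans h _; apply: le_trans total; rewrite lerD2l lerD2l ler_wpM2r // ler_nat.
  by rewrite (leq_trans (max_card _)) // card_ord.
apply: le_trans (_ : prob (colour_weight (X := subsets n k) p) (fun om =>
   [exists y : subsets n j.-1 * ('I_4 * 'I_4), (y.2.1 != y.2.2) && ~~
      explored (@link_colour s k n) (@link_ends s k n (val y.1) (residue_block (val y.1) y.2.1))
      (link_target (val y.1) y.2.1 y.2.2) T (residue_block (val y.1) y.2.2) K n om]) <= _).
  apply: le_prob => // om; apply: contraR => none; apply/asboolP.
  apply: (@all_explored_percolates n T K); first by clear -nj; lia.
  apply/forallP => L; apply/forallP => a; apply/forallP => b'; apply/implyP => nab.
  by apply: contraR none => nex; apply/existsP; exists (L, (a, b')); rewrite /= nab.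
apply: le_trans (prob_exists w01 _ _) _.
have E00 : 0 <= E0 by rewrite mulr_ge0 ?expR_ge0.
apply: le_trans (_ : \sum_(y : subsets n j.-1 * ('I_4 * 'I_4)) E0 <= _).
  apply: le_trans (_ : \sum_(y : subsets n j.-1 * ('I_4 * 'I_4) | y.2.1 != y.2.2) E0 <= _).
    by apply: ler_sum => -[L [a b']] /=; apply: one.
  by rewrite [X in X <= _]big_mkcond /=; apply: ler_sum => y _; case: ifP.
rewrite sumr_const !card_prod !card_ord card_subsets -[E0 *+ _]mulr_natl.
apply: le_trans (_ : (n ^ j.-1 * 16)%:R * E0 <= _).
  rewrite ler_wpM2r // ler_nat leq_mul2r; apply/orP; right.
  by apply: leq_trans (bin_le_expn _ _); rewrite leq_pmulr // fact_gt0.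
have -> : (n ^ j.-1 * 16)%:R * E0 = (16 * (s + 2))%:R / n%:R ^+ 2.
  rewrite /E0 expRN expRM_natl expR_ln_nat // -(prednK hj) [n%:R ^+ _.+2]exprS [n%:R ^+ _.+1]exprS /=.
  rewrite !natrM natrX; field.
  by rewrite expf_neq0 gt_eqF.
rewrite ler_pdivrMr ?exprn_gt0 //.
rewrite ler_pdivrMr // in n_eps; apply: le_trans n_eps _.
by rewrite mulrC ler_pM2l // expr2 ler_peMr ?ler1n // ltW.
Qed.

End Supercritical.

(** * Transfer to the measure of the statement *)

Section GraphMeasure.
Variables (R : realType) (s k n : nat) (p : 'I_s -> R).

Lemma sfold_graph_mass_graph_of (om : {set 'I_s * subsets n k}) :
  sfold_graph_mass p (graph_of om) = mass (colour_weight (X := subsets n k) p) om.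
Proof.
rewrite /sfold_graph_mass /mass pair_big /=; apply: eq_bigr => -[i e] _.
by rewrite ffunE inE.
Qed.

Lemma sfold_graph_probE (A : sfold_graph s k n -> Prop) :
  sfold_graph_prob p A = prob (colour_weight (X := subsets n k) p) (fun om => `[< A (graph_of om) >]).
Proof.
pose set_of (H : sfold_graph s k n) := [set x : 'I_s * subsets n k | x.2 \in H x.1].
rewrite /sfold_graph_prob (reindex (@graph_of s k n)) /=; last first.
  exists set_of => [om _ | H _]; first by apply/setP => -[i e]; rewrite inE ffunE inE.
  by apply/ffunP => i; rewrite ffunE; apply/setP => e; rewrite !inE.
rewrite big_mkcond; apply: eq_bigr => om _; rewrite sfold_graph_mass_graph_of.
by case: asboolP; rewrite ?mulr1 ?mulr0.
Qed.

End GraphMeasure.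

From mathcomp Require Import classical_sets topology normedtype.
Import numFieldTopology.Exports numFieldNormedType.Exports.
Local Open Scope classical_set_scope.
Local Open Scope ring_scope.

Lemma whpI (R : realType) (s k : nat) (p : nat -> 'I_s -> R) (A : forall n, sfold_graph s k n -> Prop) :
  (forall n i, 0 <= p n i <= 1) ->
  (forall eps : R, 0 < eps -> exists N : nat, forall n, (N <= n)%N ->
     prob (colour_weight (X := subsets n k) (p n)) (fun om => ~~ `[< A n (graph_of om) >]) <= eps) ->
  whp p A.
Proof.
move=> p01 small; apply/cvgrPdist_le => eps eps0; have [N NP] := small eps eps0.
exists N => // n /= Nn; rewrite sfold_graph_probE -probC ger0_norm; first exact: NP.
apply: prob_ge0; exact: colour_weight01.
Qed.

Theorem theorem4p2 (R : realType) (s k j : nat)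
    (hj : (1 <= j)%N) (hjk : (j < k)%N) (hs : (2 <= s)%N) :
  exists c : R, 0 < c /\
  forall p : nat -> 'I_s -> R,
    (forall n i, 0 <= p n i <= 1) ->
    (forall n (i i' : 'I_s), (i <= i')%N -> p n i <= p n i') ->
    ((\forall n \near \oo,
        p n (Ordinal (ltnW hs)) <= ln n%:R / (c * n%:R ^+ (k - j)) \/
        exists r : nat, (2 <= r <= s)%N /\
          \prod_(i < s | (i < r)%N) p n i <=
            1 / (c * n%:R ^+ (r * (k - j - 1) + 1) * ln n%:R ^+ (r - 1))) ->
      whp p (fun n (H : sfold_graph s k n) => ~ percolates j H))
    /\
    ((\forall n \near \oo,
        p n (Ordinal (ltnW hs)) >= c * ln n%:R / n%:R ^+ (k - j) /\
        forall r : nat, (2 <= r <= s)%N ->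
          \prod_(i < s | (i < r)%N) p n i >=
            c / (n%:R ^+ (r * (k - j - 1) + 1) * ln n%:R ^+ (r - 1))) ->
      whp p (fun n (H : sfold_graph s k n) => percolates j H)).
Proof.
have [c1 c1_gt0 sub] := @subcritical_product R s k j hj hjk.
have [c2 c2_gt0 super] := @supercritical R s k j hj hjk (ltnW hs).
(* All three bounds hold for every larger constant, so the sum serves both parts. *)
exists (c1 + c2 + 4); split; first lra.
have c1_le : c1 <= c1 + c2 + 4 by lra.
have c2_le : c2 <= c1 + c2 + 4 by lra.
have c4_le : 4 <= c1 + c2 + 4 by lra.
move=> p p01 p_mono; split => -[N0 _ N0P]; apply: whpI => // eps eps0.
  have [N1 N1P] := sub _ c1_le eps eps0.
  have [N2 N2P] := @subcritical_isolated R s k j hj hjk _ c4_le eps eps0.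
  exists (N0 + N1 + N2)%N => n Nn.
  have -> : prob (colour_weight (X := subsets n k) (p n)) (fun om => ~~ `[< ~ percolates j (graph_of om) >]) =
      prob (colour_weight (X := subsets n k) (p n)) (fun om => `[< percolates j (graph_of om) >]).
    by apply: eq_prob => om; rewrite asbool_neg negbK.
  have n0 : (N0 <= n)%N by clear -Nn; lia.
  (* Which alternative holds, and with which [r], may change with [n]; [N1] and [N2] are uniform in
     [r] and in the probabilities. *)
  case: (N0P n n0) => [le_p | [r [rs le_p]]].
    by apply: N2P le_p => //; clear -Nn; lia.
  by apply: N1P rs le_p => //; clear -Nn; lia.
have [N1 N1P] := super _ c2_le eps eps0.
exists (N0 + N1)%N => n Nn.
have n0 : (N0 <= n)%N by clear -Nn; lia.
have [p_ge prod_ge] := N0P n n0.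
apply: N1P => //; first by clear -Nn; lia.
  exact: p_mono.
by move=> i; apply: le_trans p_ge _; apply: p_mono.
Qed.
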